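(* Fix a self-adjoint boundary condition $AY(a)+BY(b)=0$. Then for any $n\in\mathbb N_0$, the $n$-th eigenvalue of the problem consisting of $-(y^{[1]})'+sy^{[1]}+qy=\lambda ry$ on $(a,b)$ and this boundary condition depends continuously on the coefficients of the differential equation; that is, $\omega\mapsto\lambda_n(\omega)$ is a continuous function on the metric space $(\tilde\Omega,d)$ of coefficients $\omega=(1/p,q,r,s)$.
   Context: Let $J=(a,b)$ with $-\infty<a<b<\infty$. $\tilde\Omega$ is the set of all $\omega=(1/p,q,r,s)$ with $p,q,r,s$ real-valued, $1/p,q,r,s\in L^1(J,\mathbb R)$, $p>0$ and $r>0$ a.e. on $J$, with the metric $$d(\omega,\omega_0)=\int_a^b\left(\left|\tfrac1p-\tfrac1{p_0}\right|+|q-q_0|+|r-r_0|+|s-s_0|\right)$$ for $\omega=(1/p,q,r,s)$, $\omega_0=(1/p_0,q_0,r_0,s_0)$. For given $\omega$, put $y^{[1]}=p(y'+sy)$ and $Y=(y,y^{[1]})^T$; solutions of the equation are functions $y$ with $y,y^{[1]}$ absolutely continuous on $[a,b]$. A self-adjoint boundary condition is $AY(a)+BY(b)=0$ with complex $2\times2$ matrices $A,B$ such that $(A|B)$ has rank $2$ and $AEA^*=BEB^*$, $E=\begin{pmatrix}0&-1\\1&0\end{pmatrix}$. An eigenvalue is a $\lambda$ for which there is a nontrivial solution satisfying the boundary condition; the eigenvalues are real and, counted with multiplicity, are ordered as a non-decreasing sequence indexed by $n\in\mathbb N_0=\{0,1,2,\ldots\}$ tending to $+\infty$; $\lambda_n(\omega)$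 is the $n$-th one. *)

(* Defs.v *)
From HB Require Import structures.
From mathcomp Require Import all_boot all_order all_algebra.
From mathcomp Require Import complex.
From mathcomp Require Import all_classical all_reals all_analysis.

Set Implicit Arguments.
Unset Strict Implicit.
Unset Printing Implicit Defensive.

Import Order.TTheory GRing.Theory Num.Theory.
Import numFieldNormedType.Exports.

Local Open Scope classical_set_scope.
Local Open Scope ring_scope.
Local Open Scope complex_scope.
Local Open Scope sesquilinear_scope.

Definition abs_continuous (R : realType) (a b : R) (f : R -> R) : Prop :=
  forall eps : R, 0 < eps -> exists2 delta : R, 0 < delta &
    forall (n : nat) (u v : 'I_n -> R),
      (forall i, [/\ a <= u i, u i <= v i & v i <= b]) ->
      trivIset [set: 'I_n] (fun i => `]u i, v i[%classic) ->
      \sum_(i < n) (v i - u i) < delta ->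
      \sum_(i < n) `|f (v i) - f (u i)| < eps.

(* R[i] carries no normed-module structure over R, so absolute continuity and
   differentiability of complex-valued functions of a real variable are
   expressed through real and imaginary parts. *)
Definition cabs_continuous (R : realType) (a b : R) (f : R -> R[i]) : Prop :=
  abs_continuous a b (fun x => complex.Re (f x)) /\
  abs_continuous a b (fun x => complex.Im (f x)).

Definition is_cderive (R : realType) (x : R) (f : R -> R[i]) (df : R[i]) : Prop :=
  is_derive x 1 (fun t => complex.Re (f t)) (complex.Re df) /\
  is_derive x 1 (fun t => complex.Im (f t)) (complex.Im df).

(* The point (1/p, q, r, s) of the coefficient space, stored through p itself,
   which is determined by 1/p where p <> 0. *)
Record coefficients (R : realType) := Coefficients {
  coef_p : R -> R;
  coef_q : R -> R;
  coef_r : R -> R;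
  coef_s : R -> R }.

Definition coef_space (R : realType) (a b : R) : set (coefficients R) :=
  [set om | let J := `]a, b[%classic in
    [/\ [/\ lebesgue_measure.-integrable J (fun x => ((coef_p om x)^-1)%:E),
            lebesgue_measure.-integrable J (fun x => (coef_q om x)%:E),
            lebesgue_measure.-integrable J (fun x => (coef_r om x)%:E) &
            lebesgue_measure.-integrable J (fun x => (coef_s om x)%:E)],
        {ae lebesgue_measure, forall x, J x -> 0 < coef_p om x} &
        {ae lebesgue_measure, forall x, J x -> 0 < coef_r om x}]].

Definition coef_dist (R : realType) (a b : R) (om om0 : coefficients R) : R :=
  \int[lebesgue_measure]_(x in `]a, b[)
    (`|(coef_p om x)^-1 - (coef_p om0 x)^-1| + `|coef_q om x - coef_q om0 x|
     + `|coef_r om x - coef_r om0 x| + `|coef_s om x - coef_s om0 x|).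

(* [y1] is the (absolutely continuous representative of the) quasi-derivative
   p (y' + s y) of the solution [y]. *)
Definition is_solution (R : realType) (a b : R) (om : coefficients R)
    (z : R[i]) (y y1 : R -> R[i]) : Prop :=
  [/\ cabs_continuous a b y, cabs_continuous a b y1 &
    {ae lebesgue_measure, forall x : R, `]a, b[%classic x ->
      exists dy dy1 : R[i],
      [/\ is_cderive x y dy, is_cderive x y1 dy1,
          y1 x = (coef_p om x)%:C * (dy + (coef_s om x)%:C * y x) &
          - dy1 + (coef_s om x)%:C * y1 x + (coef_q om x)%:C * y x
            = z * (coef_r om x)%:C * y x]}].

Definition vec2 (T : Type) (u v : T) : 'cV[T]_2 :=
  \col_(i < 2) (if i == ord0 then u else v).

Definition symplE (R : realType) : 'M[R[i]]_2 :=
  \matrix_(i < 2, j < 2)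
    (if (i < j)%N then -1 else if (j < i)%N then 1 else 0).

Definition selfadjoint_bc (R : realType) (A B : 'M[R[i]]_2) : Prop :=
  \rank (row_mx A B) = 2%N /\
  A *m symplE R *m A ^t* = B *m symplE R *m B ^t*.

Definition eigenspace (R : realType) (a b : R) (A B : 'M[R[i]]_2)
    (om : coefficients R) (z : R[i]) : set (R -> R[i]) :=
  [set y | exists2 y1, is_solution a b om z y y1 &
     A *m vec2 (y a) (y1 a) + B *m vec2 (y b) (y1 b) = 0].

Definition is_eigenvalue (R : realType) (a b : R) (A B : 'M[R[i]]_2)
    (om : coefficients R) (z : R[i]) : Prop :=
  exists2 y, eigenspace a b A B om z y & exists2 x, `[a, b]%classic x & y x != 0.

(* Functions are compared on [a, b] only: their values elsewhere are junk. *)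
Definition eigenspace_dim (R : realType) (a b : R) (A B : 'M[R[i]]_2)
    (om : coefficients R) (z : R[i]) (m : nat) : Prop :=
  exists e : 'I_m -> R -> R[i],
  [/\ forall i, eigenspace a b A B om z (e i),
      forall c : 'I_m -> R[i],
        (forall x, `[a, b]%classic x -> \sum_(i < m) c i * e i x = 0) ->
        forall i, c i = 0 &
      forall y, eigenspace a b A B om z y ->
        exists c : 'I_m -> R[i],
          forall x, `[a, b]%classic x -> y x = \sum_(i < m) c i * e i x].

Definition is_eigenvalue_sequence (R : realType) (a b : R) (A B : 'M[R[i]]_2)
    (om : coefficients R) (l : nat -> R) : Prop :=
  [/\ forall n m, (n <= m)%N -> l n <= l m,
      l n @[n --> \oo] --> +oo,
      forall z : R[i], is_eigenvalue a b A B om z <-> exists n, z = (l n)%:C &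
      forall n, exists2 m, eigenspace_dim a b A B om (l n)%:C m &
        ([set k | l k = l n] #= `I_m)%card].

(* Continuity of [f] on the set [S] with respect to the distance [d]. *)
Definition continuous_for (R : realType) (X : Type) (S : set X)
    (d : X -> X -> R) (f : X -> R) : Prop :=
  forall x0, S x0 -> forall eps : R, 0 < eps ->
    exists2 delta : R, 0 < delta &
      forall x, S x -> d x x0 < delta -> `|f x - f x0| < eps.

(* Main.v *)
Require Import Defs.
From mathcomp Require Import all_boot all_order all_algebra.
From mathcomp Require Import complex ring lra.
From mathcomp Require Import all_classical all_reals all_analysis measurable_realfun.

(* The eigenvalue [l] of [om] is a coincidence of two Lagrangian planes of C^2 + C^2: the
   boundary plane [A u + B v = 0] and the graph of the transfer matrix [Phi om l], which
   sends [(y, y1)] at [a] to [(y, y1)] at [b].  In a chart where the boundary plane is the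
   zero section and the graph at a given [(om0, l0)] is transversal to the fibre, the graph
   is that of a hermitian 2x2 matrix [H om l], continuous in [(om, l)], whose nullity is the
   multiplicity of [l].  By Lagrange's identity [H om l - H om l'] is [(l - l')] times a matrix
   close to a congruent of the Gram matrix of a solution basis in [L^2(r)], so the two
   eigenvalues of [H om l] increase strictly with [l].  Hence the number of eigenvalues of
   [om] between two points that are not eigenvalues of [om0] can be read off from signs which
   do not change for [om] near [om0].  An energy estimate, uniform near [om0], bounds the
   spectrum from below, so no eigenvalue enters from -oo, and the number of eigenvalues below
   any point off the spectrum of [om0] is locally constant. *)

Set Implicit Arguments.
Unset Strict Implicit.
Unset Printing Implicit Defensive.

Import Order.TTheory GRing.Theory Num.Theory.
Import numFieldNormedType.Exports.

Local Open Scope classical_set_scope.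
Local Open Scope ring_scope.
Local Open Scope complex_scope.
Local Open Scope sesquilinear_scope.

(** * Integrals over half-open intervals *)

(** The index [n] is counted from the bottom of the spectrum, so continuity of the spectrum as a set
    does not suffice: an eigenvalue arriving from -oo would shift every index. Hence a lower bound
    uniform in [om] is indispensable. It rests on [p > 0], by which the energy controls the
    oscillation of [y], and on self-adjointness, by which the boundary term is controlled by [y(a)]
    and [y(b)] alone. A chart is valid only near one [(om0, l0)], since its denominator must stay
    invertible; so counts are compared locally and carried up the real line by a supremum argument.
    The tilt of the fibre that gives transversality must be real to keep the matrix hermitian;
    invertibility is clear at the tilt [i], and a polynomial argument moves it to a natural number.
    Multiple eigenvalues need no separate treatment: each branch increases strictly, so it has at
    most one zero in a chart, and the multiplicity is the number of branches vanishing there. As the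
    coefficients are merely integrable, the equation is used in integrated form, and solutions are
    compared by Gronwall's inequality in L^1 norms. *)

Definition oc_integrable (R : realType) (a b : R) (g : R -> R) :=
  (@lebesgue_measure R).-integrable `]a, b] (EFin \o g).

(** Half-open intervals concatenate without overlap, so additivity in the endpoints is exact; the
    open interval of the coefficient space differs from []a, b]] by a null set. *)
Definition oc_int (R : realType) (x y : R) (g : R -> R) : R :=
  \int[lebesgue_measure]_(t in `]x, y]) g t.

Section OcIntegral.
Context {R : realType}.
Local Notation mu := (@lebesgue_measure R).
Implicit Types (a b c x y z : R) (f g h : R -> R).

Lemma oc_integrableS a b x y g : a <= x -> y <= b ->
  oc_integrable a b g -> oc_integrable x y g.
Proof.
move=> ax yb; apply: integrableS => //; apply: subset_itv; by rewrite bnd_simp.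
Qed.

Lemma oc_integrable_measurable a b g : oc_integrable a b g -> measurable_fun `]a, b] g.
Proof. by move=> /(measurable_int mu) /measurable_EFinP. Qed.

Lemma oc_integrableD a b f g : oc_integrable a b f -> oc_integrable a b g ->
  oc_integrable a b (fun x => f x + g x).
Proof. by move=> fi gi; apply: (integrableD _ fi gi). Qed.

Lemma oc_integrableB a b f g : oc_integrable a b f -> oc_integrable a b g ->
  oc_integrable a b (fun x => f x - g x).
Proof. by move=> fi gi; apply: (integrableB _ fi gi). Qed.

Lemma oc_integrableZ a b k f : oc_integrable a b f ->
  oc_integrable a b (fun x => k * f x).
Proof. by move=> fi; apply: (integrableZl _ k fi). Qed.

Lemma oc_integrableN a b f : oc_integrable a b f ->
  oc_integrable a b (fun x => - f x).
Proof. by move=> fi; apply: (integrableN fi). Qed.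

Lemma oc_integrable_norm a b f : oc_integrable a b f ->
  oc_integrable a b (fun x => `|f x|).
Proof. by move=> fi; apply: (integrable_norm fi). Qed.

Lemma oc_integrable_cst a b k : oc_integrable a b (fun=> k).
Proof.
apply: measurable_bounded_integrable => //.
  by rewrite /= lebesgue_measure_itv/=; case: ifP => // _; rewrite -EFinB ltry.
by exists `|k|; split; [exact: num_real|move=> y ky x _; rewrite ltW].
Qed.

Lemma oc_integrableM a b f g (B : R) : measurable_fun `]a, b] f ->
  (forall x, a < x <= b -> `|f x| <= B) ->
  oc_integrable a b g -> oc_integrable a b (fun x => f x * g x).
Proof.
move=> mf fB gi; rewrite /oc_integrable.
have -> : EFin \o (fun x => f x * g x) = ((EFin \o f) \* (EFin \o g))%E.
  by apply/funext => x; rewrite /= EFinM.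
apply: integrableMr => //.
exists B; split; first exact: num_real.
move=> y By x /= xab; apply: le_trans (ltW By).
by apply: fB; move: xab; rewrite in_itv.
Qed.

Lemma eq_oc_integrable a b f g : (forall x, a < x <= b -> f x = g x) ->
  oc_integrable a b f -> oc_integrable a b g.
Proof.
move=> fg; apply: eq_integrable => // x; rewrite inE/= in_itv/= => /fg fgx.
by rewrite fgx.
Qed.

Lemma eq_oc_int a b f g : (forall x, a < x <= b -> f x = g x) ->
  oc_int a b f = oc_int a b g.
Proof.
by move=> fg; apply: eq_Rintegral => x; rewrite inE/= in_itv/=; exact: fg.
Qed.

Lemma oc_int_xx x g : oc_int x x g = 0.
Proof. by rewrite /oc_int set_itvoc0 Rintegral_set0. Qed.

Lemma oc_int_chasles x y z g : x <= y -> y <= z -> oc_integrable x z g ->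
  oc_int x z g = oc_int x y g + oc_int y z g.
Proof.
move=> xy yz gi; have := @Rintegral_itvB R g (BRight x) (BRight z) y gi.
by rewrite !bnd_simp => /(_ xy yz); rewrite /oc_int => <-; rewrite addrC subrK.
Qed.

Lemma oc_intD a b f g : oc_integrable a b f -> oc_integrable a b g ->
  oc_int a b (fun x => f x + g x) = oc_int a b f + oc_int a b g.
Proof. by move=> fi gi; rewrite /oc_int RintegralD. Qed.

Lemma oc_intB a b f g : oc_integrable a b f -> oc_integrable a b g ->
  oc_int a b (fun x => f x - g x) = oc_int a b f - oc_int a b g.
Proof. by move=> fi gi; rewrite /oc_int RintegralB. Qed.

Lemma oc_intZ a b k f : oc_integrable a b f ->
  oc_int a b (fun x => k * f x) = k * oc_int a b f.
Proof. by move=> fi; rewrite /oc_int RintegralZl. Qed.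

Lemma oc_intN a b f : oc_integrable a b f ->
  oc_int a b (fun x => - f x) = - oc_int a b f.
Proof.
move=> fi; rewrite -mulN1r -oc_intZ //.
by apply: eq_oc_int => x _; rewrite mulN1r.
Qed.

Lemma oc_int_ge0 a b f : (forall x, a < x <= b -> 0 <= f x) -> 0 <= oc_int a b f.
Proof. by move=> f0; apply: Rintegral_ge0 => x /=; rewrite in_itv/=; exact: f0. Qed.

Lemma le_oc_int a b f g : oc_integrable a b f -> oc_integrable a b g ->
  (forall x, a < x <= b -> f x <= g x) -> oc_int a b f <= oc_int a b g.
Proof.
by move=> fi gi fg; apply: le_Rintegral => // x /=; rewrite in_itv/=; exact: fg.
Qed.

Lemma oc_int_norm a b f : oc_integrable a b f ->
  `|oc_int a b f| <= oc_int a b (fun x => `|f x|).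
Proof. by move=> fi; apply: le_normr_Rintegral. Qed.

Lemma oc_int_cst a b k : a <= b -> oc_int a b (fun=> k) = k * (b - a).
Proof.
move=> ab; rewrite /oc_int Rintegral_cst //= lebesgue_measure_itv/= lte_fin.
case: ltP => [_ //|ba]; suff -> : b = a by rewrite subrr.
by apply/le_anti; rewrite ba ab.
Qed.

Lemma oc_int_le_sub a b x y f : a <= x -> x <= y -> y <= b ->
  oc_integrable a b f -> (forall t, a < t <= b -> 0 <= f t) ->
  oc_int x y f <= oc_int a b f.
Proof.
move=> ax xy yb fi f0.
rewrite (@oc_int_chasles a x b)// ?(le_trans xy)//.
rewrite (@oc_int_chasles x y b)//; last exact: oc_integrableS fi.
rewrite addrCA lerDl addr_ge0//; apply: oc_int_ge0 => t /andP[h1 h2]; apply: f0.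
  by rewrite h1 (le_trans h2)// (le_trans xy).
by rewrite h2 andbT (le_lt_trans _ h1)// (le_trans ax).
Qed.

(** Absolute continuity of the integral, imported from the whole line through the extension of [g]
    by zero. *)
Lemma oc_int_small a b g : oc_integrable a b g -> forall e : R, 0 < e ->
  exists2 d : R, 0 < d & forall A, measurable A -> A `<=` `]a, b] ->
    (mu A < d%:E)%E -> \int[mu]_(x in A) `|g x| < e.
Proof.
move=> gi e e0.
have gi' : mu.-integrable setT (EFin \o (g \_ `]a, b])).
  by move/integrable_mkcond: gi => /(_ (measurable_itv _)); rewrite restrict_EFin.
have [d [d0 H]] := integral_normr_continuous gi' e0.
exists d => // A mA Aab /(H _ mA); apply: le_lt_trans.
rewrite le_eqVlt; apply/orP; left; apply/eqP/eq_Rintegral => x xA.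
by rewrite patchE mem_set//; apply: Aab; exact/set_mem.
Qed.

Lemma oc_int_small_itv a b g : oc_integrable a b g -> forall e : R, 0 < e ->
  exists2 d : R, 0 < d & forall x y, a <= x -> x <= y -> y <= b -> y - x < d ->
    oc_int x y (fun t => `|g t|) < e.
Proof.
move=> gi e e0; have [d d0 H] := oc_int_small gi e0.
exists d => // x y ax xy yb yxd; apply: H => //.
  by apply: subset_itv; rewrite bnd_simp.
rewrite lebesgue_measure_itv/= lte_fin; case: ifP => _; last by rewrite lte_fin.
by rewrite -EFinB lte_fin.
Qed.

Lemma oo_oc_integrable a b g : mu.-integrable `]a, b[ (EFin \o g) ->
  oc_integrable a b g.
Proof.
have [ab|ba] := ltP a b; last first.
  by move=> _; rewrite /oc_integrable set_itv_ge ?bnd_simp -?leNgt//; exact: integrable_set0.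
move=> gi; rewrite /oc_integrable -(@setUitv1 _ _ (BRight a) b true) ?bnd_simp//.
apply/integrableP; split.
  rewrite measurable_funU//; split; first exact: measurable_int gi.
  exact: measurable_fun_set1.
rewrite ge0_integral_setU//=.
- have -> : (\int[mu]_(x in [set b]) `|(g x)%:E|)%E = 0%E.
    by rewrite integral_set1.
  by rewrite adde0; case/integrableP: gi.
- rewrite measurable_funU//; split; last exact: measurable_fun_set1.
  by apply/measurable_EFinP/measurableT_comp => //;
    move: gi => /(measurable_int mu) /measurable_EFinP.
- apply/disj_setPS => x [/=]; rewrite in_itv/= => /andP[_ xb] xE.
  by move: xb; rewrite xE ltxx.
Qed.

Lemma oc_int_oo a b g : mu.-integrable `]a, b[ (EFin \o g) ->
  oc_int a b g = \int[mu]_(x in `]a, b[) g x.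
Proof. by move=> gi; rewrite /oc_int Rintegral_itv_bndo_bndc. Qed.

End OcIntegral.

(** * Absolutely continuous functions *)

(** Working form of absolute continuity: products and differences of solutions are computed on the
    densities [g]. The passage to and from [abs_continuous] is [primitive_abs_continuous] and
    [abs_continuous_bounded_ae_primitive]. *)
Definition primitive (R : realType) (a b : R) (f g : R -> R) :=
  oc_integrable a b g /\ forall x, a <= x <= b -> f x = f a + oc_int a x g.

Section Primitive.
Context {R : realType}.
Local Notation mu := (@lebesgue_measure R).
Implicit Types (a b c x y z : R) (f g h : R -> R).

Lemma within_itv_continuous a b f :
  (forall x, a <= x <= b -> forall e, 0 < e -> exists2 d, 0 < d &
    forall y, a <= y <= b -> `|x - y| < d -> `|f x - f y| < e) ->
  {within `[a, b], continuous f}.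
Proof.
move=> H; apply/subspace_continuousP => x /=; rewrite in_itv/= => xab.
apply/cvgrPdist_lt => e e0; have [d d0 Hd] := H _ xab _ e0.
apply/nbhs_ballP; exists d => //= y xy; rewrite in_itv/= => yab.
exact: Hd.
Qed.

Lemma primitive_sub a b f g x y : primitive a b f g ->
  a <= x -> x <= y -> y <= b -> f y - f x = oc_int x y g.
Proof.
move=> [gi fE] ax xy yb.
rewrite (fE y) ?(fE x) ?ax ?(le_trans ax) ?(le_trans xy)//.
rewrite (oc_int_chasles ax xy); last exact: oc_integrableS gi.
by ring.
Qed.

Lemma primitive_restr a b f g x y : primitive a b f g ->
  a <= x -> x <= y -> y <= b -> primitive x y f g.
Proof.
move=> fg ax xy yb; split; first by case: fg => gi _; exact: oc_integrableS gi.
move=> z /andP[xz zy]; rewrite -(primitive_sub fg) ?(le_trans zy)//.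
by rewrite addrC subrK.
Qed.

Lemma primitive_dist a b f g x y : primitive a b f g ->
  a <= x -> x <= y -> y <= b -> `|f y - f x| <= oc_int x y (fun t => `|g t|).
Proof.
move=> fg ax xy yb; rewrite (primitive_sub fg)//; apply: oc_int_norm.
by case: fg => gi _; apply: oc_integrableS gi.
Qed.

Lemma primitive_continuous a b f g : primitive a b f g ->
  {within `[a, b], continuous f}.
Proof.
move=> fg; apply: within_itv_continuous => x /andP[ax xb] e e0.
have [gi _] := fg; have [d d0 H] := oc_int_small_itv gi e0.
exists d => // y /andP[ay yb] xyd.
have [xy|yx] := leP x y.
  rewrite distrC; apply: (le_lt_trans (primitive_dist fg ax xy yb)).
  by apply: H => //; apply: le_lt_trans xyd; rewrite distrC ler_norm.
apply: (le_lt_trans (primitive_dist fg ay (ltW yx) xb)).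
by apply: H => //; [exact: ltW|apply: le_lt_trans xyd; rewrite ler_norm].
Qed.

Lemma primitive_measurable a b f g : primitive a b f g -> measurable_fun `]a, b] f.
Proof.
move=> /primitive_continuous /subspace_continuous_measurable_fun H.
apply: measurable_funS (H _) => //; by apply: subset_itv; rewrite bnd_simp.
Qed.

Lemma primitive_bounded a b f g : primitive a b f g ->
  exists2 B, 0 <= B & forall x, a <= x <= b -> `|f x| <= B.
Proof.
move=> fg; exists (`|f a| + oc_int a b (fun t => `|g t|)).
  by rewrite addr_ge0//; apply: oc_int_ge0.
move=> x /andP[ax xb]; rewrite -(subrK (f a) (f x)) addrC.
apply: (le_trans (ler_normD _ _)); rewrite lerD2l.
apply: le_trans (primitive_dist fg _ ax xb) _ => //.
apply: oc_int_le_sub => //; by case: fg => gi _; apply: oc_integrable_norm.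
Qed.

Lemma primitive_integrableM a b f g h : primitive a b f g -> oc_integrable a b h ->
  oc_integrable a b (fun x => f x * h x).
Proof.
move=> fg hi; have [B _ fB] := primitive_bounded fg.
apply: (@oc_integrableM _ _ _ _ _ B) => //; first exact: primitive_measurable fg.
by move=> x /andP[/ltW ax xb]; rewrite fB// ax.
Qed.

(** Turns the sum over disjoint intervals into one integral over their union, a set of small measure
    to which [oc_int_small] applies. *)
Lemma sum_oc_int a b g n (u v : 'I_n -> R) : oc_integrable a b g ->
  (forall i, [/\ a <= u i, u i <= v i & v i <= b]) ->
  trivIset [set: 'I_n] (fun i => `]u i, v i[%classic) ->
  \sum_(i < n) oc_int (u i) (v i) (fun t => `|g t|) =
  \int[mu]_(x in \big[setU/set0]_(i < n) `]u i, v i[%classic) `|g x|.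
Proof.
move=> gi uv tI; rewrite /Rintegral.
have sub i : `]u i, v i[%classic `<=` `]a, b].
  have [au uvi vb] := uv i; apply: subset_itv; rewrite bnd_simp//.
have gni : mu.-integrable `]a, b] (EFin \o (fun x => `|g x|)) := oc_integrable_norm gi.
rewrite ge0_integral_bigsetU//=.
- rewrite -[RHS]/(fine (\sum_(i < n) \int[mu]_(x in `]u i, v i[) (`|g x|)%:E)%E).
  rewrite (eq_bigr (fun i => (oc_int (u i) (v i) (fun t => `|g t|))%:E)).
    by rewrite sumEFin.
  move=> i _; have [au uvi vb] := uv i.
  have gii : mu.-integrable `]u i, v i[ (EFin \o (fun x => `|g x|)).
    exact: integrableS gni.
  by rewrite oc_int_oo// /Rintegral fineK//; exact: integrable_fin_num.
- exact: index_enum_uniq.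
- by apply: sub_trivIset tI.
- apply: measurable_funS (measurable_int mu gni) => //.
  by elim/big_ind: _ => // A B hA hB x [/hA|/hB].
Qed.

Lemma primitive_abs_continuous a b f g : primitive a b f g -> abs_continuous a b f.
Proof.
move=> fg e e0; have [gi _] := fg; have [d d0 H] := oc_int_small gi e0.
exists d => // n u v uv tI uvd.
apply: (@le_lt_trans _ _ (\sum_(i < n) oc_int (u i) (v i) (fun t => `|g t|))).
  apply: ler_sum => i _; have [au uvi vb] := uv i.
  exact: primitive_dist fg au uvi vb.
have mU : measurable (\big[setU/set0]_(i < n) `]u i, v i[%classic).
  by apply: bigsetU_measurable => i _.
rewrite (sum_oc_int gi)//; apply: H => //.
  elim/big_ind: _ => [//|A B hA hB x [/hA|/hB] //|i _].
  have [au uvi vb] := uv i; by apply: subset_itv; rewrite bnd_simp.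
rewrite measure_semi_additive_ord//.
rewrite (eq_bigr (fun i => (v i - u i)%:E)) ?sumEFin ?lte_fin// => i _.
have [au uvi vb] := uv i.
etransitivity; first exact: lebesgue_measure_itv.
rewrite /= lte_fin; case: ltP => [_|vu]; first by rewrite EFinB.
by have -> : v i = u i; [apply/le_anti; rewrite vu uvi|rewrite subrr].
Qed.

(** Lebesgue differentiation for [g] extended by zero; near an interior point [f] differs from that
    primitive by the constant [f a]. *)
Lemma primitive_derive a b f g : primitive a b f g ->
  {ae mu, forall x, `]a, b[%classic x -> is_derive x 1 f (g x)}.
Proof.
move=> [gi fE]; set g' := g \_ `]a, b].
have gi' : mu.-integrable setT (EFin \o g').
  by move/integrable_mkcond: gi => /(_ (measurable_itv _)); rewrite restrict_EFin.
have locg : locally_integrable [set: R] g'.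
  by apply: open_integrable_locally => //; exact: openT.
have := @FTC1 R g' (BRight a) _ locg.
set F := fun x => _; move=> /(_ _)/wrap[]; first by move=> y; apply: integrableS gi'.
apply: filterS; first exact: (ae_filter_ringOfSetsType mu).
move=> x /= H; rewrite in_itv/= => /andP[ax xb].
have [dF F'] : derivable F x 1 /\ F^`()%classic x = g' x by apply: H; rewrite lte_fin.
have g'x : g' x = g x.
  by rewrite /g' patchE mem_set//= in_itv/= ax ltW.
have isF : is_derive x 1 F (g x) by apply: DeriveDef => //; rewrite -derive1E F' g'x.
have isF' : is_derive x 1 (cst (f a) + F) (g x).
  by rewrite -[g x]add0r; apply: is_deriveD.
apply: near_eq_is_derive isF'.
have : \forall y \near x, y \in `]a, b[ by apply: near_in_itvoo; rewrite in_itv/= ax.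
apply: filterS => y; rewrite in_itv/= => /andP[ay yb].
rewrite /= (fE y) ?ltW//=; congr (_ + _).
apply: eq_Rintegral => t; rewrite inE/= in_itv/= => /andP[a_t ty].
by rewrite /g' patchE mem_set//= in_itv/= a_t (le_trans ty)// ltW.
Qed.

End Primitive.

Section AbsContinuous.
Context {R : realType}.
Local Notation mu := (@lebesgue_measure R).
Implicit Types (a b c x y z : R) (f g h : R -> R).

Definition subdivision (good : R -> R -> Prop) a b :=
  exists n : nat, exists t : nat -> R, [/\ t 0%N = a, t n = b &
    forall i, (i < n)%N -> t i <= t i.+1 /\ good (t i) (t i.+1)].

Lemma subdivision_rcons (good : R -> R -> Prop) a x y :
  subdivision good a x -> x <= y -> good x y -> subdivision good a y.
Proof.
move=> [n [t [t0 tn tP]]] xy gxy.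
exists n.+1, (fun i => if (i <= n)%N then t i else y); split => //=.
  by rewrite ltnn.
move=> i lin; have [->|ni] := eqVneq i n; first by rewrite leqnn ltnn tn.
have {}lin : (i < n)%N by rewrite ltn_neqAle ni.
by rewrite (ltnW lin) lin; exact: tP.
Qed.

(** Cousin's covering lemma. The points reachable from [a] by a good subdivision have a supremum;
    the interval assigned to that supremum joins a reachable point on its left to a point on its
    right, or to [b]. *)
Lemma cousin (good : R -> R -> Prop) a b : a <= b ->
  (forall x, a <= x <= b -> exists2 d, 0 < d & forall u v,
    a <= u -> u <= x -> x <= v -> v <= b -> x - u < d -> v - x < d -> good u v) ->
  subdivision good a b.
Proof.
move=> ab H; pose S := [set x | a <= x <= b /\ subdivision good a x].
have Sa : S a by split; [rewrite lexx ab|exists 0%N, (fun=> a); split].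
have Sb : has_sup S.
  by split; [exists a|exists b => x [/andP[]]].
have Sub x : S x -> x <= sup S by move=> Sx; apply: sup_upper_bound.
have supab : a <= sup S <= b.
  by rewrite Sub//=; apply: ge_sup => [|x [/andP[]]//]; exists a.
have [d d0 Hd] := H _ supab.
have [s Ss sd] := sup_adherent d0 Sb.
have [/andP[sa sb] Cs] := Ss.
pose v := Num.min (sup S + d / 2) b.
have supv : sup S <= v.
  by rewrite /v le_min; apply/andP; split; [rewrite lerDl; lra|case/andP: supab].
have vb : v <= b by rewrite /v ge_min lexx orbT.
have Sv : S v.
  split; first by rewrite vb andbT (le_trans _ supv)//; case/andP: supab.
  apply: (subdivision_rcons Cs); first exact: le_trans (Sub _ Ss) supv.
  apply: Hd => //; [exact: Sub|lra|].
  have : v <= sup S + d / 2 by rewrite /v ge_min lexx.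
  lra.
have := Sub _ Sv; rewrite {1}/v ge_min => /orP[h|bs]; first lra.
suff -> : b = v by case: Sv.
by apply/le_anti; rewrite vb andbT (le_trans bs).
Qed.

Lemma is_derive0_dist f x : is_derive x 1 f 0 -> forall e, 0 < e ->
  exists2 d, 0 < d & forall y, `|x - y| < d -> `|f y - f x| <= e * `|y - x|.
Proof.
move=> /is_derive1_caratheodory[k [fk /cvgrPdist_lt kc kx]] e /kc /nbhs_ballP[d /= d0 H].
exists d => // y /H; rewrite kx sub0r normrN => ke.
by rewrite fk normrM ler_wpM2r// ltW.
Qed.

(** A gauge argument in place of a Vitali covering. Intervals tagged outside an exceptional null set
    contribute at most [e] times their length; the others lie in an open set of measure below [d],
    and absolute continuity bounds their total contribution by [e]. *)
Lemma abs_continuous_derive0 a b F : a <= b -> abs_continuous a b F ->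
  {ae mu, forall x, `]a, b[%classic x -> is_derive x 1 F 0} -> F b = F a.
Proof.
move=> ab acF [N [mN N0 HN]].
suff H e : 0 < e -> `|F b - F a| <= e * (b - a) + e.
  apply/eqP; rewrite -subr_eq0 -normr_le0; apply/ler_addgt0Pl => e e0.
  have k0 : 0 < b - a + 1 by rewrite ltr_wpDl ?subr_ge0.
  have := H (e / (b - a + 1)); rewrite divr_gt0// => /(_ isT).
  have -> : e / (b - a + 1) * (b - a) + e / (b - a + 1) = e.
    by field; rewrite gt_eqF.
  by rewrite addr0.
move=> e0; have [d d0 Hd] := acF e e0.
(* The endpoints join the null set because differentiability is given only inside []a, b[]. *)
pose N1 := N `|` [set a; b].
have mN1 : measurable N1 by apply: measurableU => //; apply: measurableU.
have N10 : mu N1 = 0%E.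
  have ab0 : mu [set a; b] = 0%E.
    by apply: null_set_setU => //; exact: lebesgue_measure_set1.
  by apply: null_set_setU => //; exact: measurableU.
have [U [oU NU Ud]] : exists U : set R,
    [/\ open U, N1 `<=` U & (mu (U `\` N1) < d%:E)%E].
  have N1y : (mu N1 < +oo)%E by rewrite N10.
  by apply: lebesgue_regularity_outer.
have mU : measurable U by exact: open_measurable.
have {}Ud : (mu U < d%:E)%E.
  have -> : U = (U `\` N1) `|` N1.
    by rewrite setUC setDUK.
  by rewrite measureU0//; exact: measurableD.
pose good u v := `|F v - F u| <= e * (v - u) \/ `]u, v[%classic `<=` U.
have [|n [t [t0 tn tP]]] := @cousin good a b ab.
  move=> x /andP[ax xb].
  have [Ux|nUx] := pselect (U x).
    have [r r0 Hr] : exists2 r, 0 < r & ball x r `<=` U.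
      have /nbhs_ballP[r r0 Hr] : nbhs x U by apply: open_nbhs_nbhs.
      by exists r.
    exists r => // u v au ux xv vb xur vxr; right => y /=; rewrite in_itv/= => /andP[uy yv].
    by apply: Hr; rewrite /ball/= ltr_norml; apply/andP; split; lra.
  have xab : `]a, b[%classic x.
    rewrite /= in_itv/= !lt_neqAle ax xb !andbT; apply/andP; split.
      by apply/eqP => E; apply: nUx; apply: NU; right; left.
    by apply/eqP => E; apply: nUx; apply: NU; right; right.
  have dF : is_derive x 1 F 0.
    apply: contrapT => h; apply: nUx; apply: NU; left; apply: HN => /= h'.
    by apply: h; exact: h'.
  have [r r0 Hr] := is_derive0_dist dF e0.
  exists r => // u v au ux xv vb xur vxr; left.
  have Hu : `|F u - F x| <= e * (x - u).
    have xu0 : 0 <= x - u by rewrite subr_ge0.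
    by rewrite -(ger0_norm xu0) (distrC x) Hr// ger0_norm.
  have Hv : `|F v - F x| <= e * (v - x).
    have vx0 : 0 <= v - x by rewrite subr_ge0.
    by rewrite -(ger0_norm vx0) Hr// distrC ger0_norm.
  have -> : F v - F u = (F v - F x) - (F u - F x) by ring.
  apply: (le_trans (ler_normB _ _)).
  have -> : e * (v - u) = e * (v - x) + e * (x - u) by ring.
  exact: lerD.
pose bad (i : 'I_n) := `[< `]t i, t i.+1[%classic `<=` U >].
pose u (i : 'I_n) := t i.
(* Intervals not inside [U] are collapsed to a point, so that one family indexed by all of ['I_n]
   can be given to absolute continuity. *)
pose v (i : 'I_n) := if bad i then t i.+1 else t i.
have tmono i j : (i <= j)%N -> (j <= n)%N -> t i <= t j.
  elim: j => [|j IH]; first by rewrite leqn0 => /eqP ->.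
  rewrite leq_eqVlt => /orP[/eqP -> //|]; rewrite ltnS => ij jn.
  by apply: le_trans (IH ij (ltnW jn)) _; have [] := tP _ jn.
have uvP i : [/\ a <= u i, u i <= v i & v i <= b].
  have [h _] := tP _ (ltn_ord i); split.
  - by rewrite -t0; apply: tmono => //; exact: ltnW.
  - by rewrite /v; case: ifP.
  - by rewrite -tn /v; case: ifP => _; apply: tmono => //; exact: ltnW.
have tI : trivIset [set: 'I_n] (fun i => `]u i, v i[%classic).
  apply/trivIsetP => i j _ _ ij; apply/seteqP; split => // x /=.
  wlog : i j ij / (i < j)%N.
    move=> W; have [/W|ji] := ltnP i j; first exact.
    move=> [h1 h2]; apply: (W j i) => //; first by rewrite eq_sym.
    by rewrite ltn_neqAle ji andbT eq_sym.
  move=> lij []; rewrite !in_itv/= => /andP[_ xv] /andP[ux _].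
  have : v i <= u j.
    apply: (@le_trans _ _ (t i.+1)).
      by rewrite /v; case: ifP => // _; have [] := tP _ (ltn_ord i).
    by apply: tmono => //; exact: ltnW.
  lra.
have uvd : \sum_(i < n) (v i - u i) < d.
  rewrite -lte_fin -sumEFin; apply: le_lt_trans Ud.
  have mB : measurable (\big[setU/set0]_(i < n) `]u i, v i[%classic).
    by apply: bigsetU_measurable => i _.
  rewrite (eq_bigr (fun i => mu `]u i, v i[%classic)).
    rewrite -measure_semi_additive_ord//; apply: le_measure; rewrite ?inE//.
    elim/big_ind: _ => [//|A B hA hB x [/hA|/hB] //|i _].
    rewrite /u /v; case: ifPn => [/asboolP //|_] x /=; rewrite in_itv/=; lra.
  move=> i _; have [_ uvi _] := uvP i.
  apply/esym; etransitivity; first exact: lebesgue_measure_itv.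
  rewrite /= lte_fin; case: ltP => [_|vu]; first by rewrite EFinB.
  by have -> : v i = u i; [apply/le_anti; rewrite vu uvi|rewrite subrr].
have := Hd n u v uvP tI uvd.
have -> : F b - F a = \sum_(i < n) (F (t i.+1) - F (t i)).
  by rewrite -(big_mkord xpredT (fun i => F (t i.+1) - F (t i))) telescope_sumr// t0 tn.
have -> : b - a = \sum_(i < n) (t i.+1 - t i).
  by rewrite -(big_mkord xpredT (fun i => t i.+1 - t i)) telescope_sumr// t0 tn.
move=> Hs; apply: (@le_trans _ _ (\sum_(i < n) (e * (t i.+1 - t i) + `|F (v i) - F (u i)|))).
  apply: le_trans (ler_norm_sum _ _ _) _; apply: ler_sum => i _.
  have [ti gi] := tP _ (ltn_ord i).
  rewrite /u /v; case: ifPn => [_|/asboolPn nb].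
    by rewrite lerDr mulr_ge0 ?subr_ge0// ltW.
  by rewrite subrr normr0 addr0; case: gi.
by rewrite big_split/= -mulr_sumr lerD2l ltW.
Qed.

Lemma abs_continuousS a b x y f : a <= x -> y <= b ->
  abs_continuous a b f -> abs_continuous x y f.
Proof.
move=> ax yb acf e e0; have [d d0 H] := acf _ e0; exists d => // n u v uv.
by apply: H => i; have [xu uvi vy] := uv i; split; [exact: le_trans xu| |exact: le_trans yb].
Qed.

Lemma abs_continuousB a b f g : abs_continuous a b f -> abs_continuous a b g ->
  abs_continuous a b (fun x => f x - g x).
Proof.
move=> acf acg e e0; have e20 : 0 < e / 2 by rewrite divr_gt0.
have [d1 d10 H1] := acf _ e20; have [d2 d20 H2] := acg _ e20.
exists (Num.min d1 d2); first by rewrite lt_min d10.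
move=> n u v uv tI; rewrite lt_min => /andP[/(H1 n u v uv tI) h1 /(H2 n u v uv tI) h2].
apply: (@le_lt_trans _ _ (\sum_(i < n) (`|f (v i) - f (u i)| + `|g (v i) - g (u i)|))).
  apply: ler_sum => i _; apply: le_trans (ler_normB _ _); rewrite le_eqVlt.
  by apply/orP; left; apply/eqP; congr `|_|; ring.
rewrite big_split/=; lra.
Qed.

Lemma abs_continuousM a b f g (B : R) : 0 <= B ->
  (forall x, a <= x <= b -> `|f x| <= B) -> (forall x, a <= x <= b -> `|g x| <= B) ->
  abs_continuous a b f -> abs_continuous a b g ->
  abs_continuous a b (fun x => f x * g x).
Proof.
move=> B0 fB gB acf acg e e0.
have B1 : 0 < B + 1 by lra.
have e20 : 0 < e / 2 / (B + 1) by rewrite !divr_gt0.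
have [d1 d10 H1] := acf _ e20; have [d2 d20 H2] := acg _ e20.
exists (Num.min d1 d2); first by rewrite lt_min d10.
move=> n u v uv tI; rewrite lt_min => /andP[/(H1 n u v uv tI) h1 /(H2 n u v uv tI) h2].
apply: (@le_lt_trans _ _ (\sum_(i < n) (B + 1) * (`|f (v i) - f (u i)| + `|g (v i) - g (u i)|))).
  apply: ler_sum => i _; have [au uvi vb] := uv i.
  have -> : f (v i) * g (v i) - f (u i) * g (u i) =
    g (v i) * (f (v i) - f (u i)) + f (u i) * (g (v i) - g (u i)) by ring.
  rewrite [leRHS]mulrDr; apply: le_trans (ler_normD _ _) _; rewrite !normrM; apply: lerD.
    by rewrite ler_wpM2r// (le_trans (gB _ _))// ?lerDl// vb andbT (le_trans au).
  by rewrite ler_wpM2r// (le_trans (fB _ _))// ?lerDl// au (le_trans uvi).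
rewrite -mulr_sumr big_split/= mulrC -ltr_pdivlMr//.
apply: lt_le_trans (ltrD h1 h2) _.
by rewrite -mulrDl -splitr.
Qed.

(** Subtracting the integral of [g] leaves an absolutely continuous function with zero derivative
    almost everywhere, which is constant. *)
Lemma abs_continuous_bounded_ae_primitive a b f g :
  abs_continuous a b f -> oc_integrable a b g ->
  {ae mu, forall x, `]a, b[%classic x -> is_derive x 1 f (g x)} ->
  primitive a b f g.
Proof.
move=> acf gi df; split => // x /andP[ax xb].
pose G y := oc_int a y g.
have pG : primitive a b G g.
  by split => // y _; rewrite /G oc_int_xx add0r.
have : f x - G x = f a - G a.
  apply: (@abs_continuous_derive0 a x (fun y => f y - G y)) => //.
    apply: (abs_continuousS (lexx a) xb); apply: abs_continuousB => //.
    exact: primitive_abs_continuous pG.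
  have := primitive_derive pG; move: df.
  apply: filterS2; first exact: (ae_filter_ringOfSetsType mu).
  move=> y /= h1 h2; rewrite in_itv/= => /andP[ay yx].
  have yab : y \in `]a, b[ by rewrite in_itv/= ay (lt_le_trans yx).
  by rewrite -(subrr (g y)); apply: is_deriveB; [exact: h1|exact: h2].
by rewrite {2}/G oc_int_xx subr0 => <-; rewrite subrK.
Qed.

Lemma primitiveM a b f g f' g' : primitive a b f f' -> primitive a b g g' ->
  primitive a b (fun x => f x * g x) (fun x => f x * g' x + g x * f' x).
Proof.
move=> pf pg; apply: abs_continuous_bounded_ae_primitive.
- have [B1 B10 H1] := primitive_bounded pf; have [B2 B20 H2] := primitive_bounded pg.
  apply: (@abs_continuousM _ _ _ _ (B1 + B2)); first exact: addr_ge0.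
  + by move=> x /H1 /le_trans; apply; rewrite lerDl.
  + by move=> x /H2 /le_trans; apply; rewrite lerDr.
  + exact: primitive_abs_continuous pf.
  + exact: primitive_abs_continuous pg.
- by apply: oc_integrableD; apply: primitive_integrableM; eauto; [case: pg|case: pf].
- have := primitive_derive pg; have := primitive_derive pf.
  apply: filterS2; first exact: (ae_filter_ringOfSetsType mu).
  by move=> x /= h1 h2 xab; apply: is_deriveM; [exact: h1|exact: h2].
Qed.

Lemma primitiveB a b f g f' g' : primitive a b f f' -> primitive a b g g' ->
  primitive a b (fun x => f x - g x) (fun x => f' x - g' x).
Proof.
move=> [fi fE] [gi gE]; split; first exact: oc_integrableB.
move=> x xab; have xb : x <= b by case/andP: xab.
by rewrite oc_intB ?(fE x xab) ?(gE x xab) //; [ring|exact: oc_integrableS fi|exact: oc_integrableS gi].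
Qed.

Lemma primitiveD a b f g f' g' : primitive a b f f' -> primitive a b g g' ->
  primitive a b (fun x => f x + g x) (fun x => f' x + g' x).
Proof.
move=> [fi fE] [gi gE]; split; first exact: oc_integrableD.
move=> x xab; have xb : x <= b by case/andP: xab.
by rewrite oc_intD ?(fE x xab) ?(gE x xab) //; [ring|exact: oc_integrableS fi|exact: oc_integrableS gi].
Qed.

Lemma primitiveZ a b k f f' : primitive a b f f' ->
  primitive a b (fun x => k * f x) (fun x => k * f' x).
Proof.
move=> [fi fE]; split; first exact: oc_integrableZ.
move=> x xab; have xb : x <= b by case/andP: xab.
by rewrite oc_intZ ?(fE x xab) //; [ring|exact: oc_integrableS fi].
Qed.

End AbsContinuous.

(** * Gronwall's inequality and the linear system *)

Section Gronwall.
Context {R : realType}.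
Implicit Types (a b c x y z : R) (f g h k u : R -> R).

(* The weight is split into pieces of integral [1/2]; on each of them
   [C + int k u] at most doubles. *)
Lemma gronwall a b k u C : 0 <= C -> oc_integrable a b k ->
  oc_integrable a b (fun t => k t * u t) ->
  (forall t, a <= t <= b -> 0 <= k t) -> (forall t, a <= t <= b -> 0 <= u t) ->
  (forall x, a <= x <= b -> u x <= C + oc_int a x (fun t => k t * u t)) ->
  forall N x, a <= x <= b -> oc_int a x k <= N%:R / 2 -> u x <= 2 ^+ N * C.
Proof.
move=> C0 ki kui k0 u0 uC.
pose g x := C + oc_int a x (fun t => k t * u t).
have kS x y : a <= x -> y <= b -> oc_integrable x y k.
  by move=> ax yb; exact: oc_integrableS ki.
have gS x y : a <= x -> x <= y -> y <= b ->
    g y = g x + oc_int x y (fun t => k t * u t).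
  move=> ax xy yb; rewrite /g (oc_int_chasles ax xy) ?addrA//.
  exact: oc_integrableS kui.
have gmono x y : a <= x -> x <= y -> y <= b -> g x <= g y.
  move=> ax xy yb; rewrite (gS x y)// lerDl; apply: oc_int_ge0 => t /andP[xt ty].
  have tab : a <= t <= b by rewrite (le_trans ax (ltW xt)) (le_trans ty).
  by rewrite mulr_ge0 ?k0 ?u0.
have g0 x : a <= x -> x <= b -> 0 <= g x.
  move=> ax xb; apply: le_trans (gmono a x _ ax xb) => //.
  by rewrite /g oc_int_xx addr0.
have step x y : a <= x -> x <= y -> y <= b -> g y <= g x + g y * oc_int x y k.
  move=> ax xy yb; rewrite {1}(gS x y)// lerD2l -oc_intZ; last exact: kS.
  apply: le_oc_int; [exact: oc_integrableS kui|exact/oc_integrableZ/kS|].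
  move=> t /andP[xt ty]; have a_t := le_trans ax (ltW xt); have tb := le_trans ty yb.
  rewrite mulrC ler_wpM2r ?k0 ?a_t//; apply: le_trans (uC t _) _; first by rewrite a_t.
  exact: gmono.
have cm : primitive a b (fun x => oc_int a x k) k.
  by split => // x _; rewrite oc_int_xx add0r.
suff H N x : a <= x <= b -> oc_int a x k <= N%:R / 2 -> g x <= 2 ^+ N * C.
  move=> N x xab kN; apply: le_trans (uC _ xab) (H _ _ xab kN).
elim: N x => [|N IH] x /andP[ax xb].
  rewrite mul0r expr0 mul1r => kx; have := step a x (lexx a) ax xb.
  have gx := g0 _ ax xb; have ga : g a = C by rewrite /g oc_int_xx addr0.
  have : g x * oc_int a x k <= 0 by rewrite mulr_ge0_le0.
  rewrite ga; lra.
move=> kN; have [h|h] := leP (oc_int a x k) (N%:R / 2).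
  apply: le_trans (IH x _ h) _; first by rewrite ax.
  rewrite exprS -mulrA ler_peMl ?ler1n// mulr_ge0// exprn_ge0//.
(* Cut at the point [c] where the weight has integral [N / 2]: what remains up to [x] is at most
   [1/2], so [step] gives [g x <= 2 * g c]. *)
have [] := @IVT R (fun x => oc_int a x k) a x (N%:R / 2) ax.
- exact: primitive_continuous (primitive_restr cm (lexx a) ax xb).
- rewrite oc_int_xx ge_min le_max (ltW h) orbT andbT.
  by rewrite divr_ge0.
move=> c; rewrite in_itv/= => /andP[ac cx] kc.
have cb := le_trans cx xb.
have gc : g c <= 2 ^+ N * C by apply: IH; rewrite ?ac ?cb// kc.
have kcx : oc_int c x k <= 2^-1.
  move: kN; rewrite (oc_int_chasles ac cx) ?kc; last exact: kS.
  by rewrite -(natr1 N) mulrDl lerD2l mul1r.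
have := step c x ac cx xb; have gx := g0 x ax xb.
have : g x * oc_int c x k <= g x * 2^-1 by rewrite ler_wpM2l.
rewrite exprS -mulrA; lra.
Qed.

Lemma oc_int_dct a x (f_ : nat -> R -> R) f h : oc_integrable a x h ->
  (forall n, oc_integrable a x (f_ n)) ->
  (forall t, a < t <= x -> f_ n t @[n --> \oo] --> f t) ->
  (forall n t, a < t <= x -> `|f_ n t| <= h t) ->
  oc_integrable a x f /\ oc_int a x (f_ n) @[n --> \oo] --> oc_int a x f.
Proof.
move=> hi fi fc fh.
have mf : measurable_fun `]a, x] f.
  apply: (@measurable_fun_cvg _ _ _ _ f_).
    by move=> m; exact: oc_integrable_measurable (fi m).
  by move=> t /=; rewrite in_itv/=; exact: fc.
have [] := @dominated_convergence _ _ R lebesgue_measure `]a, x]%classic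
    (measurable_itv _) (fun n => EFin \o f_ n) (EFin \o f) (EFin \o h).
- by move=> n; exact: measurable_int (fi n).
- exact/measurable_EFinP.
- apply: aeW => t /=; rewrite in_itv/= => tax.
  by apply: cvg_EFin; [exact: nearW|exact: fc].
- exact: hi.
- by apply: aeW => t /= n; rewrite in_itv/= => tax; rewrite lee_fin fh.
move=> iF _ cF; split => //; rewrite /oc_int /Rintegral.
apply: fine_cvg; rewrite fineK; first exact: cF.
exact: integrable_fin_num.
Qed.

End Gronwall.

Section System.
Context {R : realType}.
Implicit Types (a b c x : R) (y z f g h k P S Q : R -> R).

(** The equation as a real first-order system in [y] and [z = y^[1]], with [P = 1/p], [S = s] and
    [Q = q - l r]. All three are real for real [l], so a complex solution is a pair of real ones. *)
Definition sl_solution a b P S Q y z :=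
  primitive a b y (fun t => P t * z t - S t * y t) /\
  primitive a b z (fun t => S t * z t + Q t * y t).

Definition sl_weight P S Q t : R := `|P t| + `|S t| + `|Q t|.

Lemma sl_weight_integrable a b P S Q : oc_integrable a b P -> oc_integrable a b S ->
  oc_integrable a b Q -> oc_integrable a b (sl_weight P S Q).
Proof.
move=> Pi Si Qi; apply: oc_integrableD; last exact: oc_integrable_norm.
by apply: oc_integrableD; exact: oc_integrable_norm.
Qed.

Lemma sl_weight_ge0 P S Q t : 0 <= sl_weight P S Q t.
Proof. by rewrite /sl_weight !addr_ge0. Qed.

Definition bounded_measurable a b f :=
  measurable_fun `]a, b] f /\ exists B : R, forall x, a <= x <= b -> `|f x| <= B.

Lemma primitive_bounded_measurable a b f g : primitive a b f g ->
  bounded_measurable a b f.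
Proof.
move=> fg; split; first exact: primitive_measurable fg.
by have [B _ H] := primitive_bounded fg; exists B.
Qed.

Lemma bounded_measurable_integrableM a b f h : bounded_measurable a b f ->
  oc_integrable a b h -> oc_integrable a b (fun t => h t * f t).
Proof.
move=> [mf [B fB]] hi.
apply: (@eq_oc_integrable _ _ _ (fun t => f t * h t)) => [x _|]; first by rewrite mulrC.
by apply: (@oc_integrableM _ _ _ _ _ B) => // x /andP[/ltW ax xb]; rewrite fB// ax.
Qed.

Lemma bounded_measurableD a b f g : bounded_measurable a b f ->
  bounded_measurable a b g -> bounded_measurable a b (fun t => f t + g t).
Proof.
move=> [mf [B fB]] [mg [C gC]]; split; first exact: measurable_funD.
by exists (B + C) => x xab; rewrite (le_trans (ler_normD _ _))// lerD ?fB ?gC.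
Qed.

Lemma bounded_measurableB a b f g : bounded_measurable a b f ->
  bounded_measurable a b g -> bounded_measurable a b (fun t => f t - g t).
Proof.
move=> [mf [B fB]] [mg [C gC]]; split; first exact: measurable_funB.
by exists (B + C) => x xab; rewrite (le_trans (ler_normB _ _))// lerD ?fB ?gC.
Qed.

Lemma bounded_measurable_norm a b f : bounded_measurable a b f ->
  bounded_measurable a b (fun t => `|f t|).
Proof.
move=> [mf [B fB]]; split; first exact: measurableT_comp.
by exists B => x xab; rewrite normr_id fB.
Qed.

Lemma bounded_measurable0 a b : bounded_measurable a b (fun=> 0).
Proof. by split => //; exists 0 => x _; rewrite normr0. Qed.

(** The difference of the right-hand sides splits into the new coefficients acting on the difference
    of the arguments, and the difference of the coefficients acting on [y0], [z0], which [B]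
    bounds. *)
Lemma sl_solution_diff P S Q P0 S0 Q0 (y z y0 z0 B : R) : `|y0| <= B -> `|z0| <= B ->
  forall t, `|(P t * z - S t * y) - (P0 t * z0 - S0 t * y0)| +
    `|(S t * z + Q t * y) - (S0 t * z0 + Q0 t * y0)| <=
  sl_weight P S Q t * (`|y - y0| + `|z - z0|) + 2 * B *
  sl_weight (fun t => P t - P0 t) (fun t => S t - S0 t) (fun t => Q t - Q0 t) t.
Proof.
move=> yB zB t; rewrite /sl_weight.
have -> : P t * z - S t * y - (P0 t * z0 - S0 t * y0) =
  P t * (z - z0) - S t * (y - y0) + ((P t - P0 t) * z0 - (S t - S0 t) * y0) by ring.
have -> : S t * z + Q t * y - (S0 t * z0 + Q0 t * y0) =
  S t * (z - z0) + Q t * (y - y0) + ((S t - S0 t) * z0 + (Q t - Q0 t) * y0) by ring.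
set p := P t - _; set s := S t - _; set q := Q t - _; set u := y - y0; set v := z - z0.
have B0 : 0 <= B by exact: le_trans yB.
have H1 : `|P t * v - S t * u + (p * z0 - s * y0)| <=
    `|P t| * `|v| + `|S t| * `|u| + (`|p| * B + `|s| * B).
  apply: le_trans (ler_normD _ _) _; apply: lerD; apply: le_trans (ler_normB _ _) _;
    by rewrite !normrM// lerD ?ler_wpM2l.
have H2 : `|S t * v + Q t * u + (s * z0 + q * y0)| <=
    `|S t| * `|v| + `|Q t| * `|u| + (`|s| * B + `|q| * B).
  apply: le_trans (ler_normD _ _) _; apply: lerD; apply: le_trans (ler_normD _ _) _;
    by rewrite !normrM// lerD ?ler_wpM2l.
apply: le_trans (lerD H1 H2) _; rewrite -subr_ge0.
rewrite [leRHS](_ : _ = `|P t| * `|u| + `|Q t| * `|v| + B * (`|p| + `|q|)); last by ring.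
by rewrite !addr_ge0// ?mulr_ge0// addr_ge0.
Qed.

Lemma sl_solution_measurable a b P S Q y z : sl_solution a b P S Q y z ->
  bounded_measurable a b y /\ bounded_measurable a b z.
Proof.
by move=> [py pz]; split; [exact: primitive_bounded_measurable py|
  exact: primitive_bounded_measurable pz].
Qed.

Lemma sl_rhs_integrable a b P S Q y z : oc_integrable a b P -> oc_integrable a b S ->
  oc_integrable a b Q -> bounded_measurable a b y -> bounded_measurable a b z ->
  oc_integrable a b (fun t => P t * z t - S t * y t) /\
  oc_integrable a b (fun t => S t * z t + Q t * y t).
Proof.
move=> Pi Si Qi my mz; split.
  by apply: oc_integrableB; exact: bounded_measurable_integrableM.
by apply: oc_integrableD; exact: bounded_measurable_integrableM.
Qed.

(* Both the stability estimate and the contraction step of the Picard iteration: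
   [y], [z] are driven by [u], [v] and [y0], [z0] by [u0], [v0]. *)
Lemma sl_integral_dist a b P S Q P0 S0 Q0 y z y0 z0 u v u0 v0 B :
  oc_integrable a b P -> oc_integrable a b S -> oc_integrable a b Q ->
  oc_integrable a b P0 -> oc_integrable a b S0 -> oc_integrable a b Q0 ->
  bounded_measurable a b u -> bounded_measurable a b v ->
  bounded_measurable a b u0 -> bounded_measurable a b v0 ->
  (forall x, a <= x <= b -> `|u0 x| <= B) -> (forall x, a <= x <= b -> `|v0 x| <= B) ->
  primitive a b y (fun t => P t * v t - S t * u t) ->
  primitive a b z (fun t => S t * v t + Q t * u t) ->
  primitive a b y0 (fun t => P0 t * v0 t - S0 t * u0 t) ->
  primitive a b z0 (fun t => S0 t * v0 t + Q0 t * u0 t) ->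
  forall x, a <= x <= b -> `|y x - y0 x| + `|z x - z0 x| <=
   `|y a - y0 a| + `|z a - z0 a| + 2 * B * oc_int a b
   (sl_weight (fun t => P t - P0 t) (fun t => S t - S0 t) (fun t => Q t - Q0 t)) +
   oc_int a x (fun t => sl_weight P S Q t * (`|u t - u0 t| + `|v t - v0 t|)).
Proof.
move=> Pi Si Qi P0i S0i Q0i mu mv mu0 mv0 uB vB py pz py0 pz0 x /andP[ax xb].
have dy := primitiveB py py0; have dz := primitiveB pz pz0.
have Hy := primitive_dist dy (lexx a) ax xb.
have Hz := primitive_dist dz (lexx a) ax xb.
have [iy _] := primitive_restr dy (lexx a) ax xb.
have [iz _] := primitive_restr dz (lexx a) ax xb.
set W := sl_weight (fun t => P t - P0 t) _ _.
have Wi : oc_integrable a b W by apply: sl_weight_integrable; exact: oc_integrableB.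
have Wi' : oc_integrable a x W by exact: oc_integrableS Wi.
have B0 : 0 <= B by apply: le_trans (uB a _); rewrite ?lexx ?(le_trans ax).
set K := (fun t => sl_weight P S Q t * _).
have Ki : oc_integrable a x K.
  apply: (@oc_integrableS _ a b) => //; apply: bounded_measurable_integrableM.
    by apply: bounded_measurableD; apply: bounded_measurable_norm;
       apply: bounded_measurableB.
  exact: sl_weight_integrable.
have H : oc_int a x (fun t => `|(P t * v t - S t * u t) - (P0 t * v0 t - S0 t * u0 t)|) +
  oc_int a x (fun t => `|(S t * v t + Q t * u t) - (S0 t * v0 t + Q0 t * u0 t)|) <=
  oc_int a x (fun t => K t + 2 * B * W t).
  rewrite -oc_intD; [|exact: oc_integrable_norm|exact: oc_integrable_norm].
  apply: le_oc_int.
  - by apply: oc_integrableD; exact: oc_integrable_norm.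
  - by apply: oc_integrableD => //; exact: oc_integrableZ.
  move=> t /andP[ta tx]; apply: sl_solution_diff.
    by rewrite uB// (ltW ta) (le_trans tx).
  by rewrite vB// (ltW ta) (le_trans tx).
move: H; rewrite oc_intD//; last exact: oc_integrableZ.
rewrite oc_intZ// => H.
have HW : oc_int a x W <= oc_int a b W.
  by apply: oc_int_le_sub => // t _; exact: sl_weight_ge0.
have HW' : 2 * B * oc_int a x W <= 2 * B * oc_int a b W by rewrite ler_wpM2l// mulr_ge0.
have T (p q : R) : `|p| <= `|q| + `|p - q|.
  by rewrite -{1}(subrK q p) addrC ler_normD.
have := T (y x - y0 x) (y a - y0 a); have := T (z x - z0 x) (z a - z0 a).
lra.
Qed.

(** Gronwall's inequality for the distance of two solutions. Its factor sees the perturbed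
    coefficients only through [N], which makes the estimate uniform near a fixed system; the zero
    solution as reference gives the a priori bound. *)
Lemma sl_stability a b P S Q P0 S0 Q0 y z y0 z0 B N :
  oc_integrable a b P -> oc_integrable a b S -> oc_integrable a b Q ->
  oc_integrable a b P0 -> oc_integrable a b S0 -> oc_integrable a b Q0 ->
  sl_solution a b P S Q y z -> sl_solution a b P0 S0 Q0 y0 z0 ->
  (forall x, a <= x <= b -> `|y0 x| <= B) -> (forall x, a <= x <= b -> `|z0 x| <= B) ->
  oc_int a b (sl_weight P S Q) <= N%:R / 2 ->
  forall x, a <= x <= b -> `|y x - y0 x| + `|z x - z0 x| <=
   2 ^+ N * (`|y a - y0 a| + `|z a - z0 a| + 2 * B * oc_int a b
   (sl_weight (fun t => P t - P0 t) (fun t => S t - S0 t) (fun t => Q t - Q0 t))).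
Proof.
move=> Pi Si Qi P0i S0i Q0i sol sol0 yB zB kN x /andP[ax xb].
have ab := le_trans ax xb.
have [my mz] := sl_solution_measurable sol.
have [my0 mz0] := sl_solution_measurable sol0.
have B0 : 0 <= B by apply: le_trans (yB a _); rewrite ?lexx ?(le_trans ax).
have ki : oc_integrable a b (sl_weight P S Q) by exact: sl_weight_integrable.
set C := _ + _ + _ * oc_int a b _.
have C0 : 0 <= C.
  rewrite /C !addr_ge0// !mulr_ge0//; apply: oc_int_ge0 => t _; exact: sl_weight_ge0.
apply: (@gronwall _ a b (sl_weight P S Q) (fun t => `|y t - y0 t| + `|z t - z0 t|) C) => //.
- apply: bounded_measurable_integrableM => //.
  by apply: bounded_measurableD; apply: bounded_measurable_norm; apply: bounded_measurableB.
- by move=> t _; exact: sl_weight_ge0.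
- move=> t tab; have [py pz] := sol; have [py0 pz0] := sol0.
  exact: (sl_integral_dist Pi Si Qi P0i S0i Q0i my mz my0 mz0 yB zB py pz py0 pz0).
- by rewrite ax.
- apply: le_trans kN; apply: oc_int_le_sub => // t _; exact: sl_weight_ge0.
Qed.

Lemma sl_solution0 a b P S Q : sl_solution a b P S Q (fun=> 0) (fun=> 0).
Proof.
have H : primitive a b (fun=> 0 : R) (fun=> 0).
  split; first exact: oc_integrable_cst.
  by move=> x /andP[ax _]; rewrite oc_int_cst// mul0r addr0.
have E (g : R -> R) : (forall t, g t = 0) -> primitive a b (fun=> 0 : R) g.
  by move=> g0; have -> : g = (fun=> 0) by apply/funext.
by split; apply: E => t; ring.
Qed.

Lemma sl_solution_bound a b P S Q y z N : oc_integrable a b P -> oc_integrable a b S ->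
  oc_integrable a b Q -> sl_solution a b P S Q y z ->
  oc_int a b (sl_weight P S Q) <= N%:R / 2 ->
  forall x, a <= x <= b -> `|y x| + `|z x| <= 2 ^+ N * (`|y a| + `|z a|).
Proof.
move=> Pi Si Qi sol kN x xab.
have := @sl_stability a b P S Q P S Q y z (fun=> 0) (fun=> 0) 0 N Pi Si Qi Pi Si Qi
  sol (sl_solution0 _ _ _ _ _).
move=> /(_ (fun x _ => _))/(_ (fun x _ => _))/(_ kN x xab).
by rewrite !subr0 mulr0 mul0r addr0; apply; rewrite normr0.
Qed.

Lemma oc_int_sl_weight_nat a b P S Q : exists N : nat,
  oc_int a b (sl_weight P S Q) <= N%:R / 2.
Proof.
exists (Num.bound (2 * oc_int a b (sl_weight P S Q))).
rewrite ler_pdivlMr// mulrC; apply: ltW; apply: le_lt_trans (archi_boundP _).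
  exact: lexx.
by rewrite mulr_ge0//; apply: oc_int_ge0 => t _; exact: sl_weight_ge0.
Qed.

Lemma sl_solutionD a b P S Q y z y' z' : sl_solution a b P S Q y z ->
  sl_solution a b P S Q y' z' ->
  sl_solution a b P S Q (fun t => y t + y' t) (fun t => z t + z' t).
Proof.
move=> [py pz] [py' pz']; split.
  have := primitiveD py py'; congr primitive; apply/funext => t; ring.
have := primitiveD pz pz'; congr primitive; apply/funext => t; ring.
Qed.

Lemma sl_solutionB a b P S Q y z y' z' : sl_solution a b P S Q y z ->
  sl_solution a b P S Q y' z' ->
  sl_solution a b P S Q (fun t => y t - y' t) (fun t => z t - z' t).
Proof.
move=> [py pz] [py' pz']; split.
  have := primitiveB py py'; congr primitive; apply/funext => t; ring.
have := primitiveB pz pz'; congr primitive; apply/funext => t; ring.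
Qed.

Lemma sl_solutionZ a b P S Q (k : R) y z : sl_solution a b P S Q y z ->
  sl_solution a b P S Q (fun t => k * y t) (fun t => k * z t).
Proof.
move=> [py pz]; split.
  have := primitiveZ k py; congr primitive; apply/funext => t; ring.
have := primitiveZ k pz; congr primitive; apply/funext => t; ring.
Qed.

Lemma sl_solution_unique a b P S Q y z y' z' : oc_integrable a b P ->
  oc_integrable a b S -> oc_integrable a b Q -> sl_solution a b P S Q y z ->
  sl_solution a b P S Q y' z' -> y a = y' a -> z a = z' a ->
  forall x, a <= x <= b -> y x = y' x /\ z x = z' x.
Proof.
move=> Pi Si Qi sol sol' ya za x xab.
have [N kN] := oc_int_sl_weight_nat a b P S Q.
have := sl_solution_bound Pi Si Qi (sl_solutionB sol sol') kN xab.
rewrite ya za !subrr normr0 addr0 mulr0 => H.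
by split; apply/eqP; rewrite -subr_eq0 -normr_le0; apply: le_trans H; rewrite ?lerDl ?lerDr.
Qed.

(** In the derivative of the bracket the terms with [P] and [S] cancel, and only the difference of
    the potentials survives. *)
Lemma sl_lagrange a b P S Q Q' y z y' z' : a <= b -> sl_solution a b P S Q y z ->
  sl_solution a b P S Q' y' z' ->
  (y b * z' b - z b * y' b) - (y a * z' a - z a * y' a) =
  oc_int a b (fun t => (Q' t - Q t) * (y t * y' t)).
Proof.
move=> ab [py pz] [py' pz'].
have := primitiveB (primitiveM py pz') (primitiveM pz py').
move=> /primitive_sub /(_ (lexx a) ab (lexx b)) ->.
by apply: eq_oc_int => t _; ring.
Qed.

(** The terms with [S] cancel in the derivative of [y z]. The identity serves twice: to recover
    vanishing data of [z] from [y = 0], and to bound the spectrum from below. *)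
Lemma sl_energy a b P S Q y z : a <= b -> sl_solution a b P S Q y z ->
  y b * z b - y a * z a = oc_int a b (fun t => P t * z t ^+ 2 + Q t * y t ^+ 2).
Proof.
move=> ab [py pz].
have := primitiveM py pz => /primitive_sub /(_ (lexx a) ab (lexx b)) ->.
by apply: eq_oc_int => t _; ring.
Qed.

End System.

(** * Existence by Picard iteration *)

Section Existence.
Context {R : realType}.
Variables (a b c1 c2 : R) (P S Q : R -> R).
Hypotheses (ab : a <= b) (Pi : oc_integrable a b P) (Si : oc_integrable a b S)
  (Qi : oc_integrable a b Q).

Fixpoint picard (n : nat) : (R -> R) * (R -> R) :=
  if n is m.+1 then
    (fun x => c1 + oc_int a x (fun t => P t * (picard m).2 t - S t * (picard m).1 t),
     fun x => c2 + oc_int a x (fun t => S t * (picard m).2 t + Q t * (picard m).1 t))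
  else (fun=> c1, fun=> c2).

Let picard_bm_primitive n :
  [/\ bounded_measurable a b (picard n).1, bounded_measurable a b (picard n).2,
   primitive a b (picard n.+1).1 (fun t => P t * (picard n).2 t - S t * (picard n).1 t) &
   primitive a b (picard n.+1).2 (fun t => S t * (picard n).2 t + Q t * (picard n).1 t)].
Proof.
have prim y z : bounded_measurable a b y -> bounded_measurable a b z ->
   primitive a b (fun x => c1 + oc_int a x (fun t => P t * z t - S t * y t))
     (fun t => P t * z t - S t * y t) /\
   primitive a b (fun x => c2 + oc_int a x (fun t => S t * z t + Q t * y t))
     (fun t => S t * z t + Q t * y t).
  move=> my mz; have [i1 i2] := sl_rhs_integrable Pi Si Qi my mz.
  by split; split => // x xab; rewrite oc_int_xx addr0.
have bm_cst (c : R) : bounded_measurable a b (fun=> c).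
  by split; [exact: measurable_cst|exists `|c|].
elim: n => [|n [my mz py pz]].
  by have [p q] := prim _ _ (bm_cst c1) (bm_cst c2); split => //; exact: bm_cst.
have my' := primitive_bounded_measurable py; have mz' := primitive_bounded_measurable pz.
by have [p q] := prim _ _ my' mz'; split.
Qed.

Let step n x := `|(picard n.+1).1 x - (picard n).1 x| + `|(picard n.+1).2 x - (picard n).2 x|.

Let step_bm n : bounded_measurable a b (step n).
Proof.
have [m1 m2 _ _] := picard_bm_primitive n; have [m1' m2' _ _] := picard_bm_primitive n.+1.
by apply: bounded_measurableD; apply: bounded_measurable_norm; apply: bounded_measurableB.
Qed.

Let stepS n x : a <= x <= b ->
  step n.+1 x <= oc_int a x (fun t => sl_weight P S Q t * step n t).
Proof.
move=> xab.
have [m1 m2 p1 p2] := picard_bm_primitive n; have [m1' m2' p1' p2'] := picard_bm_primitive n.+1.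
have [_ [B1 HB1]] := m1; have [_ [B2 HB2]] := m2.
have HB1' t : a <= t <= b -> `|(picard n).1 t| <= Num.max B1 B2.
  by move=> tab; rewrite le_max HB1.
have HB2' t : a <= t <= b -> `|(picard n).2 t| <= Num.max B1 B2.
  by move=> tab; rewrite le_max HB2 ?orbT.
have := sl_integral_dist Pi Si Qi Pi Si Qi m1' m2' m1 m2 HB1' HB2' p1' p2' p1 p2 xab.
have -> : oc_int a b (sl_weight (fun t => P t - P t) (fun t => S t - S t)
    (fun t => Q t - Q t)) = 0.
  rewrite (@eq_oc_int _ _ _ _ (fun=> 0)) ?oc_int_cst ?mul0r// => t _.
  by rewrite /sl_weight !subrr normr0 !addr0.
by rewrite mulr0 addr0 /= !oc_int_xx !addr0 !subrr normr0 !add0r.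
Qed.

(** The partial sums satisfy Gronwall's hypothesis themselves: the sum of [n + 1] increments is at
    most [D] plus the integral of the weight times the sum of [n], and enlarging the latter to
    [n + 1] terms closes the inequality with a bound free of [n]. This replaces the usual factorial
    estimates. *)
Let sum_step_bound : exists B : R, forall n x, a <= x <= b -> \sum_(i < n) step i x <= B.
Proof.
have [N kN] := oc_int_sl_weight_nat a b P S Q.
have [_ [D HD]] := step_bm 0.
have D0 : 0 <= D by apply: le_trans (HD a _); rewrite ?lexx.
exists (2 ^+ N * D) => n.
have bm m : bounded_measurable a b (fun t => \sum_(i < m) step i t).
  elim: m => [|m IH].
    have := bounded_measurable0 a b; congr bounded_measurable.
    by apply/funext => t; rewrite big_ord0.
  have := bounded_measurableD IH (step_bm m); congr bounded_measurable.
  by apply/funext => t; rewrite big_ord_recr.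
have ki := sl_weight_integrable Pi Si Qi.
have ksi m : oc_integrable a b (fun t => sl_weight P S Q t * \sum_(i < m) step i t).
  exact: bounded_measurable_integrableM.
have s0 i t : 0 <= step i t by rewrite /step addr_ge0.
have H m x : a <= x <= b -> \sum_(i < m.+1) step i x <=
    D + oc_int a x (fun t => sl_weight P S Q t * \sum_(i < m) step i t).
  elim: m x => [|m IH] x xab.
    rewrite big_ord_recl big_ord0 addr0 (@eq_oc_int _ _ _ _ (fun=> 0)).
      rewrite oc_int_cst; last by case/andP: xab.
      by rewrite mul0r addr0 (le_trans (ler_norm _))// HD.
    by move=> t _; rewrite big_ord0 mulr0.
  rewrite big_ord_recr /=; apply: le_trans (lerD (IH _ xab) (stepS _ xab)) _.
  rewrite -addrA lerD2l -oc_intD; first last.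
  - apply: (@oc_integrableS _ a b) => //; first by case/andP: xab.
    exact: bounded_measurable_integrableM.
  - by apply: oc_integrableS (ksi m) => //; case/andP: xab.
  rewrite le_eqVlt; apply/orP; left; apply/eqP; apply: eq_oc_int => t _.
  by rewrite big_ord_recr /= -mulrDr.
move=> x xab; apply: (@gronwall _ a b (sl_weight P S Q) (fun t => \sum_(i < n) step i t)) => //.
- by move=> t _; exact: sl_weight_ge0.
- by move=> t _; apply: sumr_ge0 => i _.
- move=> t tab; case: n => [|n].
    by rewrite big_ord0 addr_ge0//; apply: oc_int_ge0 => u _; rewrite big_ord0 mulr0.
  apply: le_trans (H n t tab) _; rewrite lerD2l; apply: le_oc_int.
  + by apply: oc_integrableS (ksi n) => //; case/andP: tab.
  + by apply: oc_integrableS (ksi n.+1) => //; case/andP: tab.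
  + by move=> u _; rewrite ler_wpM2l ?sl_weight_ge0// big_ord_recr lerDl.
- apply: le_trans kN; case/andP: xab => ax xb; apply: oc_int_le_sub => // t _.
  exact: sl_weight_ge0.
Qed.

Let picard_cvg (f : nat -> R) (B : R) : (forall n, \sum_(i < n) `|f i.+1 - f i| <= B) ->
  cvgn f /\ forall n, `|f n| <= `|f 0%N| + B.
Proof.
move=> fB.
have fE n : f n = f 0%N + series (fun i => f i.+1 - f i) n.
  by rewrite /series/= telescope_sumr// addrC subrK.
have nB n : [normed series (fun i => f i.+1 - f i)] n <= B.
  by have := fB n; rewrite -(big_mkord xpredT (fun i => `|f i.+1 - f i|)).
split.
  have -> : f = (fun n => f 0%N + series (fun i => f i.+1 - f i) n) by apply/funext.
  apply: is_cvgD; first exact: is_cvg_cst.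
  apply: normed_cvg; apply: nondecreasing_is_cvgn.
    by apply: nondecreasing_series => *; exact: normr_ge0.
  by exists B => _ [n _ <-]; exact: nB.
move=> n; rewrite fE; apply: le_trans (ler_normD _ _) _; rewrite lerD2l.
by apply: le_trans (nB n); rewrite /series/=; exact: ler_norm_sum.
Qed.

(** The iterates converge pointwise and are bounded uniformly in [n] and [x], so dominated
    convergence, with a multiple of the weight as majorant, passes to the limit in the integral
    equations. *)
Lemma sl_solution_exists : exists y z, [/\ sl_solution a b P S Q y z, y a = c1 & z a = c2].
Proof.
have [B HB] := sum_step_bound.
have cv1 x : a <= x <= b -> cvgn (fun n => (picard n).1 x) /\
    forall n, `|(picard n).1 x| <= `|c1| + B.
  move=> xab; apply: (@picard_cvg (fun n => (picard n).1 x)) => n.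
  by apply: le_trans (HB n x xab); apply: ler_sum => i _; rewrite /step lerDl.
have cv2 x : a <= x <= b -> cvgn (fun n => (picard n).2 x) /\
    forall n, `|(picard n).2 x| <= `|c2| + B.
  move=> xab; apply: (@picard_cvg (fun n => (picard n).2 x)) => n.
  by apply: le_trans (HB n x xab); apply: ler_sum => i _; rewrite /step lerDr.
pose y x := limn (fun n => (picard n).1 x); pose z x := limn (fun n => (picard n).2 x).
have dct x : a <= x <= b ->
  [/\ oc_integrable a x (fun t => P t * z t - S t * y t),
   oc_integrable a x (fun t => S t * z t + Q t * y t),
   y x = c1 + oc_int a x (fun t => P t * z t - S t * y t) &
   z x = c2 + oc_int a x (fun t => S t * z t + Q t * y t)].
  move=> xab; have [ax xb] := andP xab.
  have tab t : a < t <= x -> a <= t <= b.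
    by move=> /andP[a_t tx]; rewrite ltW//= (le_trans tx).
  have hi : oc_integrable a x (fun t => (`|c1| + `|c2| + B) * sl_weight P S Q t).
    by apply: oc_integrableZ; apply: oc_integrableS (sl_weight_integrable Pi Si Qi).
  have B0 : 0 <= B by apply: le_trans (HB 0%N x xab); rewrite big_ord0.
  have bnd n t : a < t <= x ->
     `|P t * (picard n).2 t - S t * (picard n).1 t| <=
       (`|c1| + `|c2| + B) * sl_weight P S Q t /\
     `|S t * (picard n).2 t + Q t * (picard n).1 t| <=
       (`|c1| + `|c2| + B) * sl_weight P S Q t.
    move=> /tab ht; have [_ /(_ n) h1] := cv1 _ ht; have [_ /(_ n) h2] := cv2 _ ht.
    have {}h1 : `|(picard n).1 t| <= `|c1| + `|c2| + B by have := normr_ge0 c2; lra.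
    have {}h2 : `|(picard n).2 t| <= `|c1| + `|c2| + B by have := normr_ge0 c1; lra.
    set M := _ + _ + B in h1 h2 *; have M0 : 0 <= M by rewrite /M !addr_ge0.
    have hP := ler_wpM2l (normr_ge0 (P t)) h2; have hS2 := ler_wpM2l (normr_ge0 (S t)) h2.
    have hS1 := ler_wpM2l (normr_ge0 (S t)) h1; have hQ := ler_wpM2l (normr_ge0 (Q t)) h1.
    have hP0 : 0 <= `|P t| * M by rewrite mulr_ge0.
    have hQ0 : 0 <= `|Q t| * M by rewrite mulr_ge0.
    rewrite /sl_weight; split.
      apply: le_trans (ler_normB _ _) _; rewrite !normrM; lra.
    apply: le_trans (ler_normD _ _) _; rewrite !normrM; lra.
  have pi n : oc_integrable a x (fun t => P t * (picard n).2 t - S t * (picard n).1 t) /\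
     oc_integrable a x (fun t => S t * (picard n).2 t + Q t * (picard n).1 t).
    have [m1 m2 _ _] := picard_bm_primitive n.
    have [i1 i2] := sl_rhs_integrable Pi Si Qi m1 m2.
    by split; [exact: oc_integrableS i1|exact: oc_integrableS i2].
  have [I1 L1] := @oc_int_dct R a x
     (fun n t => P t * (picard n).2 t - S t * (picard n).1 t)
     (fun t => P t * z t - S t * y t) _ hi (fun n => (pi n).1)
     (fun t ht => cvgB (cvgM (cvg_cst (P t)) (cv2 _ (tab t ht)).1) (cvgM (cvg_cst (S t)) (cv1 _ (tab t ht)).1))
     (fun n t ht => (bnd n t ht).1).
  have [I2 L2] := @oc_int_dct R a x
     (fun n t => S t * (picard n).2 t + Q t * (picard n).1 t)
     (fun t => S t * z t + Q t * y t) _ hi (fun n => (pi n).2)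
     (fun t ht => cvgD (cvgM (cvg_cst (S t)) (cv2 _ (tab t ht)).1) (cvgM (cvg_cst (Q t)) (cv1 _ (tab t ht)).1))
     (fun n t ht => (bnd n t ht).2).
  have H1 : (fun n => (picard n.+1).1 x) @ \oo --> y x 
    by have := (cv1 _ xab).1; rewrite -cvg_shiftS.
  have H2 : (fun n => (picard n.+1).2 x) @ \oo --> z x 
    by have := (cv2 _ xab).1; rewrite -cvg_shiftS.
  split => //.
    by rewrite -(cvg_lim _ H1)//; apply: cvg_lim => //; apply: cvgD; [exact: cvg_cst|exact: L1].
  by rewrite -(cvg_lim _ H2)//; apply: cvg_lim => //; apply: cvgD; [exact: cvg_cst|exact: L2].
(* At [b], [dct] gives integrability on the whole interval; at [a], the initial values. *)
have [|ib1 ib2 _ _] := dct b; first by rewrite ab lexx.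
have [|_ _ ya za] := dct a; first by rewrite lexx ab.
rewrite oc_int_xx addr0 in ya; rewrite oc_int_xx addr0 in za.
exists y, z; split => //; split; split => // x xab; have [_ _ yx zx] := dct x xab.
  by rewrite ya.
by rewrite za.
Qed.

End Existence.

(** * Strict positivity of weighted integrals *)

Section Positivity.
Context {R : realType}.
Local Notation mu := (@lebesgue_measure R).
Implicit Types (a b c x : R) (f g w : R -> R).

Lemma ae_itv_exists a b (Pr : R -> Prop) : a < b ->
  {ae mu, forall x, `]a, b[%classic x -> Pr x} -> exists2 x, a < x < b & Pr x.
Proof.
move=> ab [N [mN N0 HN]]; apply: contrapT => H.
have sub : `]a, b[%classic `<=` N.
  move=> x xab; apply: HN => /= h; apply: H; exists x; last exact: h.
  by move: xab; rewrite /= in_itv.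
have : (mu `]a, b[%classic <= 0)%E by rewrite -N0; apply: le_measure; rewrite ?inE.
by rewrite lebesgue_measure_itv/= lte_fin ab -EFinB lee_fin subr_le0 leNgt ab.
Qed.

Lemma oc_int_eq0_ae a b g : oc_integrable a b g -> oc_int a b (fun x => `|g x|) = 0 ->
  {ae mu, forall x, `]a, b[%classic x -> g x = 0}.
Proof.
move=> gi g0.
have gni := oc_integrable_norm gi.
have g0E : (\int[mu]_(x in `]a, b]) `|(EFin \o g) x| = 0)%E.
  have := congr1 EFin g0; rewrite /oc_int /Rintegral fineK//.
  exact: integrable_fin_num.
have := (@ae_eq_integral_abs _ _ R mu `]a, b]%classic (measurable_itv _) (EFin \o g)
  (measurable_int mu gi)).1 g0E.
move=> [N [mN N0 HN]]; exists N; split => // x /= h; apply: HN => /= H; apply: h.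
rewrite in_itv/= => /andP[ax xb].
by have [] : (g x)%:E = 0%E by apply: H; rewrite in_itv/= ax ltW.
Qed.

Lemma continuous_neq0_itv a b f x0 : a < b -> a <= x0 <= b ->
  {within `[a, b], continuous f} -> f x0 != 0 ->
  exists u v, [/\ a <= u, u < v, v <= b & forall x, u <= x <= v -> f x != 0].
Proof.
move=> ab /andP[ax xb] /subspace_continuousP /(_ x0) fc fx0.
have /fc : `[a, b]%classic x0 by rewrite /= in_itv/= ax.
move=> /cvgrPdist_lt /(_ `|f x0|); rewrite normr_gt0 => /(_ fx0).
move=> /nbhs_ballP[d /= d0 H].
have Hd x : a <= x <= b -> `|x0 - x| < d -> f x != 0.
  move=> xab xd; apply/eqP => fx.
  have : `|f x0 - f x| < `|f x0| by apply: H => //; rewrite /= in_itv.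
  by rewrite fx subr0 ltxx.
have [xltb|] := ltP x0 b.
  exists x0, (Num.min (x0 + d / 2) b); split => //.
  - by rewrite lt_min xltb andbT ltrDl divr_gt0.
  - by rewrite ge_min lexx orbT.
  move=> x /andP[x0x]; rewrite le_min => /andP[xd xb']; apply: Hd.
    by rewrite xb' (le_trans ax).
  by rewrite ltr_distlC; apply/andP; split; lra.
move=> bx; have {bx}x0b : x0 = b by apply/le_anti; rewrite xb bx.
exists (Num.max (b - d / 2) a), b; split => //.
- by rewrite le_max lexx orbT.
- by rewrite gt_max ab andbT ltrBlDr ltrDl divr_gt0.
move=> x /andP[]; rewrite ge_max => /andP[xd xa] xb'; apply: Hd; first by rewrite xa.
by rewrite x0b ltr_distlC; apply/andP; split; lra.
Qed.

Lemma ae_eq_oc_int_oo a b f g : oc_integrable a b f -> oc_integrable a b g ->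
  {ae mu, forall x, `]a, b[%classic x -> f x = g x} ->
  oc_int a b f = oc_int a b g.
Proof.
move=> fi gi fg.
rewrite !oc_int_oo; first last.
- by apply: integrableS fi => //; apply: subset_itv; rewrite bnd_simp.
- by apply: integrableS gi => //; apply: subset_itv; rewrite bnd_simp.
rewrite /Rintegral; congr fine; apply: ae_eq_integral => //.
- by apply: measurable_funS (measurable_int mu fi) => //; apply: subset_itv; rewrite bnd_simp.
- by apply: measurable_funS (measurable_int mu gi) => //; apply: subset_itv; rewrite bnd_simp.
- apply: filterS fg; first exact: (ae_filter_ringOfSetsType mu).
  by move=> x /= h /h ->.
Qed.

(** Being continuous, [f] is non-zero on an interval of positive length. A zero integral would make
    [w * f ^+ 2] vanish almost everywhere, contradicting [w > 0] at some point of that interval. *)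
Lemma oc_int_weight_gt0 a b w f f' x0 : a < b -> oc_integrable a b w ->
  {ae mu, forall x, `]a, b[%classic x -> 0 < w x} -> primitive a b f f' ->
  a <= x0 <= b -> f x0 != 0 -> 0 < oc_int a b (fun x => w x * f x ^+ 2).
Proof.
move=> ab wi w0 pf x0ab fx0.
have wffi : oc_integrable a b (fun x => w x * f x ^+ 2).
  apply: (@eq_oc_integrable _ _ _ (fun x => f x * (f x * w x))) => [x _|]; first by ring.
  exact/(primitive_integrableM pf)/(primitive_integrableM pf).
have E : oc_int a b (fun x => w x * f x ^+ 2) = oc_int a b (fun x => `|w x * f x ^+ 2|).
  apply: ae_eq_oc_int_oo => //; first exact: oc_integrable_norm.
  move: w0; apply: filterS; first exact: (ae_filter_ringOfSetsType mu).
  by move=> x /= h /h /ltW wx; rewrite ger0_norm// mulr_ge0// sqr_ge0.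
rewrite lt_neqAle; apply/andP; split; last by rewrite E; apply: oc_int_ge0.
rewrite eq_sym; apply/eqP; rewrite E => /(oc_int_eq0_ae wffi) H.
have [u [v [au uv vb Huv]]] := continuous_neq0_itv ab x0ab (primitive_continuous pf) fx0.
have [] := @ae_itv_exists u v (fun x => 0 < w x /\ w x * f x ^+ 2 = 0) uv.
  move: w0 H; apply: filterS2; first exact: (ae_filter_ringOfSetsType mu).
  move=> x /= h1 h2; rewrite in_itv/= => /andP[ux xv].
  have xab : x \in `]a, b[ by rewrite in_itv/= (le_lt_trans au)// (lt_le_trans xv).
  by split; [exact: h1|exact: h2].
move=> x /andP[/ltW ux /ltW xv] [wx /eqP].
rewrite mulf_eq0 gt_eqF//= sqrf_eq0; apply/negP; apply: Huv.
by rewrite ux.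
Qed.

Lemma abs_continuous_within a b f : abs_continuous a b f ->
  {within `[a, b], continuous f}.
Proof.
move=> acf; apply: within_itv_continuous => x /andP[ax xb] e e0.
have [d d0 H] := acf e e0; exists d => // y /andP[ay yb] xyd.
have K u v : a <= u -> u <= v -> v <= b -> v - u < d -> `|f v - f u| < e.
  move=> au uv vb uvd; have := H 1%N (fun=> u) (fun=> v).
  rewrite !big_ord1; apply => //.
  by apply/trivIsetP => i j _ _; rewrite !ord1 eqxx.
have [xy|/ltW yx] := leP x y.
  by rewrite distrC K//; apply: le_lt_trans xyd; rewrite distrC ler_norm.
by rewrite K//; apply: le_lt_trans xyd; rewrite ler_norm.
Qed.

Lemma continuous_bounded_measurable a b f : a <= b ->
  {within `[a, b], continuous f} -> bounded_measurable a b f.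
Proof.
move=> ab fc; split.
  have H := subspace_continuous_measurable_fun (measurable_itv _) fc.
  by apply: measurable_funS H => //; apply: subset_itv; rewrite bnd_simp.
have [c _ Hc] := EVT_max ab fc; have [d _ Hd] := EVT_min ab fc.
exists (`|f c| + `|f d|) => x xab.
have {}xab : x \in `[a, b] by rewrite in_itv.
have := Hc _ xab; have := Hd _ xab; have := ler_norm (f c); have := ler_norm (- f d).
rewrite normrN ler_norml => h1 h2 h3 h4; have := normr_ge0 (f c); have := normr_ge0 (f d).
by move=> h5 h6; apply/andP; split; lra.
Qed.

End Positivity.

(** * Transfer matrix and eigenspaces *)

Section ComplexParts.
Context {R : realType}.
Implicit Types (u v : R[i]) (k : R).
Local Notation Re := (@complex.Re _).
Local Notation Im := (@complex.Im _).

Lemma ReD u v : Re (u + v) = Re u + Re v. Proof. by case: u; case: v. Qed.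
Lemma ImD u v : Im (u + v) = Im u + Im v. Proof. by case: u; case: v. Qed.
Lemma ReN u : Re (- u) = - Re u. Proof. by case: u. Qed.
Lemma ImN u : Im (- u) = - Im u. Proof. by case: u. Qed.
Lemma ReM u v : Re (u * v) = Re u * Re v - Im u * Im v.
Proof. by case: u; case: v. Qed.
Lemma ImM u v : Im (u * v) = Re u * Im v + Im u * Re v.
Proof. by case: u; case: v. Qed.
Lemma ReZ k u : Re (k%:C * u) = k * Re u.
Proof. by rewrite ReM/= mul0r subr0. Qed.
Lemma ImZ k u : Im (k%:C * u) = k * Im u.
Proof. by rewrite ImM/= mul0r addr0. Qed.
Lemma eq_ReIm u v : Re u = Re v -> Im u = Im v -> u = v.
Proof. by case: u => a b; case: v => c d /= -> ->. Qed.

End ComplexParts.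

Section Coefficients.
Context {R : realType}.
Local Notation mu := (@lebesgue_measure R).
Local Notation Re := (@complex.Re _).
Local Notation Im := (@complex.Im _).
Implicit Types (om : coefficients R) (l : R).

Definition cf_P om x := (coef_p om x)^-1.
Definition cf_Q om l x := coef_q om x - l * coef_r om x.

Definition sl_sol a b om l := sl_solution a b (cf_P om) (coef_s om) (cf_Q om l).

Variables (a b : R).
Hypothesis ab : a < b.

Section Fixed.
Variable om : coefficients R.
Hypothesis Som : coef_space a b om.

Lemma cf_P_integrable : oc_integrable a b (cf_P om).
Proof. by case: Som => [[h _ _ _] _ _]; exact: oo_oc_integrable. Qed.

Lemma coef_q_integrable : oc_integrable a b (coef_q om).
Proof. by case: Som => [[_ h _ _] _ _]; exact: oo_oc_integrable. Qed.

Lemma coef_r_integrable : oc_integrable a b (coef_r om).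
Proof. by case: Som => [[_ _ h _] _ _]; exact: oo_oc_integrable. Qed.

Lemma coef_s_integrable : oc_integrable a b (coef_s om).
Proof. by case: Som => [[_ _ _ h] _ _]; exact: oo_oc_integrable. Qed.

Lemma cf_Q_integrable l : oc_integrable a b (cf_Q om l).
Proof.
apply: oc_integrableB; first exact: coef_q_integrable.
exact/oc_integrableZ/coef_r_integrable.
Qed.

Lemma coef_p_gt0 : {ae mu, forall x, `]a, b[%classic x -> 0 < coef_p om x}.
Proof. by case: Som. Qed.

Lemma cf_P_gt0 : {ae mu, forall x, `]a, b[%classic x -> 0 < cf_P om x}.
Proof.
apply: filterS coef_p_gt0; first exact: (ae_filter_ringOfSetsType mu).
by move=> x /= h /h; rewrite /cf_P invr_gt0.
Qed.

Lemma coef_r_gt0 : {ae mu, forall x, `]a, b[%classic x -> 0 < coef_r om x}.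
Proof. by case: Som. Qed.

Lemma abs_continuous_sl_sol l (y z : R -> R) : abs_continuous a b y ->
  abs_continuous a b z ->
  {ae mu, forall x, `]a, b[%classic x ->
    is_derive x 1 y (cf_P om x * z x - coef_s om x * y x) /\
    is_derive x 1 z (coef_s om x * z x + cf_Q om l x * y x)} ->
  sl_sol a b om l y z.
Proof.
move=> acy acz H.
have my := continuous_bounded_measurable (ltW ab) (abs_continuous_within acy).
have mz := continuous_bounded_measurable (ltW ab) (abs_continuous_within acz).
have [i1 i2] := sl_rhs_integrable cf_P_integrable coef_s_integrable (cf_Q_integrable l) my mz.
split; apply: abs_continuous_bounded_ae_primitive => //; move: H;
  (apply: filterS; first exact: (ae_filter_ringOfSetsType mu));
  by move=> x /= h /h [].
Qed.

(** Solving the definition of [y^[1]] for the derivative divides by [coef_p], which is legitimate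
    almost everywhere. *)
Lemma is_solution_sl_sol l (y z : R -> R[i]) : is_solution a b om l%:C y z ->
  sl_sol a b om l (fun x => Re (y x)) (fun x => Re (z x)) /\
  sl_sol a b om l (fun x => Im (y x)) (fun x => Im (z x)).
Proof.
move=> [[acyr acyi] [aczr aczi] H].
have K : {ae mu, forall x, `]a, b[%classic x ->
    (is_derive x 1 (fun t => Re (y t)) (cf_P om x * Re (z x) - coef_s om x * Re (y x)) /\
    is_derive x 1 (fun t => Re (z t)) (coef_s om x * Re (z x) + cf_Q om l x * Re (y x))) /\
    (is_derive x 1 (fun t => Im (y t)) (cf_P om x * Im (z x) - coef_s om x * Im (y x)) /\
    is_derive x 1 (fun t => Im (z t)) (coef_s om x * Im (z x) + cf_Q om l x * Im (y x)))}.
  move: H coef_p_gt0; apply: filterS2; first exact: (ae_filter_ringOfSetsType mu).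
  move=> x /= h1 h2 xab.
  have [dy [dz [[dyr dyi] [dzr dzi] E1 E2]]] := h1 xab; have {h1 h2}p0 := h2 xab.
  have p1 : coef_p om x != 0 by rewrite gt_eqF.
  have E1r := congr1 Re E1; have E1i := congr1 Im E1.
  rewrite ReZ ReD ReZ in E1r; rewrite ImZ ImD ImZ in E1i.
  have E2r := congr1 Re E2; have E2i := congr1 Im E2.
  rewrite !ReD -mulrA !ReZ ReN in E2r; rewrite !ImD -mulrA !ImZ ImN in E2i.
  have -> : cf_P om x * Re (z x) - coef_s om x * Re (y x) = Re dy.
    by rewrite E1r /cf_P; field.
  have -> : cf_P om x * Im (z x) - coef_s om x * Im (y x) = Im dy.
    by rewrite E1i /cf_P; field.
  have -> : coef_s om x * Re (z x) + cf_Q om l x * Re (y x) = Re dz.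
    by rewrite /cf_Q; move: E2r; lra.
  have -> : coef_s om x * Im (z x) + cf_Q om l x * Im (y x) = Im dz.
    by rewrite /cf_Q; move: E2i; lra.
  by [].
split; apply: abs_continuous_sl_sol => //; move: K;
  (apply: filterS; first exact: (ae_filter_ringOfSetsType mu));
  by move=> x /= h /h [].
Qed.

Lemma sl_sol_is_solution l (y z : R -> R[i]) :
  sl_sol a b om l (fun x => Re (y x)) (fun x => Re (z x)) ->
  sl_sol a b om l (fun x => Im (y x)) (fun x => Im (z x)) ->
  is_solution a b om l%:C y z.
Proof.
move=> [pyr pzr] [pyi pzi]; split.
- by split; [exact: primitive_abs_continuous pyr|exact: primitive_abs_continuous pyi].
- by split; [exact: primitive_abs_continuous pzr|exact: primitive_abs_continuous pzi].
have Hr : {ae mu, forall x, `]a, b[%classic x ->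
    (is_derive x 1 (fun t => Re (y t)) (cf_P om x * Re (z x) - coef_s om x * Re (y x)) /\
    is_derive x 1 (fun t => Re (z t)) (coef_s om x * Re (z x) + cf_Q om l x * Re (y x)))}.
  move: (primitive_derive pyr) (primitive_derive pzr).
  apply: filterS2; first exact: (ae_filter_ringOfSetsType mu).
  by move=> x /= h1 h2 xab; split; [exact: h1|exact: h2].
have Hi : {ae mu, forall x, `]a, b[%classic x ->
    (is_derive x 1 (fun t => Im (y t)) (cf_P om x * Im (z x) - coef_s om x * Im (y x)) /\
    is_derive x 1 (fun t => Im (z t)) (coef_s om x * Im (z x) + cf_Q om l x * Im (y x)))}.
  move: (primitive_derive pyi) (primitive_derive pzi).
  apply: filterS2; first exact: (ae_filter_ringOfSetsType mu).
  by move=> x /= h1 h2 xab; split; [exact: h1|exact: h2].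
move: Hr Hi coef_p_gt0; apply: filterS3; first exact: (ae_filter_ringOfSetsType mu).
move=> x /= h1 h2 h3 xab; have [r1 r2] := h1 xab; have [i1 i2] := h2 xab.
have p1 : coef_p om x != 0 by rewrite gt_eqF// h3.
exists (Complex (cf_P om x * Re (z x) - coef_s om x * Re (y x))
  (cf_P om x * Im (z x) - coef_s om x * Im (y x))),
 (Complex (coef_s om x * Re (z x) + cf_Q om l x * Re (y x))
  (coef_s om x * Im (z x) + cf_Q om l x * Im (y x))).
split => //; apply: eq_ReIm.
- by rewrite ReZ ReD ReZ/= /cf_P; field.
- by rewrite ImZ ImD ImZ/= /cf_P; field.
- by rewrite !ReD -mulrA !ReZ ReN/= /cf_Q; ring.
- by rewrite !ImD -mulrA !ImZ ImN/= /cf_Q; ring.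
Qed.

End Fixed.

Lemma sl_fun_subproof : exists F : coefficients R -> R -> R * R -> (R -> R) * (R -> R),
  forall om l c, coef_space a b om ->
  [/\ sl_sol a b om l (F om l c).1 (F om l c).2, (F om l c).1 a = c.1 & (F om l c).2 a = c.2].
Proof.
have H (t : coefficients R * R * (R * R)) : exists w : (R -> R) * (R -> R),
    coef_space a b t.1.1 ->
    [/\ sl_sol a b t.1.1 t.1.2 w.1 w.2, w.1 a = t.2.1 & w.2 a = t.2.2].
  (* Outside the coefficient space the value is a dummy. *)
  have [Som|nS] := pselect (coef_space a b t.1.1); last by exists (fun=> 0, fun=> 0).
  have [y [z [sol ya za]]] := sl_solution_exists t.2.1 t.2.2 (ltW ab) (cf_P_integrable Som)
    (coef_s_integrable Som) (cf_Q_integrable Som t.1.2).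
  by exists (y, z).
have [F HF] := choice H.
by exists (fun om l c => F (om, l, c)) => om l c; exact: HF (om, l, c).
Qed.

(* The witness is taken once for all parameters, so that conversion never unfolds
   the differential system when comparing solutions. *)
Definition sl_fun : coefficients R -> R -> R * R -> (R -> R) * (R -> R) :=
  projT1 (cid sl_fun_subproof).

Lemma sl_funP om l c : coef_space a b om ->
  [/\ sl_sol a b om l (sl_fun om l c).1 (sl_fun om l c).2,
   (sl_fun om l c).1 a = c.1 & (sl_fun om l c).2 a = c.2].
Proof. by rewrite /sl_fun; case: cid => F HF /=; exact: HF. Qed.

Definition sl_base om l (j : 'I_2) := sl_fun om l ((j == 0)%:R, (j == 1)%:R).

Definition transfer om l : 'M[R]_2 :=
  \matrix_(i, j) (if i == 0 then (sl_base om l j).1 b else (sl_base om l j).2 b).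

Lemma sl_sol_base om l y z : coef_space a b om -> sl_sol a b om l y z ->
  forall x, a <= x <= b ->
  y x = y a * (sl_base om l 0).1 x + z a * (sl_base om l 1).1 x /\
  z x = y a * (sl_base om l 0).2 x + z a * (sl_base om l 1).2 x.
Proof.
move=> Som sol x xab.
have [s0 y0 z0] := sl_funP l ((0 == 0 :> 'I_2)%:R, (0 == 1 :> 'I_2)%:R) Som.
have [s1 y1 z1] := sl_funP l ((1 == 0 :> 'I_2)%:R, (1 == 1 :> 'I_2)%:R) Som.
have := sl_solutionD (sl_solutionZ (y a) s0) (sl_solutionZ (z a) s1).
move=> /(sl_solution_unique (cf_P_integrable Som) (coef_s_integrable Som)
  (cf_Q_integrable Som l) sol); apply => //.
  by rewrite y0 y1 /= mulr1 mulr0 addr0.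
by rewrite z0 z1 /= mulr1 mulr0 add0r.
Qed.

(** With [y = 0] the energy identity makes the integral of [z ^+ 2 / p] vanish, so [z a = 0] by
    positivity. Eigenfunctions are recorded through [y] alone, and this makes the passage from
    initial data to [y] injective. *)
Lemma sl_sol_eq0 om l y z : coef_space a b om -> sl_sol a b om l y z ->
  (forall x, a <= x <= b -> y x = 0) -> y a = 0 /\ z a = 0.
Proof.
move=> Som sol y0; split; first by rewrite y0// lexx ltW.
apply/eqP; apply: contrapT => /negP za.
have [_ pz] := sol; have ale : a <= a <= b by rewrite lexx ltW.
have := oc_int_weight_gt0 ab (cf_P_integrable Som) (cf_P_gt0 Som) pz ale za.
have := sl_energy (ltW ab) sol; rewrite !y0 ?lexx ?ltW// !mul0r subr0.
rewrite (@eq_oc_int _ _ _ _ (fun x => cf_P om x * z x ^+ 2)) => [<-|x /andP[/ltW ax xb]].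
  by rewrite ltxx.
by rewrite y0 ?ax// expr0n/= mulr0 addr0.
Qed.

End Coefficients.

Lemma big_ord2 (V : nmodType) (F : 'I_2 -> V) : \sum_(i < 2) F i = F 0 + F 1.
Proof.
by rewrite !big_ord_recl big_ord0 addr0; congr (F _ + F _); apply: val_inj.
Qed.

Lemma ord2P (Pr : 'I_2 -> Prop) : Pr 0 -> Pr 1 -> forall i, Pr i.
Proof.
move=> P0 P1 [[|[|i]] hi] //.
  by have <- : 0 = Ordinal hi by apply: val_inj.
by have <- : 1 = Ordinal hi by apply: val_inj.
Qed.

Section Eigenspace.
Context {R : realType}.
Local Notation C := R[i].
Local Notation Re := (@complex.Re _).
Local Notation Im := (@complex.Im _).
Implicit Types (om : coefficients R) (l : R).
Variables (a b : R).
Hypothesis ab : a < b.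
Variables (A B : 'M[R[i]]_2).

(** Its kernel consists of the data [(y, y1)] at [a] of the solutions satisfying the boundary
    condition. *)
Definition charmx om l : 'M[C]_2 := A + B *m map_mx (real_complex R) (transfer ab om l).

Section Fixed.
Variables (om : coefficients R) (l : R).
Hypothesis Som : coef_space a b om.
Local Notation base := (sl_base ab om l).

Definition csol (c : 'cV[C]_2) x : C := (((base 0).1 x)%:C * c 0 0 + ((base 1).1 x)%:C * c 1 0).
Definition csol1 (c : 'cV[C]_2) x : C := (((base 0).2 x)%:C * c 0 0 + ((base 1).2 x)%:C * c 1 0).

Lemma Re_csol c x : Re (csol c x) = Re (c 0 0) * (base 0).1 x + Re (c 1 0) * (base 1).1 x.
Proof. by rewrite ReD !ReZ ![Re (c _ _) * _]mulrC. Qed.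
Lemma Im_csol c x : Im (csol c x) = Im (c 0 0) * (base 0).1 x + Im (c 1 0) * (base 1).1 x.
Proof. by rewrite ImD !ImZ ![Im (c _ _) * _]mulrC. Qed.
Lemma Re_csol1 c x : Re (csol1 c x) = Re (c 0 0) * (base 0).2 x + Re (c 1 0) * (base 1).2 x.
Proof. by rewrite ReD !ReZ ![Re (c _ _) * _]mulrC. Qed.
Lemma Im_csol1 c x : Im (csol1 c x) = Im (c 0 0) * (base 0).2 x + Im (c 1 0) * (base 1).2 x.
Proof. by rewrite ImD !ImZ ![Im (c _ _) * _]mulrC. Qed.

Lemma sl_sol_csol c :
  sl_sol a b om l (fun x => Re (csol c x)) (fun x => Re (csol1 c x)) /\
  sl_sol a b om l (fun x => Im (csol c x)) (fun x => Im (csol1 c x)).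
Proof.
have [s0 _ _] := sl_funP ab l ((0 == 0 :> 'I_2)%:R, (0 == 1 :> 'I_2)%:R) Som.
have [s1 _ _] := sl_funP ab l ((1 == 0 :> 'I_2)%:R, (1 == 1 :> 'I_2)%:R) Som.
split.
  have := sl_solutionD (sl_solutionZ (Re (c 0 0)) s0) (sl_solutionZ (Re (c 1 0)) s1).
  by congr sl_solution; apply/funext => x; rewrite (Re_csol, Re_csol1).
have := sl_solutionD (sl_solutionZ (Im (c 0 0)) s0) (sl_solutionZ (Im (c 1 0)) s1).
by congr sl_solution; apply/funext => x; rewrite (Im_csol, Im_csol1).
Qed.

Lemma sl_base_a : [/\ (base 0).1 a = 1, (base 0).2 a = 0, (base 1).1 a = 0 & (base 1).2 a = 1].
Proof.
have [_ h1 h2] := sl_funP ab l ((0 == 0 :> 'I_2)%:R, (0 == 1 :> 'I_2)%:R) Som.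
by have [_ h3 h4] := sl_funP ab l ((1 == 0 :> 'I_2)%:R, (1 == 1 :> 'I_2)%:R) Som.
Qed.

Lemma csol_a c : vec2 (csol c a) (csol1 c a) = c.
Proof.
have [h1 h2 h3 h4] := sl_base_a.
apply/matrixP => i j; rewrite (ord1 j) mxE; elim/ord2P: i => /=.
  by rewrite /csol h1 h3 mul1r mul0r addr0.
by rewrite /csol1 h2 h4 mul1r mul0r add0r.
Qed.

Lemma csol_b c : vec2 (csol c b) (csol1 c b) =
  map_mx (real_complex R) (transfer ab om l) *m c.
Proof.
by apply/matrixP => i j; rewrite (ord1 j) !mxE big_ord2 !mxE; elim/ord2P: i.
Qed.

Lemma charmx_csol c : A *m vec2 (csol c a) (csol1 c a) + B *m vec2 (csol c b) (csol1 c b) =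
  charmx om l *m c.
Proof. by rewrite csol_a csol_b mulmxDl mulmxA. Qed.

Lemma csol_eigenspace c : charmx om l *m c = 0 -> Defs.eigenspace a b A B om l%:C (csol c).
Proof.
move=> h; exists (csol1 c); last by rewrite charmx_csol.
by have [h1 h2] := sl_sol_csol c; apply: sl_sol_is_solution.
Qed.

Lemma eigenspace_csol y : Defs.eigenspace a b A B om l%:C y ->
  exists2 c, charmx om l *m c = 0 & forall x, `[a, b]%classic x -> y x = csol c x.
Proof.
move=> [y1 /(is_solution_sl_sol ab Som)[sr si] bc].
pose c := vec2 (y a) (y1 a).
have E x : a <= x <= b -> y x = csol c x /\ y1 x = csol1 c x.
  move=> xab; have [r1 r2] := sl_sol_base ab Som sr xab; have [i1 i2] := sl_sol_base ab Som si xab.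
  split; apply: eq_ReIm.
  - by rewrite r1 Re_csol !mxE.
  - by rewrite i1 Im_csol !mxE.
  - by rewrite r2 Re_csol1 !mxE.
  - by rewrite i2 Im_csol1 !mxE.
exists c; last by move=> x /=; rewrite in_itv/= => /E[].
rewrite -charmx_csol.
have [<- <-] := E a ltac:(by rewrite lexx ltW).
by have [<- <-] := E b ltac:(by rewrite lexx ltW).
Qed.

Lemma csol_inj c : (forall x, `[a, b]%classic x -> csol c x = 0) -> c = 0.
Proof.
move=> H.
have [sr si] := sl_sol_csol c.
have [r1 r2] : Re (csol c a) = 0 /\ Re (csol1 c a) = 0.
  by apply: (sl_sol_eq0 ab Som sr) => x xab; rewrite H//= in_itv.
have [i1 i2] : Im (csol c a) = 0 /\ Im (csol1 c a) = 0.
  by apply: (sl_sol_eq0 ab Som si) => x xab; rewrite H//= in_itv.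
rewrite -[c]csol_a; apply/matrixP => i j; rewrite !mxE; case: ifP => _; exact: eq_ReIm.
Qed.

Lemma csol_sum m (d : 'I_m -> C) (c : 'I_m -> 'cV[C]_2) x :
  \sum_(i < m) d i * csol (c i) x = csol (\sum_(i < m) d i *: c i) x.
Proof.
rewrite /csol !summxE !mulr_sumr -big_split; apply: eq_bigr => i _.
by rewrite !mxE/=; ring.
Qed.

(** Taking initial data carries a basis of the eigenspace to a basis of the kernel of [charmx]. The
    data are the rows of [M]: freeness of the basis makes [M] row free, and spanning makes its row
    space the whole kernel. *)
Lemma eigenspace_dim_rank m : eigenspace_dim a b A B om l%:C m ->
  (m + \rank (charmx om l) = 2)%N.
Proof.
move=> [e [He Hfree Hspan]].
have /choice[c Hc] : forall i, exists c, charmx om l *m c = 0 /\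
    forall x, `[a, b]%classic x -> e i x = csol c x.
  by move=> i; have [c h1 h2] := eigenspace_csol (He i); exists c.
pose M : 'M[C]_(m, 2) := \matrix_(i < m) (c i)^T.
have Mrow (v : 'rV[C]_m) : v *m M = (\sum_(i < m) v 0 i *: c i)^T.
  by rewrite mulmx_sum_row linear_sum; apply: eq_bigr => i _; rewrite rowK linearZ.
have MF : row_free M.
  rewrite -kermx_eq0; apply: contrapT => /negP.
  case/rowV0Pn => v /sub_kermxP vM /eqP; apply.
  apply/rowP => i; rewrite mxE; apply: (Hfree (fun i => v 0 i)) => x xab.
  under eq_bigr => j _ do rewrite (Hc j).2//.
  rewrite csol_sum; have /(congr1 trmx) := Mrow v; rewrite trmxK vM trmx0 => <-.
  by rewrite /csol !mxE !mulr0 addr0.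
have MK : (M == kermx (charmx om l)^T)%MS.
  apply/andP; split.
    apply/sub_kermxP; apply/row_matrixP => i; rewrite row_mul rowK row0.
    by rewrite -trmx_mul (Hc i).1 trmx0.
  apply/row_subP => i; set v := row i _.
  have vK : charmx om l *m v^T = 0.
    apply: trmx_inj; rewrite trmx_mul trmxK trmx0; apply/sub_kermxP; exact: row_sub.
  have [d Hd] := Hspan _ (csol_eigenspace vK).
  apply/submxP; exists (\row_i d i); rewrite Mrow; apply: trmx_inj; rewrite trmxK.
  apply/eqP; rewrite -subr_eq0; apply/eqP; apply: csol_inj => x xab.
  have -> : csol (v^T - \sum_(i < m) (\row_i d i) 0 i *: c i) x =
     csol v^T x - csol (\sum_(i < m) (\row_i d i) 0 i *: c i) x.
    by rewrite /csol !mxE; ring.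
  rewrite Hd// -csol_sum; apply/eqP; rewrite subr_eq0; apply/eqP; apply: eq_bigr => j _.
  by rewrite mxE (Hc j).2.
have := mxrank_ker (charmx om l)^T; rewrite -(eqmx_rank MK) mxrank_tr.
move: MF; rewrite /row_free => /eqP -> ->.
by rewrite subnK// rank_leq_row.
Qed.

Lemma charmx_eigenvalue : \rank (charmx om l) != 2%N -> is_eigenvalue a b A B om l%:C.
Proof.
move=> r2.
have : kermx (charmx om l)^T != 0 by rewrite kermx_eq0 /row_free mxrank_tr.
case/rowV0Pn => v /sub_kermxP vM v0.
have vK : charmx om l *m v^T = 0.
  by apply: trmx_inj; rewrite trmx_mul trmxK trmx0.
exists (csol v^T); first exact: csol_eigenspace.
apply: contrapT => H; move: v0 => /eqP; apply; apply: trmx_inj; rewrite trmx0.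
apply: csol_inj => x xab; apply/eqP; apply: contrapT => /negP h; apply: H.
by exists x.
Qed.

End Fixed.

(** Covers every real [l]: off the spectrum [charmx] is invertible and both sets are empty. *)
Lemma eigenvalue_count om (lam : nat -> R) l : coef_space a b om ->
  is_eigenvalue_sequence a b A B om lam ->
  ([set k | lam k = l] #= `I_(2 - \rank (charmx om l)))%card.
Proof.
move=> Som [_ _ ev mult].
have [[n ln]|nl] := pselect (exists n, lam n = l).
  have [m dimm] := mult n; rewrite ln in dimm *.
  move=> cm; have /(congr1 (subn^~ (\rank (charmx om l)))) := eigenspace_dim_rank Som dimm.
  by rewrite addnK => <-.
have -> : [set k | lam k = l] = set0.
  by apply/seteqP; split => // k /= kl; apply: nl; exists k.
suff -> : \rank (charmx om l) = 2%N by rewrite subnn II0 card_eqxx.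
apply/eqP; apply: contrapT => /negP /(charmx_eigenvalue Som) /ev[n [ln]].
by apply: nl; exists n.
Qed.

End Eigenspace.

(** * Dependence on the parameters *)

Section ParameterDependence.
Context {R : realType}.
Implicit Types (om : coefficients R) (l : R).
Variables (a b : R).
Hypothesis ab : a < b.
Local Notation dist := (coef_dist a b).
Local Notation S := (coef_space a b).

Definition coef_diff om om0 t : R := `|cf_P om t - cf_P om0 t| + `|coef_q om t - coef_q om0 t|
  + `|coef_r om t - coef_r om0 t| + `|coef_s om t - coef_s om0 t|.

Lemma coef_diff_integrable om om0 : S om -> S om0 -> oc_integrable a b (coef_diff om om0).
Proof.
move=> So S0; apply: oc_integrableD; [apply: oc_integrableD; [apply: oc_integrableD|]|];
  apply: oc_integrable_norm;
  apply: oc_integrableB; (exact: cf_P_integrable || exact: coef_q_integrable ||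
  exact: coef_r_integrable || exact: coef_s_integrable).
Qed.

Lemma coef_distE om om0 : S om -> S om0 -> dist om om0 = oc_int a b (coef_diff om om0).
Proof.
move=> So S0; rewrite oc_int_oo//.
by apply: integrableS (coef_diff_integrable So S0) => //; apply: subset_itv; rewrite bnd_simp.
Qed.

Lemma coef_dist_ge0 om om0 : 0 <= dist om om0.
Proof. by apply: Rintegral_ge0 => x _; rewrite !addr_ge0. Qed.

Lemma coef_dist_le om om0 (f : R -> R) x y : S om -> S om0 -> a <= x -> x <= y -> y <= b ->
  oc_integrable a b f -> (forall t, `|f t| <= coef_diff om om0 t) ->
  oc_int x y (fun t => `|f t|) <= dist om om0.
Proof.
move=> So S0 ax xy yb fi fd; rewrite coef_distE//.
have Di := coef_diff_integrable So S0.
apply: le_trans (oc_int_le_sub ax xy yb (oc_integrable_norm fi) _) _ => //.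
by apply: le_oc_int => //; exact: oc_integrable_norm.
Qed.

Lemma cf_P_diff om om0 t : `|cf_P om t - cf_P om0 t| <= coef_diff om om0 t.
Proof. by rewrite /coef_diff -!addrA lerDl !addr_ge0. Qed.

Lemma coef_q_diff om om0 t : `|coef_q om t - coef_q om0 t| <= coef_diff om om0 t.
Proof.
rewrite /coef_diff -[_ + _ + _ + _]addrA -[_ + _ + _]addrA addrCA lerDl.
by rewrite !addr_ge0.
Qed.

Lemma coef_r_diff om om0 t : `|coef_r om t - coef_r om0 t| <= coef_diff om om0 t.
Proof. by rewrite /coef_diff addrAC lerDr !addr_ge0. Qed.

Lemma coef_s_diff om om0 t : `|coef_s om t - coef_s om0 t| <= coef_diff om om0 t.
Proof. by rewrite /coef_diff lerDr !addr_ge0. Qed.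

Lemma sl_weight_coef_dist om om0 l l0 : S om -> S om0 ->
  oc_int a b (sl_weight (fun t => cf_P om t - cf_P om0 t)
    (fun t => coef_s om t - coef_s om0 t) (fun t => cf_Q om l t - cf_Q om0 l0 t)) <=
  (1 + `|l|) * dist om om0 + `|l - l0| * oc_int a b (fun t => `|coef_r om0 t|).
Proof.
move=> So S0; rewrite coef_distE//.
have Di := coef_diff_integrable So S0; have ri := oc_integrable_norm (coef_r_integrable S0).
rewrite -!oc_intZ// -oc_intD; [|exact: oc_integrableZ|exact: oc_integrableZ].
apply: le_oc_int.
- apply: sl_weight_integrable; apply: oc_integrableB;
  (exact: cf_P_integrable || exact: cf_Q_integrable || exact: coef_s_integrable).
- by apply: oc_integrableD; apply: oc_integrableZ.
move=> t _; rewrite /sl_weight /coef_diff /cf_Q.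
have -> : coef_q om t - l * coef_r om t - (coef_q om0 t - l0 * coef_r om0 t) =
  (coef_q om t - coef_q om0 t) - l * (coef_r om t - coef_r om0 t) - (l - l0) * coef_r om0 t by ring.
set dq := coef_q om t - _; set dr := coef_r om t - _; set dp := cf_P om t - _.
set ds := coef_s om t - _.
have H : `|dq - l * dr - (l - l0) * coef_r om0 t| <=
  `|dq| + `|l| * `|dr| + `|l - l0| * `|coef_r om0 t|.
  apply: le_trans (ler_normB _ _) _; rewrite normrM lerD2r.
  by apply: le_trans (ler_normB _ _) _; rewrite normrM.
apply: le_trans (lerD (lexx _) H) _.
have : 0 <= `|dr| + `|l| * (`|dp| + `|dq| + `|ds|) by rewrite addr_ge0// mulr_ge0// !addr_ge0.
lra.
Qed.

Lemma sl_base_norm_a om l j : S om ->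
  `|(sl_base ab om l j).1 a| + `|(sl_base ab om l j).2 a| = 1.
Proof.
move=> So; have [h1 h2 h3 h4] := sl_base_a ab l So.
elim/ord2P: j; first by rewrite h1 h2 normr1 normr0 addr0.
by rewrite h3 h4 normr1 normr0 add0r.
Qed.

Lemma sl_base_sol om l j : S om ->
  sl_sol a b om l (sl_base ab om l j).1 (sl_base ab om l j).2.
Proof. by move=> So; have [] := sl_funP ab l ((j == 0)%:R, (j == 1)%:R) So. Qed.

Lemma sl_base_bound om l : S om -> exists2 B : R, 0 <= B & forall j x, a <= x <= b ->
  `|(sl_base ab om l j).1 x| <= B /\ `|(sl_base ab om l j).2 x| <= B.
Proof.
move=> So; have [N kN] := oc_int_sl_weight_nat a b (cf_P om) (coef_s om) (cf_Q om l).
exists (2 ^+ N); first by rewrite exprn_ge0.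
move=> j x xab; have := sl_solution_bound (cf_P_integrable So) (coef_s_integrable So)
  (cf_Q_integrable So l) (sl_base_sol l j So) kN xab.
rewrite sl_base_norm_a// mulr1 => H.
by split; apply: le_trans H; rewrite ?lerDl ?lerDr.
Qed.

Lemma sl_base_lipschitz om0 l0 : S om0 -> exists2 K : R, 0 <= K & forall om l, S om ->
  dist om om0 <= 1 -> `|l - l0| <= 1 -> forall j x, a <= x <= b ->
  `|(sl_base ab om l j).1 x - (sl_base ab om0 l0 j).1 x| +
  `|(sl_base ab om l j).2 x - (sl_base ab om0 l0 j).2 x| <= K * (`|l - l0| + dist om om0).
Proof.
move=> S0; have [B B0 HB] := sl_base_bound l0 S0.
set r0 := oc_int a b (fun t => `|coef_r om0 t|).
have r00 : 0 <= r0 by apply: oc_int_ge0.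
(* Since |l - l0| <= 1, the factor 1 + |l| of [dist] is at most 2 + |l0|; the factor of |l - l0| is
   [r0]. *)
pose D := 2 + `|l0| + r0.
have D0 : 0 <= D by rewrite !addr_ge0.
have HD om l : S om -> `|l - l0| <= 1 ->
   oc_int a b (sl_weight (fun t => cf_P om t - cf_P om0 t)
    (fun t => coef_s om t - coef_s om0 t) (fun t => cf_Q om l t - cf_Q om0 l0 t)) <=
  D * (`|l - l0| + dist om om0).
  move=> So ll0; apply: le_trans (sl_weight_coef_dist l l0 So S0) _.
  have ll : `|l| <= 1 + `|l0|.
    by rewrite -(subrK l0 l); apply: le_trans (ler_normD _ _) _; rewrite lerD2r.
  rewrite -/r0 mulrDr addrC; apply: lerD.
    by rewrite mulrC ler_wpM2r// /D lerDr addr_ge0.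
  by rewrite ler_wpM2r ?coef_dist_ge0// /D; lra.
have W0i := sl_weight_integrable (cf_P_integrable S0) (coef_s_integrable S0) (cf_Q_integrable S0 l0).
set W0 := oc_int a b (sl_weight (cf_P om0) (coef_s om0) (cf_Q om0 l0)).
have W00 : 0 <= W0 by apply: oc_int_ge0 => t _; exact: sl_weight_ge0.
(* One [N] for all nearby systems: the integral of their weight exceeds [W0] by at most [D * 2], as
   |l - l0| + dist <= 2. *)
have [N HN] : exists N : nat, W0 + D * 2 <= N%:R / 2.
  exists (Num.bound (2 * (W0 + D * 2))); rewrite ler_pdivlMr// mulrC ltW//.
  apply: le_lt_trans (lexx _) (archi_boundP _).
  by rewrite mulr_ge0// addr_ge0// mulr_ge0.
exists (2 ^+ N * (2 * B * D)); first by rewrite !mulr_ge0// exprn_ge0.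
move=> om l So d1 l1 j x xab.
have kN : oc_int a b (sl_weight (cf_P om) (coef_s om) (cf_Q om l)) <= N%:R / 2.
  apply: le_trans HN.
  apply: (@le_trans _ _ (W0 + oc_int a b (sl_weight (fun t => cf_P om t - cf_P om0 t)
    (fun t => coef_s om t - coef_s om0 t) (fun t => cf_Q om l t - cf_Q om0 l0 t)))).
    have Wdi : oc_integrable a b (sl_weight (fun t => cf_P om t - cf_P om0 t)
     (fun t => coef_s om t - coef_s om0 t) (fun t => cf_Q om l t - cf_Q om0 l0 t)).
      apply: sl_weight_integrable; apply: oc_integrableB;
      (exact: cf_P_integrable || exact: cf_Q_integrable || exact: coef_s_integrable).
    rewrite /W0 -oc_intD//; apply: le_oc_int.
    - by apply: sl_weight_integrable; [exact: cf_P_integrable|exact: coef_s_integrable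
        |exact: cf_Q_integrable].
    - exact: oc_integrableD.
    have T (p q : R) : `|p| <= `|q| + `|p - q|.
      by rewrite -{1}(subrK q p) addrC ler_normD.
    move=> t _; rewrite /sl_weight.
    have := T (cf_P om t) (cf_P om0 t); have := T (coef_s om t) (coef_s om0 t).
    have := T (cf_Q om l t) (cf_Q om0 l0 t); lra.
  rewrite lerD2l; apply: le_trans (HD om l So l1) _; apply: ler_wpM2l => //.
  by have := lerD l1 d1; rewrite -natr1.
have := sl_stability (cf_P_integrable So) (coef_s_integrable So) (cf_Q_integrable So l)
  (cf_P_integrable S0) (coef_s_integrable S0) (cf_Q_integrable S0 l0)
  (sl_base_sol l j So) (sl_base_sol l0 j S0)
  (fun x h => (HB j x h).1) (fun x h => (HB j x h).2) kN xab.
have [h1 h2 h3 h4] := sl_base_a ab l So; have [h1' h2' h3' h4'] := sl_base_a ab l0 S0.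
have -> : `|(sl_base ab om l j).1 a - (sl_base ab om0 l0 j).1 a| +
  `|(sl_base ab om l j).2 a - (sl_base ab om0 l0 j).2 a| = 0.
  by elim/ord2P: j; rewrite ?h1 ?h2 ?h3 ?h4 ?h1' ?h2' ?h3' ?h4' !subrr normr0 addr0.
rewrite add0r => /le_trans; apply.
rewrite -!mulrA; do 3 (apply: ler_wpM2l; rewrite ?exprn_ge0//).
exact: HD.
Qed.

(** Inner products in [L^2(r)] of the basis at [l] with the basis at [l']: two parameters, because
    Lagrange's identity pairs solutions for different spectral values. *)
Definition gram om l l' : 'M[R]_2 := \matrix_(i, j)
  oc_int a b (fun t => coef_r om t * ((sl_base ab om l i).1 t * (sl_base ab om l' j).1 t)).

Lemma gramE om l l' i j : gram om l l' i j =
  oc_int a b (fun t => coef_r om t * ((sl_base ab om l i).1 t * (sl_base ab om l' j).1 t)).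
Proof. by rewrite /gram mxE. Qed.

Lemma gram_integrable om om' l l' i j : S om -> S om' ->
  oc_integrable a b (fun t => coef_r om' t *
    ((sl_base ab om l i).1 t * (sl_base ab om l' j).1 t)).
Proof.
move=> So So'; have [pi _] := sl_base_sol l i So; have [pj _] := sl_base_sol l' j So.
apply: (@eq_oc_integrable _ _ _ (fun t => (sl_base ab om l i).1 t *
  ((sl_base ab om l' j).1 t * coef_r om' t))) => [x _|]; first by ring.
exact/(primitive_integrableM pi)/(primitive_integrableM pj)/coef_r_integrable.
Qed.

Lemma gram_lipschitz om0 l0 : S om0 -> exists2 K : R, 0 <= K & forall om l l', S om ->
  dist om om0 <= 1 -> `|l - l0| <= 1 -> `|l' - l0| <= 1 -> forall i j,
  `|gram om l l' i j - gram om0 l0 l0 i j| <= K * (`|l - l0| + `|l' - l0| + dist om om0).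
Proof.
move=> S0; have [B B0 HB] := sl_base_bound l0 S0; have [K K0 HK] := sl_base_lipschitz l0 S0.
set r0 := oc_int a b (fun t => `|coef_r om0 t|).
have r00 : 0 <= r0 by apply: oc_int_ge0.
(* [B'] bounds the basis solutions of all nearby systems. In the constant below, the first summand
   pays for the change of [r], the second for the changes of the two factors, integrated against
   |r0|. *)
pose B' := B + 2 * K; have B'0 : 0 <= B' by rewrite addr_ge0// mulr_ge0.
exists (B' * B' + 2 * B' * K * r0).
  by rewrite addr_ge0 ?mulr_ge0.
move=> om l l' So d1 l1 l1' i j; rewrite !gramE.
have <- := oc_intB (gram_integrable l l' i j So So) (gram_integrable l0 l0 i j S0 S0).
set rho := _ + _ + dist om om0.
have d0 := coef_dist_ge0 om om0.
have int1 := oc_integrableB (gram_integrable l l' i j So So) (gram_integrable l0 l0 i j S0 S0).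
apply: le_trans (oc_int_norm int1) _.
have ri := oc_integrable_norm (coef_r_integrable S0).
have Di := coef_diff_integrable So S0.
apply: (@le_trans _ _ (oc_int a b (fun t => B' * B' * coef_diff om om0 t +
  (2 * B' * K * rho) * `|coef_r om0 t|))).
  apply: le_oc_int; first exact: oc_integrable_norm.
    by apply: oc_integrableD; exact: oc_integrableZ.
  move=> t /andP[/ltW ta tb]; have tab : a <= t <= b by rewrite ta.
  set y := (sl_base ab om l i).1 t; set y' := (sl_base ab om l' j).1 t.
  set y0 := (sl_base ab om0 l0 i).1 t; set y0' := (sl_base ab om0 l0 j).1 t.
  have yd : `|y - y0| <= K * (`|l - l0| + dist om om0).
    by apply: le_trans (HK om l So d1 l1 i t tab); rewrite lerDl.
  have yd' : `|y' - y0'| <= K * (`|l' - l0| + dist om om0).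
    by apply: le_trans (HK om l' So d1 l1' j t tab); rewrite lerDl.
  have K1 : K * (`|l - l0| + dist om om0) <= 2 * K by rewrite mulrC ler_wpM2r//; lra.
  have K2 : K * (`|l' - l0| + dist om om0) <= 2 * K by rewrite mulrC ler_wpM2r//; lra.
  have Kr1 : K * (`|l - l0| + dist om om0) <= K * rho.
    by rewrite ler_wpM2l// /rho; have := normr_ge0 (l' - l0); lra.
  have Kr2 : K * (`|l' - l0| + dist om om0) <= K * rho.
    by rewrite ler_wpM2l// /rho; have := normr_ge0 (l - l0); lra.
  have T (p q : R) : `|p| <= `|q| + `|p - q|.
    by rewrite -{1}(subrK q p) addrC ler_normD.
  have y0B : `|y0| <= B' by have := (HB i t tab).1; rewrite -/y0 /B'; lra.
  have yB : `|y| <= B' by have := (HB i t tab).1; have := T y y0; rewrite -/y0 /B'; lra.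
  have yB' : `|y'| <= B' by have := (HB j t tab).1; have := T y' y0'; rewrite -/y0' /B'; lra.
  have -> : coef_r om t * (y * y') - coef_r om0 t * (y0 * y0') =
    (coef_r om t - coef_r om0 t) * (y * y') +
    coef_r om0 t * ((y - y0) * y' + y0 * (y' - y0')) by ring.
  apply: le_trans (ler_normD _ _) _; apply: lerD.
    rewrite normrM mulrC; apply: ler_pM => //; last exact: coef_r_diff.
    by rewrite normrM; apply: ler_pM.
  rewrite normrM mulrC; apply: ler_wpM2r => //.
  apply: le_trans (ler_normD _ _) _; rewrite !normrM.
  have -> : 2 * B' * K * rho = (K * rho) * B' + B' * (K * rho) by ring.
  by apply: lerD; apply: ler_pM => //; [exact: le_trans Kr1|exact: le_trans Kr2].
rewrite oc_intD; [|exact: oc_integrableZ|exact: oc_integrableZ].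
rewrite !oc_intZ// -coef_distE// -/r0 [leRHS]mulrDl; apply: lerD.
  by rewrite ler_wpM2l// ?mulr_ge0// /rho lerDr addr_ge0.
by rewrite -!mulrA [r0 * _]mulrC.
Qed.

End ParameterDependence.

(** * Lagrangian charts *)

Section Frame.
Context {C : numClosedFieldType}.

Lemma trC_mul m n p (M : 'M[C]_(m, n)) (N : 'M[C]_(n, p)) :
  (M *m N) ^t* = N ^t* *m M ^t*.
Proof. by rewrite trmx_mul map_mxM. Qed.

Lemma trCD m n (M N : 'M[C]_(m, n)) : (M + N) ^t* = M ^t* + N ^t*.
Proof. by rewrite linearD map_mxD. Qed.

Lemma trCN m n (M : 'M[C]_(m, n)) : (- M) ^t* = - M ^t*.
Proof. by rewrite linearN map_mxN. Qed.

Lemma trCB m n (M N : 'M[C]_(m, n)) : (M - N) ^t* = M ^t* - N ^t*.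
Proof. by rewrite trCD trCN. Qed.

Lemma trC1 n : (1%:M : 'M[C]_n) ^t* = 1%:M.
Proof. by rewrite trmx1 map_mx1. Qed.

Lemma trCZ m n k (M : 'M[C]_(m, n)) : (k *: M) ^t* = Num.conj k *: M ^t*.
Proof. by rewrite linearZ map_mxZ. Qed.

Lemma rV_normsq_eq0 m (u : 'rV[C]_m) : u *m u ^t* = 0 -> u = 0.
Proof.
move=> /matrixP /(_ 0 0); rewrite !mxE => H.
have /psumr_eq0P H0 : \sum_i u 0 i * (u ^t*) i 0 = 0 by [].
apply/rowP => i; rewrite mxE; apply/eqP; rewrite -mul_conjC_eq0; apply/eqP.
by have := H0 _ i isT; rewrite !mxE; apply => j _; rewrite !mxE mul_conjC_ge0.
Qed.

Lemma row_free_gram_unit m n (M : 'M[C]_(m, n)) : row_free M -> M *m M ^t* \in unitmx.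
Proof.
move=> Mf; rewrite -row_free_unit -kermx_eq0; apply: contraT => /rowV0Pn[v].
move=> /sub_kermxP vM /eqP; case.
have : (v *m M) *m (v *m M) ^t* = 0.
  by rewrite trC_mul mulmxA -(mulmxA v) vM mul0mx.
move=> /rV_normsq_eq0 vM0; apply: (row_free_inj Mf); first by rewrite vM0 mul0mx.
Qed.

Variables (n : nat) (E A B : 'M[C]_n).
Hypotheses (EN : E ^t* = - E) (E2 : E *m E = - 1%:M).
Hypothesis rAB : \rank (row_mx A B) = n.
Hypothesis sAB : A *m E *m A ^t* = B *m E *m B ^t*.

(** Put [M = (A | B)], [J = diag(E, -E)] and [G] the graph map [(1, Phi)]. Then [bc_weight] inverts
    the Gram matrix of the rows of [M]; [bc_Y] is [M G], which kills exactly the data whose graph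
    vector lies in the boundary plane; [bc_X] is [M J G], the complementary coordinate. *)
Definition bc_weight : 'M[C]_n := invmx (A *m A ^t* + B *m B ^t*).
Definition bc_Y (Phi : 'M[C]_n) := A + B *m Phi.
Definition bc_X (Phi : 'M[C]_n) := A *m E - B *m E *m Phi.

Local Notation W := bc_weight.

Let M := row_mx A B.
Let J := block_mx E 0 0 (- E).
Let G (Phi : 'M[C]_n) := col_mx 1%:M Phi.

Let trM : M ^t* = col_mx (A ^t*) (B ^t*).
Proof. by rewrite /M tr_row_mx map_col_mx. Qed.

Lemma bc_weight_unit : A *m A ^t* + B *m B ^t* \in unitmx.
Proof.
have /row_free_gram_unit : row_free M by rewrite /row_free rAB.
by rewrite trM mul_row_col.
Qed.

Lemma bc_weight_herm : W ^t* = W.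
Proof.
rewrite /bc_weight trmx_inv map_invmx; congr invmx.
by rewrite trCD !trC_mul !trmxCK.
Qed.

Let MJ : M *m J = row_mx (A *m E) (- (B *m E)).
Proof. by rewrite mul_row_block !mulmx0 addr0 add0r mulmxN. Qed.

Let trJ : J ^t* = - J.
Proof.
rewrite /J tr_block_mx map_block_mx !trmx0 !map_mx0 opp_block_mx !oppr0 opprK.
by rewrite EN linearN/= map_mxN EN opprK.
Qed.

Let JJ : J *m J = - 1%:M.
Proof.
rewrite mulmx_block !mulmx0 !mul0mx !addr0 !add0r mulNmx mulmxN opprK E2.
by rewrite [in RHS]scalar_mx_block opp_block_mx !oppr0.
Qed.

Let MM : M *m M ^t* = A *m A ^t* + B *m B ^t*.
Proof. by rewrite trM mul_row_col. Qed.

Let MJM : M *m J *m M ^t* = 0.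
Proof. by rewrite MJ trM mul_row_col sAB mulNmx subrr. Qed.

(* The rows of [M] and of [M J] form an orthogonal frame of the boundary data. *)
Let frame : M ^t* *m W *m M - J *m M ^t* *m W *m M *m J = 1%:M.
Proof.
pose N := col_mx M (M *m J).
pose N' := row_mx (M ^t* *m W) (- (J *m M ^t* *m W)).
(* Self-adjointness enters as [M J M^H = 0], which kills the off-diagonal blocks; a one-sided
   inverse of a square matrix is then two-sided. *)
have NN' : N *m N' = 1%:M.
  rewrite mul_col_row !mulmxN !mulmxA MJM mul0mx oppr0 MM mulmxV ?bc_weight_unit//.
  rewrite -(mulmxA M J J) JJ mulmxN mulmx1 !mulNmx opprK MM mulmxV ?bc_weight_unit//.
  by rewrite -scalar_mx_block.
have := mulmx1C NN'; rewrite mul_row_col => <-.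
by rewrite !mulNmx !mulmxA.
Qed.

Let GY Phi : M *m G Phi = bc_Y Phi.
Proof. by rewrite mul_row_col mulmx1. Qed.

Let GX Phi : M *m J *m G Phi = bc_X Phi.
Proof. by rewrite MJ mul_row_col mulmx1 mulNmx. Qed.

Let GYt Phi : (G Phi) ^t* *m M ^t* = (bc_Y Phi) ^t*.
Proof. by rewrite -trC_mul GY. Qed.

Let GXt Phi : (G Phi) ^t* *m J *m M ^t* = - (bc_X Phi) ^t*.
Proof.
by rewrite -GX !trC_mul trJ mulNmx mulmxN mulmxA opprK.
Qed.

Let trG Phi : (G Phi) ^t* = row_mx 1%:M (Phi ^t*).
Proof. by rewrite /G tr_col_mx map_row_mx trC1. Qed.

(** Parseval's identity: [frame] placed between two graph maps. *)
Lemma bc_gram Phi Phi' :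
  (bc_Y Phi) ^t* *m W *m bc_Y Phi' + (bc_X Phi) ^t* *m W *m bc_X Phi' =
  1%:M + Phi ^t* *m Phi'.
Proof.
have : (G Phi) ^t* *m (M ^t* *m W *m M - J *m M ^t* *m W *m M *m J) *m G Phi' =
    1%:M + Phi ^t* *m Phi'.
  by rewrite frame mulmx1 trG mul_row_col mulmx1.
rewrite mulmxBr mulmxBl !mulmxA GYt GXt !mulNmx opprK.
by rewrite -!mulmxA GY (mulmxA M) GX.
Qed.

(** On the boundary plane [M] vanishes, so only the second half of [frame] remains: the plane is the
    range of [J M^H], as befits a Lagrangian plane. *)
Lemma bc_kernel (u v : 'cV[C]_n) : A *m u + B *m v = 0 ->
  exists c : 'cV[C]_n, u = E *m A ^t* *m c /\ v = - (E *m B ^t* *m c).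
Proof.
move=> uv0; have Mw : M *m col_mx u v = 0 by rewrite mul_row_col.
exists (- (W *m M *m J *m col_mx u v)).
have : col_mx u v = J *m M ^t* *m (- (W *m M *m J *m col_mx u v)).
  rewrite -{1}[col_mx u v]mul1mx -frame mulmxBl -!mulmxA Mw !mulmx0 sub0r.
  by rewrite !mulmxN !mulmxA.
set c := - _; rewrite trM mul_block_col !mul0mx addr0 add0r mulNmx mul_col_mx mulNmx.
by move=> /eq_col_mx[].
Qed.

(** [J] times [frame], placed between two graph maps: [bc_Y] and [bc_X] are canonical coordinates
    for the symplectic form, up to the weight. *)
Lemma bc_wronskian Phi Phi' :
  (bc_Y Phi) ^t* *m W *m bc_X Phi' - (bc_X Phi) ^t* *m W *m bc_Y Phi' =
  E - Phi ^t* *m E *m Phi'.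
Proof.
have : (G Phi) ^t* *m (J *m (M ^t* *m W *m M - J *m M ^t* *m W *m M *m J)) *m G Phi' =
    E - Phi ^t* *m E *m Phi'.
  rewrite frame mulmx1 trG /J mul_row_block !mulmx0 addr0 add0r mul1mx mul_row_col.
  by rewrite mulmx1 mulmxN mulNmx.
rewrite mulmxBr -!(mulmxA J) (mulmxA J J) JJ mulNmx mul1mx opprK.
rewrite mulmxDr mulmxDl !mulmxA GXt GYt addrC.
by rewrite !mulNmx -!mulmxA GY (mulmxA M) GX.
Qed.

End Frame.

(** The determinant is a polynomial [p] in the scalar. Being non-zero at [i], it is not the zero
    polynomial, so it cannot vanish at [size p] distinct naturals. *)
Lemma exists_nat_det_unit (F : numFieldType) n (X Y : 'M[F]_n) (i : F) :
  \det (X - i *: Y) != 0 -> exists k : nat, X - k%:R *: Y \in unitmx.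
Proof.
move=> Hi; pose p := \det (map_mx polyC X - 'X *: map_mx polyC Y).
have pE t : p.[t] = \det (X - t *: Y).
  rewrite /p -horner_evalE -det_map_mx; congr (\det _); apply/matrixP => r c.
  by rewrite !mxE -[LHS]/(((X r c)%:P - 'X * (Y r c)%:P).[t]) !hornerE.
have p0 : p != 0 by apply: contraNneq Hi => p0; rewrite -pE p0 horner0.
apply: contrapT => H.
have Hr k : root p (k%:R : F).
  apply/rootP; rewrite pE; apply/eqP; apply: contrapT => /negP h; apply: H.
  by exists k; rewrite unitmxE unitfE.
have := @max_poly_roots F p [seq (k%:R : F) | k <- iota 0 (size p)] p0.
rewrite size_map size_iota ltnn => Hp; suff : false by []; apply: Hp.
  by apply/allP => _ /mapP[k _ ->].
by rewrite map_inj_uniq ?iota_uniq// => r c /eqP; rewrite eqr_nat => /eqP.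
Qed.

Section Chart.
Context {C : numClosedFieldType}.
Variables (n : nat) (E A B : 'M[C]_n).
Hypotheses (EN : E ^t* = - E) (E2 : E *m E = - 1%:M).
Hypothesis rAB : \rank (row_mx A B) = n.
Hypothesis sAB : A *m E *m A ^t* = B *m E *m B ^t*.
Variable t : C.
Hypothesis tr : Num.conj t = t.

Local Notation W := (bc_weight A B).
Local Notation Y := (bc_Y A B).

(** Subtracting [t] times [bc_Y] tilts the fibre. For real [t] the Wronskian identity is preserved,
    so the quotient [chart] stays hermitian. *)
Definition chart_den (Phi : 'M[C]_n) := bc_X E A B Phi - t *: Y Phi.
Definition chart (Phi : 'M[C]_n) := W *m Y Phi *m invmx (chart_den Phi).

Local Notation X := chart_den.

Lemma chart_den_wronskian Phi Phi' :
  (Y Phi) ^t* *m W *m X Phi' - (X Phi) ^t* *m W *m Y Phi' = E - Phi ^t* *m E *m Phi'.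
Proof.
rewrite -(bc_wronskian EN E2 rAB sAB) /chart_den trCB trCZ tr.
by rewrite mulmxBr !mulmxBl -!scalemxAr -!scalemxAl opprB addrA subrK.
Qed.

Lemma chart_herm Phi : Phi ^t* *m E *m Phi = E -> X Phi \in unitmx ->
  (chart Phi) ^t* = chart Phi.
Proof.
move=> sPhi Xu; have XuC : (X Phi) ^t* \in unitmx by rewrite map_unitmx unitmx_tr.
have := chart_den_wronskian Phi Phi; rewrite sPhi subrr => /eqP; rewrite subr_eq0 => /eqP H.
rewrite /chart !trC_mul bc_weight_herm//; apply: (can_inj (mulKmx XuC)).
rewrite !mulmxA -trC_mul mulVmx// trC1 mul1mx.
apply: (can_inj (mulmxK Xu)); rewrite H.
by rewrite mulmxKV.
Qed.

(** Hermitian symmetry lets the first chart be written with its denominator on the left; between the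
    two denominators the numerator is the Wronskian. *)
Lemma chart_diff Phi Phi' : Phi ^t* *m E *m Phi = E -> X Phi \in unitmx ->
  X Phi' \in unitmx -> chart Phi - chart Phi' =
  (invmx (X Phi)) ^t* *m (E - Phi ^t* *m E *m Phi') *m invmx (X Phi').
Proof.
move=> sPhi Xu Xu'; rewrite -{1}(chart_herm sPhi Xu) -chart_den_wronskian.
have XuC : (X Phi) ^t* \in unitmx by rewrite map_unitmx unitmx_tr.
rewrite /chart !trC_mul bc_weight_herm// mulmxBr mulmxBl !mulmxA mulmxK//.
by rewrite -(trC_mul (X Phi)) mulmxV// trC1 mul1mx.
Qed.

Lemma rank_chart Phi : X Phi \in unitmx -> \rank (chart Phi) = \rank (Y Phi).
Proof.
move=> Xu; rewrite mxrankMfree ?row_free_unit ?unitmx_inv//.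
have Wu : W \in unitmx by rewrite unitmx_inv bc_weight_unit.
apply/eqP; rewrite eqn_leq mxrankM_maxr /=.
by rewrite -{1}[Y Phi](mulKmx Wu) mxrankM_maxr.
Qed.

End Chart.

(** At the non-real tilt [i] the cross terms cancel because [Phi] is symplectic, and the denominator
    [Z] satisfies [Z^H W Z = 1 + Phi^H Phi], which is invertible. The polynomial argument then moves
    the tilt to a natural number, which is real. *)
Lemma chart_den_exists (C : numClosedFieldType) n (E A B Phi : 'M[C]_n) :
  E ^t* = - E -> E *m E = - 1%:M -> \rank (row_mx A B) = n ->
  A *m E *m A ^t* = B *m E *m B ^t* -> Phi ^t* *m E *m Phi = E ->
  exists k : nat, chart_den E A B k%:R Phi \in unitmx.
Proof.
move=> EN E2 rAB sAB sPhi; apply: (@exists_nat_det_unit _ _ _ _ 'i).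
set X := bc_X E A B Phi; set Y := bc_Y A B Phi; set W := bc_weight A B.
have H : (X - 'i *: Y) ^t* *m W *m (X - 'i *: Y) = 1%:M + Phi ^t* *m Phi.
  rewrite -(bc_gram EN E2 rAB sAB) -/X -/Y -/W trCB trCZ conjCi.
  have := bc_wronskian EN E2 rAB sAB Phi Phi; rewrite sPhi subrr => /eqP.
  rewrite subr_eq0 -/X -/Y -/W => /eqP K.
  rewrite mulmxBr !mulmxBl -!scalemxAr -!scalemxAl K scaleNr opprK.
  rewrite scalerA mulrN -expr2 sqrCi opprK scale1r.
  by rewrite opprB addrA addrAC addrK addrC.
have U : 1%:M + Phi ^t* *m Phi \in unitmx.
  have rf : row_free (row_mx (1%:M : 'M[C]_n) (Phi ^t*)).
    rewrite /row_free eqn_leq rank_leq_row /=.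
    have := mxrankM_maxl (row_mx 1%:M (Phi ^t*)) (col_mx 1%:M (0 : 'M[C]_n)).
    by rewrite mul_row_col mulmx1 mulmx0 addr0 mxrank1.
  have := row_free_gram_unit rf.
  by rewrite tr_row_mx map_col_mx mul_row_col trmxCK trC1 mulmx1.
move: U; rewrite -H unitmxE !det_mulmx unitfE !mulf_eq0 !negb_or.
by case/andP.
Qed.

(** * Hermitian 2x2 matrices *)

Lemma det_mx2 (K : comNzRingType) (M : 'M[K]_2) : \det M = M 0 0 * M 1 1 - M 0 1 * M 1 0.
Proof.
rewrite (expand_det_row _ 0) big_ord2 /cofactor !det_mx11 !mxE /=.
rewrite !addn0 addn1 expr0 expr1 mul1r mulN1r mulrN.
have -> : lift 0 0 = 1 :> 'I_2 by apply: val_inj.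
by have -> : lift 1 0 = 0 :> 'I_2 by apply: val_inj.
Qed.

Section Hermitian2.
Context {R : realType}.
Local Notation C := R[i].
Local Notation Re := (@complex.Re _).
Local Notation Im := (@complex.Im _).
Implicit Types (H D : 'M[C]_2).

(** Pauli coordinates: a hermitian matrix is [herm_s] times the identity plus a traceless part of
    Euclidean length [herm_r], so its eigenvalues are [herm_s] minus and plus [herm_r]. *)
Definition herm_s H : R := (Re (H 0 0) + Re (H 1 1)) / 2.
Definition herm_x H : R := (Re (H 0 0) - Re (H 1 1)) / 2.
Definition herm_r H : R :=
  Num.sqrt (herm_x H ^+ 2 + Re (H 0 1) ^+ 2 + Im (H 0 1) ^+ 2).

(* For hermitian [H] these are the two eigenvalues: [herm_eig false H <= herm_eig true H]. *)
Definition herm_eig (s : bool) H : R := if s then herm_s H + herm_r H else herm_s H - herm_r H.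

Lemma herm_r_ge0 H : 0 <= herm_r H. Proof. exact: sqrtr_ge0. Qed.

Lemma sqr_herm_r H : herm_r H ^+ 2 = herm_x H ^+ 2 + Re (H 0 1) ^+ 2 + Im (H 0 1) ^+ 2.
Proof. by rewrite sqr_sqrtr// !addr_ge0// sqr_ge0. Qed.

Lemma norm3_triangle (x y z x' y' z' : R) :
  Num.sqrt ((x + x') ^+ 2 + (y + y') ^+ 2 + (z + z') ^+ 2) <=
  Num.sqrt (x ^+ 2 + y ^+ 2 + z ^+ 2) + Num.sqrt (x' ^+ 2 + y' ^+ 2 + z' ^+ 2).
Proof.
set u := Num.sqrt (x ^+ 2 + _ + _); set v := Num.sqrt (x' ^+ 2 + _ + _).
have sq0 (p q r : R) : 0 <= p ^+ 2 + q ^+ 2 + r ^+ 2 by rewrite !addr_ge0// sqr_ge0.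
have u0 : 0 <= u by exact: sqrtr_ge0.
have v0 : 0 <= v by exact: sqrtr_ge0.
have u2 : u ^+ 2 = x ^+ 2 + y ^+ 2 + z ^+ 2 by rewrite sqr_sqrtr.
have v2 : v ^+ 2 = x' ^+ 2 + y' ^+ 2 + z' ^+ 2 by rewrite sqr_sqrtr.
have CS : x * x' + y * y' + z * z' <= u * v.
  have [h|h] := leP (x * x' + y * y' + z * z') 0; first by rewrite (le_trans h)// mulr_ge0.
  rewrite -(@ler_pXn2r _ 2)// ?nnegrE ?mulr_ge0//; last exact: ltW.
  rewrite exprMn u2 v2 -subr_ge0.
  (* Lagrange's identity for the cross product. *)
  rewrite [leRHS](_ : _ = (x * y' - y * x') ^+ 2 + (x * z' - z * x') ^+ 2 +
    (y * z' - z * y') ^+ 2) ?sq0//; by ring.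
rewrite -[leRHS]ger0_norm ?addr_ge0// -sqrtr_sqr ler_sqrt ?sqr_ge0//.
rewrite [leRHS]sqrrD u2 v2.
rewrite [leRHS](_ : _ = x ^+ 2 + y ^+ 2 + z ^+ 2 + (x' ^+ 2 + y' ^+ 2 + z' ^+ 2) +
  2 * (u * v)); last by ring.
by rewrite -subr_ge0 [leRHS](_ : _ = 2 * (u * v - (x * x' + y * y' + z * z')));
  [rewrite mulr_ge0// subr_ge0|ring].
Qed.

Lemma herm_rD H D : herm_r (H + D) <= herm_r H + herm_r D.
Proof.
rewrite /herm_r; apply: le_trans (norm3_triangle _ _ _ _ _ _).
rewrite le_eqVlt; apply/orP; left; apply/eqP; congr Num.sqrt.
by rewrite /herm_x !mxE !ReD !ImD; congr (_ ^+ 2 + _ + _); field.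
Qed.

Lemma herm_rN H : herm_r (- H) = herm_r H.
Proof.
rewrite /herm_r /herm_x !mxE !ReN !ImN; congr Num.sqrt.
by field.
Qed.

Lemma herm_sD H D : herm_s (H + D) = herm_s H + herm_s D.
Proof. by rewrite /herm_s !mxE !ReD; field. Qed.

(** Weyl monotonicity: for hermitian matrices the hypothesis says that the difference is positive
    definite. [herm_s] is additive, and [herm_r] changes by at most [herm_r (H' - H)]. *)
Lemma herm_eig_lt s H H' : herm_r (H' - H) < herm_s (H' - H) -> herm_eig s H < herm_eig s H'.
Proof.
set D := H' - H => posD.
have H'E : H' = H + D by rewrite addrC subrK.
have h1 := herm_rD H D; rewrite -H'E in h1.
have HE : H = H' + (- D) by rewrite opprB addrC subrK.
have h2 := herm_rD H' (- D); rewrite -HE herm_rN in h2.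
have h3 := herm_sD H D; rewrite -H'E in h3.
by case: s; rewrite /herm_eig; lra.
Qed.

Section Herm.
Variable H : 'M[C]_2.
Hypothesis HH : H ^t* = H.

Let Hij i j : Re (H j i) = Re (H i j) /\ Im (H j i) = - Im (H i j).
Proof.
have /matrixP /(_ i j) := HH; rewrite !mxE => <-.
by rewrite /Num.conj/=; case: (H j i) => u v /=; rewrite opprK.
Qed.

Let im0 i : Im (H i i) = 0.
Proof. by have [_ h] := Hij i i; lra. Qed.

Lemma det_herm : \det H = (herm_eig false H * herm_eig true H)%:C.
Proof.
have -> : herm_eig false H * herm_eig true H = Re (H 0 0) * Re (H 1 1) -
    (Re (H 0 1) ^+ 2 + Im (H 0 1) ^+ 2).
  have -> : herm_eig false H * herm_eig true H = herm_s H ^+ 2 - herm_r H ^+ 2.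
    by rewrite /herm_eig; ring.
  by rewrite sqr_herm_r /herm_s /herm_x; field.
have [h1 h2] := Hij 0 1.
rewrite det_mx2; apply: eq_ReIm.
  by rewrite ReD ReN !ReM h1 h2 !im0/=; ring.
by rewrite ImD ImN !ImM h1 h2 !im0/=; ring.
Qed.

Lemma herm_eq0 : herm_eig false H = 0 -> herm_eig true H = 0 -> H = 0.
Proof.
rewrite /herm_eig => e1 e2.
have s0 : herm_s H = 0 by lra.
have r0 : herm_r H = 0 by lra.
have := sqr_herm_r H; rewrite r0 expr0n/= => /esym/eqP.
rewrite !paddr_eq0 ?addr_ge0 ?sqr_ge0// !sqrf_eq0 => /andP[/andP[/eqP x0 /eqP h1] /eqP h2].
have [h3 h4] := Hij 0 1.
have a0 : Re (H 0 0) = 0 by move: s0 x0; rewrite /herm_s /herm_x; lra.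
have b0 : Re (H 1 1) = 0 by move: s0 x0; rewrite /herm_s /herm_x; lra.
apply/matrixP => i j; rewrite mxE; elim/ord2P: i; elim/ord2P: j;
  by apply: eq_ReIm => //=; rewrite ?im0 ?h3 ?h4 ?h1 ?h2 ?oppr0.
Qed.

(** Rank 2 is detected by the determinant, the product of the eigenvalues, and rank 0 by both
    eigenvalues vanishing; rank 1 is what remains. *)
Lemma rank_herm : (2 - \rank H = (herm_eig false H == 0%R) + (herm_eig true H == 0%R))%N.
Proof.
have det0 : (\rank H == 2%N) = (herm_eig false H * herm_eig true H != 0).
  rewrite -[X in _ == X]/(2%N) -/(row_free H) row_free_unit unitmxE unitfE det_herm.
  by rewrite eq_complex/= eqxx andbT.
have r2 : (\rank H <= 2)%N := rank_leq_row H.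
have r0 : (\rank H == 0%N) = (herm_eig false H == 0) && (herm_eig true H == 0).
  rewrite mxrank_eq0; apply/eqP/andP => [->|[/eqP h1 /eqP h2]]; last exact: herm_eq0.
  have z : herm_r 0 = 0.
    by apply/eqP; rewrite -sqrf_eq0 sqr_herm_r /herm_x !mxE/= subrr mul0r expr0n/= !addr0.
  by rewrite /herm_eig z /herm_s !mxE/= addr0 mul0r addr0 subr0 eqxx.
rewrite mulf_eq0 negb_or in det0.
by move: det0 r0 r2; case: (herm_eig false H == 0); case: (herm_eig true H == 0) => /=;
  case: (\rank H) => [|[|[|k]]].
Qed.

(** Sylvester's criterion in Pauli coordinates: the determinant is [herm_s ^+ 2 - herm_r ^+ 2], and
    the first diagonal entry settles the sign of [herm_s]. *)
Lemma herm_posdef : 0 < Re (H 0 0) -> 0 < Re (\det H) -> herm_r H < herm_s H.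
Proof.
move=> h0; rewrite det_herm/=.
have e : herm_eig false H * herm_eig true H = herm_s H ^+ 2 - herm_r H ^+ 2.
  by rewrite /herm_eig; ring.
rewrite e subr_gt0 => h1.
have d : Re (H 0 0) * Re (H 1 1) = herm_s H ^+ 2 - herm_x H ^+ 2.
  by rewrite /herm_s /herm_x; field.
have s0 : 0 < herm_s H.
  have : 0 < Re (H 0 0) * Re (H 1 1).
    rewrite d subr_gt0; apply: le_lt_trans h1.
    by rewrite sqr_herm_r -addrA lerDl addr_ge0// sqr_ge0.
  by rewrite pmulr_rgt0// /herm_s => h2; rewrite divr_gt0// addr_gt0.
by rewrite -(@ltr_pXn2r _ 2)// nnegrE ?herm_r_ge0// ltW.
Qed.

End Herm.

End Hermitian2.

(** * Componentwise limits of complex matrices *)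

Section ComplexLimits.
Context {R : realType} {T : Type} (F : set_system T) {FF : Filter F}.
Local Notation C := R[i].
Local Notation Re := (@complex.Re _).
Local Notation Im := (@complex.Im _).

(* [R[i]] has no topology in the library: limits are taken componentwise. *)
Definition ccvg (f : T -> C) (c : C) :=
  Re (f t) @[t --> F] --> Re c /\ Im (f t) @[t --> F] --> Im c.

Definition mcvg m n (M : T -> 'M[C]_(m, n)) (M0 : 'M[C]_(m, n)) :=
  forall i j, ccvg (fun t => M t i j) (M0 i j).

Lemma ccvg_cst c : ccvg (fun=> c) c.
Proof. by split; exact: cvg_cst. Qed.

Lemma near_eq_ccvg f g c : (\forall t \near F, f t = g t) -> ccvg f c -> ccvg g c.
Proof.
move=> fg [h1 h2]; split.
  by apply: cvg_trans h1; apply: near_eq_cvg; apply: filterS fg => t ->.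
by apply: cvg_trans h2; apply: near_eq_cvg; apply: filterS fg => t ->.
Qed.

Lemma eq_ccvg f g c : (forall t, f t = g t) -> ccvg f c -> ccvg g c.
Proof. by move=> fg; have -> : f = g by apply/funext. Qed.

Lemma ccvgD f g c d : ccvg f c -> ccvg g d -> ccvg (fun t => f t + g t) (c + d).
Proof.
move=> [f1 f2] [g1 g2]; rewrite /ccvg ReD ImD.
under eq_fun do rewrite ReD; under [X in _ /\ X @ _ --> _]eq_fun do rewrite ImD.
by split; apply: cvgD.
Qed.

Lemma ccvgN f c : ccvg f c -> ccvg (fun t => - f t) (- c).
Proof.
move=> [f1 f2]; rewrite /ccvg ReN ImN.
under eq_fun do rewrite ReN; under [X in _ /\ X @ _ --> _]eq_fun do rewrite ImN.
by split; apply: cvgN.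
Qed.

Lemma ccvgM f g c d : ccvg f c -> ccvg g d -> ccvg (fun t => f t * g t) (c * d).
Proof.
move=> [f1 f2] [g1 g2]; rewrite /ccvg ReM ImM.
under eq_fun do rewrite ReM; under [X in _ /\ X @ _ --> _]eq_fun do rewrite ImM.
split; first by apply: cvgB; apply: cvgM.
by apply: cvgD; apply: cvgM.
Qed.

Lemma ReC (u : C) : Re (Num.conj u) = Re u. Proof. by case: u. Qed.
Lemma ImC (u : C) : Im (Num.conj u) = - Im u. Proof. by case: u. Qed.

Lemma ccvg_conj f c : ccvg f c -> ccvg (fun t => Num.conj (f t)) (Num.conj c).
Proof.
move=> [f1 f2]; rewrite /ccvg ReC ImC.
under eq_fun do rewrite ReC; under [X in _ /\ X @ _ --> _]eq_fun do rewrite ImC.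
by split => //; apply: cvgN.
Qed.

Lemma ReV (u : C) : Re u^-1 = Re u / (Re u ^+ 2 + Im u ^+ 2). Proof. by case: u. Qed.
Lemma ImV (u : C) : Im u^-1 = - (Im u / (Re u ^+ 2 + Im u ^+ 2)). Proof. by case: u. Qed.

Lemma normsq_neq0 (u : C) : u != 0 -> Re u ^+ 2 + Im u ^+ 2 != 0.
Proof.
by move=> u0; rewrite paddr_eq0 ?sqr_ge0// !sqrf_eq0; move: u0; rewrite eq_complex.
Qed.

Lemma ccvgV f c : c != 0 -> ccvg f c -> ccvg (fun t => (f t)^-1) c^-1.
Proof.
move=> /normsq_neq0 c0 [f1 f2]; rewrite /ccvg ReV ImV.
under eq_fun do rewrite ReV; under [X in _ /\ X @ _ --> _]eq_fun do rewrite ImV.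
have H : (Re (f t) ^+ 2 + Im (f t) ^+ 2)^-1 @[t --> F] --> (Re c ^+ 2 + Im c ^+ 2)^-1.
  by apply: cvgV => //; apply: cvgD; rewrite expr2; under eq_fun do rewrite expr2; apply: cvgM.
split; first exact: cvgM.
by apply: cvgN; apply: cvgM.
Qed.

Lemma ccvg_real (f : T -> R) (c : R) : f t @[t --> F] --> c -> ccvg (fun t => (f t)%:C) c%:C.
Proof. by move=> h; split => //=; exact: cvg_cst. Qed.

Lemma ccvg_near_neq0 f c : c != 0 -> ccvg f c -> \forall t \near F, f t != 0.
Proof.
move=> c0 [f1 f2].
have [h|h] : Re c != 0 \/ Im c != 0.
  by move: c0; rewrite eq_complex negb_and => /orP[]; [left|right].
- have /cvgrPdist_lt /(_ `|Re c|) := f1; rewrite normr_gt0 => /(_ h).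
  apply: filterS => t; apply: contraTneq => ->.
  by rewrite /= subr0 ltxx.
- have /cvgrPdist_lt /(_ `|Im c|) := f2; rewrite normr_gt0 => /(_ h).
  apply: filterS => t; apply: contraTneq => ->.
  by rewrite /= subr0 ltxx.
Qed.

Lemma mcvg_cst m n (M0 : 'M[C]_(m, n)) : mcvg (fun=> M0) M0.
Proof. by move=> i j; exact: ccvg_cst. Qed.

Lemma mcvgD m n (M N : T -> 'M[C]_(m, n)) M0 N0 : mcvg M M0 -> mcvg N N0 ->
  mcvg (fun t => M t + N t) (M0 + N0).
Proof.
move=> h1 h2 i j; rewrite mxE; apply: eq_ccvg (ccvgD (h1 i j) (h2 i j)) => t.
by rewrite mxE.
Qed.

Lemma mcvgN m n (M : T -> 'M[C]_(m, n)) M0 : mcvg M M0 -> mcvg (fun t => - M t) (- M0).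
Proof. by move=> h1 i j; rewrite mxE; apply: eq_ccvg (ccvgN (h1 i j)) => t; rewrite mxE. Qed.

Lemma mcvgZ m n k (M : T -> 'M[C]_(m, n)) M0 : mcvg M M0 ->
  mcvg (fun t => k *: M t) (k *: M0).
Proof.
move=> h1 i j; rewrite mxE; apply: eq_ccvg (ccvgM (ccvg_cst k) (h1 i j)) => t.
by rewrite mxE.
Qed.

Lemma ccvg_sum I (r : seq I) (f : I -> T -> C) (c : I -> C) :
  (forall i, ccvg (f i) (c i)) -> ccvg (fun t => \sum_(i <- r) f i t) (\sum_(i <- r) c i).
Proof.
move=> h; elim: r => [|x r IH].
  by rewrite big_nil; apply: eq_ccvg (ccvg_cst 0) => t; rewrite big_nil.
by rewrite big_cons; apply: eq_ccvg (ccvgD (h x) IH) => t; rewrite big_cons.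
Qed.

Lemma mcvgM m n p (M : T -> 'M[C]_(m, n)) (N : T -> 'M[C]_(n, p)) M0 N0 :
  mcvg M M0 -> mcvg N N0 -> mcvg (fun t => M t *m N t) (M0 *m N0).
Proof.
move=> h1 h2 i j; rewrite mxE.
apply: eq_ccvg (ccvg_sum _ (fun k => ccvgM (h1 i k) (h2 k j))) => t.
by rewrite mxE.
Qed.

Lemma mcvg_trC m n (M : T -> 'M[C]_(m, n)) M0 : mcvg M M0 ->
  mcvg (fun t => (M t) ^t*) (M0 ^t*).
Proof.
move=> h i j; rewrite !mxE; apply: eq_ccvg (ccvg_conj (h j i)) => t.
by rewrite !mxE.
Qed.

Lemma ccvg_det2 (M : T -> 'M[C]_2) M0 : mcvg M M0 -> ccvg (fun t => \det (M t)) (\det M0).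
Proof.
move=> h; rewrite det_mx2.
apply: eq_ccvg (ccvgD (ccvgM (h 0 0) (h 1 1)) (ccvgN (ccvgM (h 0 1) (h 1 0)))) => t.
by rewrite det_mx2.
Qed.

Lemma mcvg_unit2 (M : T -> 'M[C]_2) M0 : M0 \in unitmx -> mcvg M M0 ->
  \forall t \near F, M t \in unitmx.
Proof.
rewrite unitmxE unitfE => u h; have := ccvg_near_neq0 u (ccvg_det2 h).
by apply: filterS => t ht; rewrite unitmxE unitfE.
Qed.

Lemma mcvg_inv2 (M : T -> 'M[C]_2) M0 : M0 \in unitmx -> mcvg M M0 ->
  mcvg (fun t => invmx (M t)) (invmx M0).
Proof.
move=> u h i j.
(* A cofactor of a 2x2 matrix is a single entry up to sign. *)
have E (N : 'M[C]_2) : N \in unitmx ->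
    invmx N i j = (\det N)^-1 * ((-1) ^+ (j + i) * N (lift j 0) (lift i 0)).
  by move=> Nu; rewrite /invmx Nu !mxE /cofactor det_mx11 !mxE.
rewrite E//; have := mcvg_unit2 u h.
move=> /(filterS (fun t => @E (M t))) nE.
apply: near_eq_ccvg.
  by apply: filterS nE => t e; exact: esym e.
apply: ccvgM; last by apply: ccvgM; [exact: ccvg_cst|exact: h].
by apply: ccvgV; [rewrite -unitfE -unitmxE|exact: ccvg_det2].
Qed.

Lemma cvg_herm_s (M : T -> 'M[C]_2) M0 : mcvg M M0 ->
  herm_s (M t) @[t --> F] --> herm_s M0.
Proof.
move=> h; rewrite /herm_s; apply: cvgM; last exact: cvg_cst.
by apply: cvgD; [exact: (h 0 0).1|exact: (h 1 1).1].
Qed.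

Lemma cvg_herm_r (M : T -> 'M[C]_2) M0 : mcvg M M0 ->
  herm_r (M t) @[t --> F] --> herm_r M0.
Proof.
move=> h; rewrite /herm_r; apply: continuous_cvg; first exact: sqrt_continuous.
have sq (f : T -> R) (c : R) : f t @[t --> F] --> c -> f t ^+ 2 @[t --> F] --> c ^+ 2.
  by move=> fc; rewrite expr2; under eq_fun do rewrite expr2; apply: cvgM.
apply: cvgD; last exact: sq (h 0 1).2.
apply: cvgD; last exact: sq (h 0 1).1.
apply: sq; rewrite /herm_x; apply: cvgM; last exact: cvg_cst.
by apply: cvgB; [exact: (h 0 0).1|exact: (h 1 1).1].
Qed.

Lemma cvg_herm_eig s (M : T -> 'M[C]_2) M0 : mcvg M M0 ->
  herm_eig s (M t) @[t --> F] --> herm_eig s M0.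
Proof.
move=> h; rewrite /herm_eig; case: s.
  by apply: cvgD; [exact: cvg_herm_s|exact: cvg_herm_r].
by apply: cvgB; [exact: cvg_herm_s|exact: cvg_herm_r].
Qed.

End ComplexLimits.

(** * Local structure of the spectrum *)

Section LocalStructure.
Context {R : realType}.
Local Notation C := R[i].
Local Notation Re := (@complex.Re _).
Local Notation Im := (@complex.Im _).
Implicit Types (om : coefficients R) (l : R).
Variables (a b : R).
Hypothesis ab : a < b.
Local Notation dist := (coef_dist a b).
Local Notation S := (coef_space a b).
Local Notation E := (symplE R).
Local Notation toC := (map_mx (real_complex R)).

(** Triples [(l, l', om)]: the same [om] at two nearby spectral parameters, as the difference
    quotient of the chart in [l] requires. *)
Definition sl_near om0 l0 : set_system (R * R * coefficients R) :=
  filter_from [set e : R | 0 < e] (fun e => [set t |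
    [/\ S t.2, `|t.1.1 - l0| < e, `|t.1.2 - l0| < e & dist t.2 om0 < e]]).

Global Instance sl_near_filter om0 l0 : Filter (sl_near om0 l0).
Proof.
apply: filter_from_filter; first by exists 1 => /=.
move=> e e' /= e0 e'0; exists (Num.min e e'); first by rewrite /= lt_min e0.
by move=> t [/= h1]; rewrite !lt_min => /andP[h2 h2'] /andP[h3 h3'] /andP[h4 h4'].
Qed.

Lemma cvg_sl_near om0 l0 (f : R * R * coefficients R -> R) (c K : R) : 0 <= K ->
  (forall t, S t.2 -> dist t.2 om0 <= 1 -> `|t.1.1 - l0| <= 1 -> `|t.1.2 - l0| <= 1 ->
    `|f t - c| <= K * (`|t.1.1 - l0| + `|t.1.2 - l0| + dist t.2 om0)) ->
  f t @[t --> sl_near om0 l0] --> c.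
Proof.
move=> K0 H; apply/cvgrPdist_lt => e e0.
(* Three distances, each to be below [e / (3 * (K + 1))]; [K + 1] is positive even for [K = 0]. *)
have K1 : 0 < 3 * (K + 1) by lra.
exists (Num.min 1 (e / (3 * (K + 1)))); first by rewrite /= lt_min ltr01 divr_gt0.
move=> t /= [St]; rewrite !lt_min => /andP[h1 h1'] /andP[h2 h2'] /andP[h3 h3'].
rewrite distrC; apply: le_lt_trans (H t St (ltW h3) (ltW h1) (ltW h2)) _.
set r := _ + _ + dist t.2 om0.
have r3 : r < 3 * (e / (3 * (K + 1))) by rewrite /r; lra.
have r0 : 0 <= r by rewrite !addr_ge0// coef_dist_ge0.
have E3 : (K + 1) * (3 * (e / (3 * (K + 1)))) = e by field; rewrite gt_eqF// ltr_wpDl.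
rewrite -E3; apply: (@le_lt_trans _ _ ((K + 1) * r)).
  by rewrite ler_wpM2r// lerDl.
by rewrite ltr_pM2l// ltr_wpDl.
Qed.

Lemma cvg_transfer om0 l0 i j : S om0 ->
  transfer ab t.2 t.1.1 i j @[t --> sl_near om0 l0] --> transfer ab om0 l0 i j /\
  transfer ab t.2 t.1.2 i j @[t --> sl_near om0 l0] --> transfer ab om0 l0 i j.
Proof.
move=> S0; have [K K0 HK] := sl_base_lipschitz ab l0 S0.
have H om l : S om -> dist om om0 <= 1 -> `|l - l0| <= 1 ->
    `|transfer ab om l i j - transfer ab om0 l0 i j| <= K * (`|l - l0| + dist om om0).
  move=> So d1 l1; have := HK om l So d1 l1 j b; rewrite lexx ltW// => /(_ isT).
  have n1 := normr_ge0 ((sl_base ab om l j).1 b - (sl_base ab om0 l0 j).1 b).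
  have n2 := normr_ge0 ((sl_base ab om l j).2 b - (sl_base ab om0 l0 j).2 b).
  by rewrite /transfer !mxE; case: ifP => _; lra.
split; apply: (cvg_sl_near K0) => t St d1 l1 l2; apply: le_trans (H _ _ St d1 _) _ => //;
  by apply: ler_wpM2l => //; rewrite lerD2r ?lerDl ?lerDr.
Qed.

Lemma cvg_gram om0 l0 i j : S om0 ->
  gram ab t.2 t.1.2 t.1.1 i j @[t --> sl_near om0 l0] --> gram ab om0 l0 l0 i j.
Proof.
move=> S0; have [K K0 HK] := gram_lipschitz ab l0 S0.
apply: (cvg_sl_near K0) => t St d1 l1 l2; rewrite [_ + `|_|]addrC.
exact: HK.
Qed.

Lemma symplE_N : E ^t* = - E.
Proof.
apply/matrixP => i j; rewrite !mxE; elim/ord2P: i; elim/ord2P: j => /=;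
  by apply: eq_ReIm; rewrite ?ReC ?ImC ?ReN ?ImN//= ?oppr0 ?opprK.
Qed.

Lemma symplE_sqr : E *m E = - 1%:M.
Proof.
apply/matrixP => i j; rewrite !mxE big_ord2 !mxE; elim/ord2P: i; elim/ord2P: j => /=; ring.
Qed.

Lemma toC_trC m n (M : 'M[R]_(m, n)) : (toC M) ^t* = toC M^T.
Proof. by apply/matrixP => i j; rewrite !mxE; apply: eq_ReIm => /=; rewrite ?oppr0. Qed.

(** Lagrange's identity for all pairs of basis solutions at once; the term [E] is the bracket of the
    initial data. *)
Lemma transfer_lagrange om l l' : S om ->
  E - (toC (transfer ab om l)) ^t* *m E *m toC (transfer ab om l') =
  toC ((l - l') *: gram ab om l l').
Proof.
move=> So.
have L i j := sl_lagrange (ltW ab) (sl_base_sol ab l i So) (sl_base_sol ab l' j So).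
have G i j : oc_int a b (fun t => (cf_Q om l' t - cf_Q om l t) *
    ((sl_base ab om l i).1 t * (sl_base ab om l' j).1 t)) = (l - l') * gram ab om l l' i j.
  rewrite gramE -oc_intZ; last exact: gram_integrable.
  by apply: eq_oc_int => t _; rewrite /cf_Q; ring.
have [p1 p2 p3 p4] := sl_base_a ab l So; have [q1 q2 q3 q4] := sl_base_a ab l' So.
rewrite toC_trC.
have EC : E = toC (\matrix_(i, j) (if (i < j)%N then -1 else if (j < i)%N then 1 else 0)).
  apply/matrixP => i j; rewrite !mxE.
  by case: ifP => _; [rewrite rmorphN1|case: ifP => _; rewrite ?rmorph1 ?rmorph0].
rewrite EC -!map_mxM -map_mxB; congr toC; apply/matrixP => i j.
rewrite [RHS]mxE -G -L !mxE !big_ord2 !mxE !big_ord2 !mxE.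
by elim/ord2P: i; elim/ord2P: j => /=; rewrite ?p1 ?p2 ?p3 ?p4 ?q1 ?q2 ?q3 ?q4; ring.
Qed.

Lemma transfer_symplectic om l : S om ->
  (toC (transfer ab om l)) ^t* *m E *m toC (transfer ab om l) = E.
Proof.
move=> So; have := transfer_lagrange l l So.
rewrite subrr scale0r map_mx0 => /eqP; rewrite subr_eq0 => /eqP <-.
by [].
Qed.

Lemma gram_sym om l : (gram ab om l l)^T = gram ab om l l.
Proof.
apply/matrixP => i j; rewrite mxE !gramE; apply: eq_oc_int => t _; ring.
Qed.

(** The form is the integral of [r] times the square of the solution with initial data [(u, v)]. *)
Lemma gram_quad_gt0 om l (u v : R) : S om -> (u != 0) || (v != 0) ->
  0 < u ^+ 2 * gram ab om l l 0 0 + 2 * u * v * gram ab om l l 0 1 +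
      v ^+ 2 * gram ab om l l 1 1.
Proof.
move=> So uv.
have sol := sl_solutionD (sl_solutionZ u (sl_base_sol ab l 0 So))
                         (sl_solutionZ v (sl_base_sol ab l 1 So)).
have [py _] := sol.
have [x0 x0ab yx0] : exists2 x0, a <= x0 <= b &
    u * (sl_base ab om l 0).1 x0 + v * (sl_base ab om l 1).1 x0 != 0.
  apply: contrapT => H.
  have [] := sl_sol_eq0 ab So sol.
    move=> x xab; apply/eqP; apply: contrapT => /negP h; apply: H; by exists x.
  have [-> -> -> ->] := sl_base_a ab l So.
  rewrite !mulr0 !mulr1 addr0 add0r => u0 v0.
  by move: uv; rewrite u0 v0 eqxx.
have := oc_int_weight_gt0 ab (coef_r_integrable So) (coef_r_gt0 So) py x0ab yx0.
have gi i j := gram_integrable ab l l i j So So.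
congr (_ < _); rewrite !gramE.
rewrite -[u ^+ 2 * _]oc_intZ// -[2 * u * v * _]oc_intZ// -[v ^+ 2 * _]oc_intZ//.
rewrite -!oc_intD; first (apply: eq_oc_int => t _; ring);
  by repeat first [exact: gi | apply: oc_integrableZ | apply: oc_integrableD].
Qed.

Lemma gram_det_gt0 om l : S om -> 0 < gram ab om l l 0 0 /\
  0 < gram ab om l l 0 0 * gram ab om l l 1 1 - gram ab om l l 0 1 ^+ 2.
Proof.
move=> So.
have g0 : 0 < gram ab om l l 0 0.
  have := @gram_quad_gt0 om l 1 0 So; rewrite oner_eq0 => /(_ isT).
  by congr (_ < _); ring.
split => //; rewrite -(pmulr_rgt0 _ g0).
(* On this vector the form is the corner entry times the determinant. *)
have := @gram_quad_gt0 om l (- gram ab om l l 0 1) (gram ab om l l 0 0) So.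
rewrite (gt_eqF g0) orbT => /(_ isT); congr (_ < _); ring.
Qed.

Section Boundary.
Variables (A B : 'M[C]_2).
Hypothesis hAB : selfadjoint_bc A B.

Let rAB : \rank (row_mx A B) = 2%N. Proof. by case: hAB. Qed.
Let sAB : A *m E *m A ^t* = B *m E *m B ^t*. Proof. by case: hAB. Qed.

(** Congruence preserves definiteness. The corner entry is the form [G] on the first column of
    [invmx X], and the determinant is that of [G] times a squared modulus. *)
Lemma herm_congr (X : 'M[C]_2) (G : 'M[R]_2) : X \in unitmx -> G^T = G ->
  0 < G 0 0 -> 0 < G 0 0 * G 1 1 - G 0 1 ^+ 2 ->
  herm_r ((invmx X) ^t* *m toC G *m invmx X) < herm_s ((invmx X) ^t* *m toC G *m invmx X).
Proof.
move=> Xu GT G0 Gd; set V := invmx X.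
have Vu : V \in unitmx by rewrite unitmx_inv.
have G10 : G 1 0 = G 0 1 by have /matrixP/(_ 0 1) := GT; rewrite mxE.
have dG : \det G = G 0 0 * G 1 1 - G 0 1 ^+ 2 by rewrite det_mx2 G10 expr2.
apply: herm_posdef.
- by rewrite !trC_mul trmxCK toC_trC GT mulmxA.
- set p := V 0 0; set q := V 1 0.
  have -> : Re ((V ^t* *m toC G *m V) 0 0) =
    (Re p ^+ 2 + Im p ^+ 2) * G 0 0 + 2 * (Re p * Re q + Im p * Im q) * G 0 1 +
    (Re q ^+ 2 + Im q ^+ 2) * G 1 1.
    rewrite !mxE !big_ord2 !mxE !big_ord2 !mxE -/p -/q G10.
    by rewrite !(ReD, ReM, ImM, ImD, ReC, ImC)/=; ring.
  have nz : (Re p ^+ 2 + Im p ^+ 2) + (Re q ^+ 2 + Im q ^+ 2) != 0.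
    rewrite paddr_eq0 ?addr_ge0 ?sqr_ge0//; apply/negP => /andP[p0 q0].
    have {}p0 : p = 0 by apply/eqP; apply: contraLR p0; exact: normsq_neq0.
    have {}q0 : q = 0 by apply/eqP; apply: contraLR q0; exact: normsq_neq0.
    by move: Vu; rewrite unitmxE det_mx2 -/p -/q p0 q0 mul0r mulr0 subrr unitr0.
  have {}nz : 0 < (Re p ^+ 2 + Im p ^+ 2) + (Re q ^+ 2 + Im q ^+ 2).
    by rewrite lt_neqAle eq_sym nz !addr_ge0// sqr_ge0.
  rewrite -(pmulr_rgt0 _ G0).
  (* Completing the square after multiplication by [G 0 0]. *)
  rewrite [ltRHS](_ : _ = (G 0 0 * Re p + G 0 1 * Re q) ^+ 2 +
    (G 0 0 * Im p + G 0 1 * Im q) ^+ 2 + (G 0 0 * G 1 1 - G 0 1 ^+ 2) *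
    (Re q ^+ 2 + Im q ^+ 2)); last by ring.
  have := ltW Gd; set D := _ - _ in Gd * => D0.
  have q0 : 0 <= Re q ^+ 2 + Im q ^+ 2 by rewrite addr_ge0// sqr_ge0.
  move: q0; rewrite le_eqVlt => /orP[/eqP q0|q0]; last first.
    by rewrite ltr_wpDl ?mulr_gt0// addr_ge0// sqr_ge0.
  move: q0 => /esym/eqP; rewrite paddr_eq0 ?sqr_ge0// !sqrf_eq0 => /andP[/eqP q1 /eqP q2].
  move: nz; rewrite q1 q2 expr0n/= !addr0 !mulr0 !addr0 => nz.
  by rewrite !exprMn -mulrDr mulr_gt0// exprn_gt0.
- rewrite !det_mulmx det_map_mx/= det_map_mx det_tr dG.
  have d0 : \det V != 0 by rewrite -unitfE -unitmxE.
  rewrite !(ReM, ImM, ReC, ImC)/=.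
  rewrite [ltRHS](_ : _ = (G 0 0 * G 1 1 - G 0 1 ^+ 2) *
    (Re (\det V) ^+ 2 + Im (\det V) ^+ 2)); last by ring.
  by rewrite mulr_gt0// lt_neqAle eq_sym normsq_neq0// addr_ge0// sqr_ge0.
Qed.

(** The branches are the two eigenvalues of the chart whose tilt [k] is chosen at [(om0, l0)]; [e]
    is small enough for the denominator to stay invertible and the difference quotient to stay
    positive definite. Dependence on [om] is stated at [om0], with which signs will be compared. *)
Lemma local_structure om0 l0 : S om0 -> exists2 e : R, 0 < e &
  exists h : bool -> coefficients R -> R -> R,
  [/\ forall om l, S om -> dist om om0 < e -> `|l - l0| < e ->
        (2 - \rank (charmx ab A B om l) =
          (h false om l == 0%R) + (h true om l == 0%R))%N,
      forall s om l l', S om -> dist om om0 < e -> `|l - l0| < e -> `|l' - l0| < e ->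
        l < l' -> h s om l < h s om l',
      forall s om l, S om -> dist om om0 < e -> `|l - l0| < e ->
        {for l, continuous (h s om)} &
      forall s l, `|l - l0| < e -> forall eps, 0 < eps -> exists2 d, 0 < d &
        forall om, S om -> dist om om0 < d -> `|h s om l - h s om0 l| < eps].
Proof.
move=> S0.
have symp om l (So : S om) := transfer_symplectic l So.
have [k kU] := chart_den_exists symplE_N symplE_sqr rAB sAB (symp om0 l0 S0).
have kR : Num.conj (k%:R : C) = k%:R by rewrite rmorph_nat.
pose Phi om l := toC (transfer ab om l).
pose X om l := chart_den E A B k%:R (Phi om l).
pose H om l := chart E A B k%:R (Phi om l).
(* For [t = (l, l', om)] this is the difference quotient of [H om] between [l] and [l']; on the
   diagonal it is congruent to the Gram matrix. *)
pose T (t : R * R * coefficients R) :=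
  (invmx (X t.2 t.1.2)) ^t* *m toC (gram ab t.2 t.1.2 t.1.1) *m invmx (X t.2 t.1.1).
have cPhi om l : S om ->
  mcvg (sl_near om l) (fun t => Phi t.2 t.1.1) (Phi om l) /\
  mcvg (sl_near om l) (fun t => Phi t.2 t.1.2) (Phi om l).
  move=> So; split => i j; rewrite [X in ccvg _ _ X]mxE.
    apply: eq_ccvg (ccvg_real (cvg_transfer l i j So).1) => t; by rewrite [RHS]mxE.
  apply: eq_ccvg (ccvg_real (cvg_transfer l i j So).2) => t; by rewrite [RHS]mxE.
have cY om l : S om -> mcvg (sl_near om l) (fun t => bc_Y A B (Phi t.2 t.1.1)) (bc_Y A B (Phi om l)) /\
    mcvg (sl_near om l) (fun t => bc_Y A B (Phi t.2 t.1.2)) (bc_Y A B (Phi om l)).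
  move=> So; have [p1 p2] := cPhi om l So; rewrite /bc_Y; split.
    apply: mcvgD; first exact: mcvg_cst.
    by apply: mcvgM; [exact: mcvg_cst|exact: p1].
  apply: mcvgD; first exact: mcvg_cst.
  by apply: mcvgM; [exact: mcvg_cst|exact: p2].
have cX om l : S om -> mcvg (sl_near om l) (fun t => X t.2 t.1.1) (X om l) /\
    mcvg (sl_near om l) (fun t => X t.2 t.1.2) (X om l).
  move=> So; have [p1 p2] := cPhi om l So; have [y1 y2] := cY om l So.
  rewrite /X /chart_den /bc_X; split.
    apply: mcvgD; last by apply: mcvgN; apply: mcvgZ; exact: y1.
    apply: mcvgD; first exact: mcvg_cst.
    by apply: mcvgN; apply: mcvgM; [exact: mcvg_cst|exact: p1].
  apply: mcvgD; last by apply: mcvgN; apply: mcvgZ; exact: y2.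
  apply: mcvgD; first exact: mcvg_cst.
  by apply: mcvgN; apply: mcvgM; [exact: mcvg_cst|exact: p2].
have cH om l : S om -> X om l \in unitmx ->
    mcvg (sl_near om l) (fun t => H t.2 t.1.1) (H om l).
  move=> So Xu; apply: mcvgM; last exact: mcvg_inv2 Xu (cX om l So).1.
  by apply: mcvgM; [exact: mcvg_cst|exact: (cY om l So).1].
have cT : mcvg (sl_near om0 l0) T (T (l0, l0, om0)).
  apply: mcvgM; last exact: mcvg_inv2 kU (cX om0 l0 S0).1.
  apply: mcvgM; first by apply: mcvg_trC; exact: mcvg_inv2 kU (cX om0 l0 S0).2.
  move=> i j; rewrite [X in ccvg _ _ X]mxE /=.
  by apply: eq_ccvg (ccvg_real (@cvg_gram om0 l0 i j S0)) => t; rewrite [RHS]mxE.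
have T0 : herm_r (T (l0, l0, om0)) < herm_s (T (l0, l0, om0)).
  have [g1 g2] := gram_det_gt0 l0 S0.
  exact: herm_congr kU (gram_sym om0 l0) g1 g2.
have nT : \forall t \near sl_near om0 l0, herm_r (T t) < herm_s (T t).
  have c : herm_s (T t) - herm_r (T t) @[t --> sl_near om0 l0] -->
      herm_s (T (l0, l0, om0)) - herm_r (T (l0, l0, om0)).
    by apply: cvgB; [exact: cvg_herm_s|exact: cvg_herm_r].
  move: c => /cvgrPdist_lt /(_ (herm_s (T (l0, l0, om0)) - herm_r (T (l0, l0, om0)))).
  rewrite subr_gt0 => /(_ T0); apply: filterS => t.
  by rewrite ltr_distlC/= => /andP[+ _]; rewrite subrr subr_gt0.
have nX : \forall t \near sl_near om0 l0, X t.2 t.1.1 \in unitmx.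
  exact: mcvg_unit2 kU (cX om0 l0 S0).1.
have [e e0 He] : \forall t \near sl_near om0 l0,
    herm_r (T t) < herm_s (T t) /\ X t.2 t.1.1 \in unitmx.
  exact: filterI nT nX.
have XU om l : S om -> dist om om0 < e -> `|l - l0| < e -> X om l \in unitmx.
  by move=> So d1 l1; have [] := He (l, l, om).
exists e => //; exists (fun s om l => herm_eig s (H om l)); split.
- move=> om l So d1 l1; have Xu := XU om l So d1 l1.
  rewrite -(rank_chart rAB Xu) -rank_herm//.
  exact: (chart_herm symplE_N symplE_sqr rAB sAB kR (symp om l So) Xu).
- move=> s om l l' So d1 l1 l1' ll'; apply: herm_eig_lt.
  have Xu := XU om l So d1 l1; have Xu' := XU om l' So d1 l1'.
  have [posT _] : herm_r (T (l, l', om)) < herm_s (T (l, l', om)) /\ X om l \in unitmx.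
    exact: (He (l, l', om)).
  have -> : H om l' - H om l = (l' - l)%:C *: T (l, l', om).
    rewrite /H (chart_diff symplE_N symplE_sqr rAB sAB kR (symp om l' So) Xu' Xu).
    rewrite /T /Phi /= (transfer_lagrange l' l So) map_mxZ -scalemxAr -scalemxAl.
    by [].
  set M := T _ in posT *.
  have p : 0 < l' - l by rewrite subr_gt0.
  have -> : herm_s ((l' - l)%:C *: M) = (l' - l) * herm_s M.
    by rewrite /herm_s !mxE !ReZ; field.
  have -> : herm_r ((l' - l)%:C *: M) = (l' - l) * herm_r M.
    rewrite /herm_r /herm_x !mxE !ReZ ImZ -[X in X * Num.sqrt _](ger0_norm (ltW p)).
    rewrite -sqrtr_sqr -sqrtrM ?sqr_ge0//; congr Num.sqrt.
    by field.
  by rewrite ltr_pM2l.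
- move=> s om l So d1 l1; have Xu := XU om l So d1 l1.
  have c : herm_eig s (H t.2 t.1.1) @[t --> sl_near om l] --> herm_eig s (H om l).
    by apply: cvg_herm_eig; exact: cH.
  apply/cvgrPdist_lt => eps eps0; move: c => /cvgrPdist_lt /(_ _ eps0)[d /= d0 Hd].
  apply/nbhs_ballP; exists d => // l' ll'.
  apply: (Hd (l', l', om)); split => //=; [by rewrite distrC|by rewrite distrC|].
  by rewrite coef_distE// (@eq_oc_int _ _ _ _ (fun=> 0)) ?oc_int_cst ?mul0r ?ltW// => t _;
    rewrite /coef_diff !subrr normr0 !addr0.
- move=> s l l1 eps eps0.
  have dd : dist om0 om0 < e.
    by rewrite coef_distE// (@eq_oc_int _ _ _ _ (fun=> 0)) ?oc_int_cst ?mul0r ?ltW// => t _;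
    rewrite /coef_diff !subrr normr0 !addr0.
  have Xu := XU om0 l S0 dd l1.
  have : herm_eig s (H t.2 t.1.1) @[t --> sl_near om0 l] --> herm_eig s (H om0 l).
    by apply: cvg_herm_eig; exact: cH.
  move=> /cvgrPdist_lt /(_ _ eps0)[d /= d0 Hd].
  exists d => // om So dom; rewrite distrC; apply: (Hd (l, l, om)).
  by split => //=; rewrite subrr normr0.
Qed.

End Boundary.

End LocalStructure.

(** * Uniform lower bound *)

Section WeightedEstimates.
Context {R : realType}.
Local Notation mu := (@lebesgue_measure R).
Implicit Types (a b c d x : R) (f g w y z : R -> R).

Lemma bounded_measurableM a b f g : bounded_measurable a b f ->
  bounded_measurable a b g -> bounded_measurable a b (fun t => f t * g t).
Proof.
move=> [mf [B fB]] [mg [D gD]]; split; first exact: measurable_funM.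
by exists (B * D) => x xab; rewrite normrM ler_pM ?fB ?gD.
Qed.

Lemma bounded_measurableS a b c d f : a <= c -> d <= b ->
  bounded_measurable a b f -> bounded_measurable c d f.
Proof.
move=> ac db [mf [B fB]]; split.
  by apply: measurable_funS mf => //; apply: subset_itv; rewrite bnd_simp.
exists B => t /andP[ct td]; apply: fB.
by rewrite (le_trans ac)// (le_trans td).
Qed.

Lemma oc_int_weight_norm a b w f : oc_integrable a b w -> bounded_measurable a b f ->
  {ae mu, forall x, `]a, b[%classic x -> 0 < w x} ->
  oc_int a b (fun x => w x * f x) = oc_int a b (fun x => `|w x| * f x).
Proof.
move=> wi mf w0; apply: ae_eq_oc_int_oo.
- exact: bounded_measurable_integrableM.
- by apply: bounded_measurable_integrableM => //; exact: oc_integrable_norm.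
- apply: filterS w0; first exact: (ae_filter_ringOfSetsType mu).
  by move=> x /= h /h wx; rewrite gtr0_norm.
Qed.

(** Expand the integral of |w| (e f - U)^2, where [U] is the integral of |w| f; the bound [e] stands
    in for the total mass of |w|. *)
Lemma weighted_cauchy_schwarz a b w f (e : R) : 0 < e -> oc_integrable a b w ->
  bounded_measurable a b f -> oc_int a b (fun t => `|w t|) <= e ->
  oc_int a b (fun t => `|w t| * f t) ^+ 2 <= e * oc_int a b (fun t => `|w t| * f t ^+ 2).
Proof.
move=> e0 wi mf we.
have wni := oc_integrable_norm wi.
have wfi := bounded_measurable_integrableM mf wni.
have mf2 : bounded_measurable a b (fun t => f t ^+ 2) := bounded_measurableM mf mf.
have wf2i := bounded_measurable_integrableM mf2 wni.
set V := oc_int a b (fun t => `|w t| * f t ^+ 2).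
set U := oc_int a b (fun t => `|w t| * f t).
set w1 := oc_int a b (fun t => `|w t|) in we *.
have : 0 <= oc_int a b (fun t => `|w t| * (e * f t - U) ^+ 2).
  by apply: oc_int_ge0 => t _; rewrite mulr_ge0// sqr_ge0.
rewrite (@eq_oc_int _ _ _ _ (fun t => e ^+ 2 * (`|w t| * f t ^+ 2) -
  2 * e * U * (`|w t| * f t) + U ^+ 2 * `|w t|)); last by move=> t _; ring.
rewrite oc_intD; last exact: oc_integrableZ.
  rewrite oc_intB; [|exact: oc_integrableZ|exact: oc_integrableZ].
  rewrite !oc_intZ// -/U -/V -/w1 => H.
  have H2 : U ^+ 2 * w1 <= U ^+ 2 * e by rewrite ler_wpM2l// sqr_ge0.
  rewrite -subr_ge0 -(pmulr_rge0 _ e0).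
  rewrite [leRHS](_ : _ = e ^+ 2 * V - 2 * e * U * U + U ^+ 2 * e); last by ring.
  lra.
by apply: oc_integrableB; exact: oc_integrableZ.
Qed.

(** A Sobolev-type bound. On a window where |s| has integral at most 1/2, the oscillation of [y] is
    at most half its maximum plus the integral of |P z|, whose square Cauchy-Schwarz bounds by [e]
    times the energy. Averaging the reference point against |w| turns a point value into the
    weighted norm. *)
Lemma sl_sup_estimate a b c d P s Q w y z (e rho : R) :
  a <= c -> c <= d -> d <= b -> 0 < e -> 0 < rho ->
  oc_integrable a b P -> oc_integrable a b s -> oc_integrable a b w ->
  sl_solution a b P s Q y z ->
  oc_int c d (fun t => `|P t|) <= e -> oc_int c d (fun t => `|s t|) <= 2^-1 ->
  rho <= oc_int c d (fun t => `|w t|) ->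
  forall x, c <= x <= d -> y x ^+ 2 <= 8 * e * oc_int a b (fun t => `|P t| * z t ^+ 2) +
    8 / rho * oc_int a b (fun t => `|w t| * y t ^+ 2).
Proof.
move=> ac cd db e0 rho0 Pi si wi [py pz] Pe s2 wrho x xcd.
have my := primitive_bounded_measurable py; have mz := primitive_bounded_measurable pz.
have my' := bounded_measurableS ac db my; have mz' := bounded_measurableS ac db mz.
have Pi' := oc_integrableS ac db Pi; have si' := oc_integrableS ac db si.
have wi' := oc_integrableS ac db wi.
have my2 : bounded_measurable a b (fun t => y t ^+ 2) := bounded_measurableM my my.
have mz2 : bounded_measurable a b (fun t => z t ^+ 2) := bounded_measurableM mz mz.
have py' := primitive_restr py ac cd db.
set Z := oc_int c d (fun t => `|P t| * `|z t|).
set Ez := oc_int a b (fun t => `|P t| * z t ^+ 2).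
set Rw := oc_int a b (fun t => `|w t| * y t ^+ 2).
have Ez0 : 0 <= Ez by apply: oc_int_ge0 => t _; rewrite mulr_ge0// sqr_ge0.
have Rw0 : 0 <= Rw by apply: oc_int_ge0 => t _; rewrite mulr_ge0// sqr_ge0.
have mnz := bounded_measurable_norm mz'; have mny := bounded_measurable_norm my'.
have Pni := oc_integrable_norm Pi'; have sni := oc_integrable_norm si'.
have Z0 : 0 <= Z by apply: oc_int_ge0 => t _; rewrite mulr_ge0.
have Z2 : Z ^+ 2 <= e * Ez.
  apply: le_trans (weighted_cauchy_schwarz e0 Pi' mnz Pe) _; rewrite ler_pM2l//.
  rewrite (@eq_oc_int _ _ _ _ (fun t => `|P t| * z t ^+ 2)); last first.
    by move=> t _; rewrite real_normK ?num_real.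
  apply: oc_int_le_sub => //; first exact: (bounded_measurable_integrableM mz2 (oc_integrable_norm Pi)).
  by move=> t _; rewrite mulr_ge0// sqr_ge0.
have yc : {within `[c, d], continuous (fun t => `|y t|)}.
  move=> t; apply: continuous_comp; last exact: norm_continuous.
  exact: (primitive_continuous py').
have [x1 x1cd Hx1] := EVT_max cd yc.
move: x1cd; rewrite in_itv/= => x1cd.
have ymax t : c <= t <= d -> `|y t| <= `|y x1| by move=> tcd; apply: Hx1; rewrite in_itv.
have osc t t' : c <= t -> t <= t' -> t' <= d -> `|y t' - y t| <= Z + `|y x1| / 2.
  move=> ct tt' t'd; apply: le_trans (primitive_dist py' ct tt' t'd) _.
  have [iy _] := py'.
  apply: le_trans (oc_int_le_sub ct tt' t'd (oc_integrable_norm iy) _) _ => //.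
  have i1 := bounded_measurable_integrableM mnz Pni.
  have i2 := oc_integrableZ `|y x1| sni.
  apply: (@le_trans _ _ (oc_int c d (fun t => `|P t| * `|z t| + `|y x1| * `|s t|))).
    apply: le_oc_int; [exact: oc_integrable_norm|exact: oc_integrableD|].
    move=> u /andP[/ltW cu ud]; apply: le_trans (ler_normB _ _) _; rewrite !normrM.
    by rewrite lerD2l mulrC ler_wpM2r// ymax// cu.
  by rewrite oc_intD// oc_intZ// lerD2l ler_wpM2l.
have bnd x2 : c <= x2 <= d -> `|y x1| <= 2 * (`|y x2| + Z).
  move=> /andP[cx2 x2d]; have /andP[cx1 x1d] := x1cd.
  have o : `|y x1 - y x2| <= Z + `|y x1| / 2.
    have [h|/ltW h] := leP x2 x1; first exact: osc.
    by rewrite distrC; exact: osc.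
  have : `|y x1| <= `|y x2| + `|y x1 - y x2|.
    by rewrite -{1}(subrK (y x2) (y x1)) addrC ler_normD.
  lra.
(* Squaring [bnd] with (u + v)^2 <= 2 u^2 + 2 v^2 produces the constants 8. *)
have sq x2 : c <= x2 <= d -> y x ^+ 2 <= 8 * y x2 ^+ 2 + 8 * (e * Ez).
  move=> x2cd; have h := le_trans (ymax _ xcd) (bnd _ x2cd).
  rewrite -[y x ^+ 2]real_normK ?num_real// -[y x2 ^+ 2]real_normK ?num_real//.
  have h2 : `|y x| ^+ 2 <= (2 * (`|y x2| + Z)) ^+ 2.
    by rewrite ler_pXn2r// nnegrE// mulr_ge0// addr_ge0.
  apply: le_trans h2 _.
  have h3 : 0 <= (`|y x2| - Z) ^+ 2 by exact: sqr_ge0.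
  have h4 : (2 * (`|y x2| + Z)) ^+ 2 = 8 * `|y x2| ^+ 2 + 8 * Z ^+ 2 - 4 * (`|y x2| - Z) ^+ 2.
    by ring.
  rewrite h4; lra.
(* Integrate [sq] over the reference point [x2] against |w|. *)
have int : (y x ^+ 2 - 8 * (e * Ez)) * oc_int c d (fun t => `|w t|) <= 8 * Rw.
  have wni := oc_integrable_norm wi'.
  have my2' := bounded_measurableS ac db my2.
  rewrite -oc_intZ//.
  apply: (@le_trans _ _ (8 * oc_int c d (fun t => `|w t| * y t ^+ 2))).
    rewrite -oc_intZ; last exact: bounded_measurable_integrableM.
    apply: le_oc_int; first exact: oc_integrableZ.
      by apply: oc_integrableZ; exact: bounded_measurable_integrableM.
    move=> t /andP[/ltW ct td].
    have := sq t; rewrite ct td => /(_ isT) h.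
    rewrite [leRHS]mulrCA [leLHS]mulrC ler_wpM2l//; lra.
  rewrite ler_pM2l//; apply: oc_int_le_sub => //.
    exact: (bounded_measurable_integrableM my2 (oc_integrable_norm wi)).
  by move=> t _; rewrite mulr_ge0// sqr_ge0.
have [h|h] := leP (y x ^+ 2 - 8 * (e * Ez)) 0.
  have : 0 <= 8 / rho * Rw by rewrite !mulr_ge0// invr_ge0 ltW.
  by rewrite -[8 * e * _]mulrA; lra.
have : (y x ^+ 2 - 8 * (e * Ez)) * rho <= 8 * Rw.
  by apply: le_trans int; rewrite ler_pM2l.
rewrite -ler_pdivlMr// [8 * Rw / rho]mulrAC -[8 * e * _]mulrA; lra.
Qed.

Lemma subitv_containing a b (e0 x : R) : 0 < e0 -> e0 <= b - a -> a <= x -> x <= b ->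
  exists c, [/\ a <= c, c + e0 <= b, c <= x & x <= c + e0].
Proof.
move=> e00 e0ab ax xb; exists (Num.min x (b - e0)).
by case: (leP x (b - e0)) => h; split; lra.
Qed.

(** The mass of a window of length [e0] is a continuous and positive function of its left end, so it
    attains a positive minimum on [[a, b - e0]]. *)
Lemma uniform_cover a b w (e0 : R) : a < b -> oc_integrable a b w ->
  {ae mu, forall x, `]a, b[%classic x -> 0 < w x} -> 0 < e0 -> e0 <= b - a ->
  exists2 rho, 0 < rho & forall c, a <= c -> c + e0 <= b -> rho <= oc_int c (c + e0) w.
Proof.
move=> ab wi w0 e00 e0ab.
have pm : primitive a b (fun x => oc_int a x w) w.
  by split => // x _; rewrite oc_int_xx add0r.
pose g c := oc_int a (c + e0) w - oc_int a c w.
have gE c : a <= c -> c + e0 <= b -> g c = oc_int c (c + e0) w.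
  by move=> ac cb; rewrite /g (primitive_sub pm)// lerDl ltW.
have ale : a <= b - e0 by lra.
have gc : {within `[a, b - e0], continuous g}.
  apply: within_itv_continuous => x /andP[ax xb] e e1.
  have e2 : 0 < e / 2 by rewrite divr_gt0.
  have [d d0 H] := oc_int_small_itv wi e2.
  have K u v : a <= u -> u <= v -> v <= b -> v - u < d ->
      `|oc_int a v w - oc_int a u w| < e / 2.
    by move=> au uv vb uvd; apply: le_lt_trans (primitive_dist pm au uv vb) _; exact: H.
  have K' u v : a <= u <= b -> a <= v <= b -> `|u - v| < d ->
      `|oc_int a u w - oc_int a v w| < e / 2.
    move=> /andP[au ub] /andP[av vb] uvd; have [uv|/ltW vu] := leP u v.
      by rewrite distrC; apply: K => //; apply: le_lt_trans uvd; rewrite distrC ler_norm.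
    by apply: K => //; apply: le_lt_trans uvd; rewrite ler_norm.
  exists d => // y /andP[ay yb] xyd.
  have -> : g x - g y = (oc_int a (x + e0) w - oc_int a (y + e0) w) -
      (oc_int a x w - oc_int a y w) by rewrite /g; ring.
  apply: le_lt_trans (ler_normB _ _) _; rewrite [ltRHS]splitr; apply: ltrD; apply: K'.
  - by apply/andP; split; lra.
  - by apply/andP; split; lra.
  - by rewrite opprD addrACA subrr addr0.
  - by apply/andP; split; lra.
  - by apply/andP; split; lra.
  - by [].
have [c cab Hc] := EVT_min ale gc.
move: cab; rewrite in_itv/= => /andP[ac cb].
have cb' : c + e0 <= b by lra.
exists (g c).
  have w0' : {ae mu, forall x, `]c, (c + e0)%R[%classic x -> 0 < w x}.
    apply: filterS w0; first exact: (ae_filter_ringOfSetsType mu).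
    move=> x /= h; rewrite in_itv/= => /andP[cx xc]; apply: h.
    by rewrite in_itv/= (le_lt_trans ac)// (lt_le_trans xc).
  have p1 : primitive c (c + e0) (fun=> 1 : R) (fun=> 0).
    split; first exact: oc_integrable_cst.
    by move=> x /andP[cx _]; rewrite oc_int_cst// mul0r addr0.
  have := @oc_int_weight_gt0 _ c (c + e0) w (fun=> 1) _ c _ _ w0' p1.
  rewrite gE//; rewrite (@eq_oc_int _ _ _ _ w); last by move=> x _; rewrite expr1n mulr1.
  apply; rewrite ?ltrDl ?lexx ?lerDl ?(ltW e00) ?oner_neq0//.
  exact: oc_integrableS wi.
move=> c' ac' c'b; rewrite -gE//; apply: Hc.
by rewrite in_itv/= ac'; lra.
Qed.

End WeightedEstimates.

Section LowerBound.
Context {R : realType}.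
Local Notation mu := (@lebesgue_measure R).
Local Notation C := R[i].
Local Notation Re := (@complex.Re _).
Local Notation Im := (@complex.Im _).
Local Notation E := (symplE R).

Definition normsq (p : C) : R := Re p ^+ 2 + Im p ^+ 2.

Lemma normsq_ge0 p : 0 <= normsq p. Proof. by rewrite addr_ge0 ?sqr_ge0. Qed.

Lemma Re_form_le (p z q : C) :
  Re (Num.conj p * z * q) <= (`|Re z| + `|Im z|) * (normsq p + normsq q).
Proof.
rewrite !(ReM, ImM, ReC, ImC) /normsq.
set p1 := Re p; set p2 := Im p; set q1 := Re q; set q2 := Im q.
have T (w s r : R) : `|s| <= r -> w * s <= `|w| * r.
  move=> sr; apply: le_trans (ler_norm _) _; rewrite normrM; exact: ler_wpM2l.
have h1 : Re z * (p1 * q1 + p2 * q2) <= `|Re z| * (p1 ^+ 2 + p2 ^+ 2 + (q1 ^+ 2 + q2 ^+ 2)).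
  apply: T; rewrite ler_norml; apply/andP; split; rewrite -subr_ge0.
    rewrite [leRHS](_ : _ = ((p1 + q1) ^+ 2 + (p2 + q2) ^+ 2 +
     (p1 ^+ 2 + p2 ^+ 2 + q1 ^+ 2 + q2 ^+ 2)) / 2); last by field.
    by rewrite divr_ge0// !addr_ge0// sqr_ge0.
  rewrite [leRHS](_ : _ = ((p1 - q1) ^+ 2 + (p2 - q2) ^+ 2 +
     (p1 ^+ 2 + p2 ^+ 2 + q1 ^+ 2 + q2 ^+ 2)) / 2); last by field.
  by rewrite divr_ge0// !addr_ge0// sqr_ge0.
have h2 : Im z * (p2 * q1 - p1 * q2) <= `|Im z| * (p1 ^+ 2 + p2 ^+ 2 + (q1 ^+ 2 + q2 ^+ 2)).
  apply: T; rewrite ler_norml; apply/andP; split; rewrite -subr_ge0.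
    rewrite [leRHS](_ : _ = ((p2 + q1) ^+ 2 + (p1 - q2) ^+ 2 +
     (p1 ^+ 2 + p2 ^+ 2 + q1 ^+ 2 + q2 ^+ 2)) / 2); last by field.
    by rewrite divr_ge0// !addr_ge0// sqr_ge0.
  rewrite [leRHS](_ : _ = ((p2 - q1) ^+ 2 + (p1 + q2) ^+ 2 +
     (p1 ^+ 2 + p2 ^+ 2 + q1 ^+ 2 + q2 ^+ 2)) / 2); last by field.
  by rewrite divr_ge0// !addr_ge0// sqr_ge0.
lra.
Qed.

Lemma Re_form_sum (Z : 'M[C]_2) (w : 'cV[C]_2) : Re ((w ^t* *m Z *m w) 0 0) =
  \sum_j \sum_i Re (Num.conj (w i 0) * Z i j * w j 0).
Proof. by rewrite mxE !big_ord2 !mxE !big_ord2 !mxE -!ReD; congr Re; ring. Qed.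

Section Boundary.
Variables (A B : 'M[C]_2).
Hypothesis hAB : selfadjoint_bc A B.

(* On the Lagrangian plane of the boundary condition the quasi-derivatives enter the
   boundary form only through the values of the function: the form vanishes on the
   kernel of [(y(a), y(b))], so it factors through it. *)
Lemma boundary_form_bound : exists2 K : R, 0 <= K & forall u v : 'cV[C]_2,
  A *m u + B *m v = 0 ->
  Re (Num.conj (v 0 0) * v 1 0) - Re (Num.conj (u 0 0) * u 1 0) <=
  K * (normsq (u 0 0) + normsq (v 0 0)).
Proof.
have [rAB sAB] := hAB.
(* For [(u, v)] parametrized by [c] as in [bc_kernel], [P c] is [(- y(a), y(b))] and [Q c] is
   [(y1(a), y1(b))], so the boundary form is [c^H P^H Q c]. *)
pose P : 'M[C]_2 := \matrix_(i, j) (if i == 0 then Num.conj (A j 1) else Num.conj (B j 1)).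
pose Q : 'M[C]_2 := \matrix_(i, j) (if i == 0 then Num.conj (A j 0) else - Num.conj (B j 0)).
have PQ : P ^t* *m Q = Q ^t* *m P.
  apply/matrixP => i j; have /matrixP/(_ i j) := sAB.
  have conjNK (x : C) : Num.conj (- Num.conj x) = - x.
    by apply: eq_ReIm; rewrite !(ReC, ImC, ReN, ImN, opprK).
  rewrite !mxE !big_ord2 !mxE !big_ord2 !mxE /= !conjNK !conjCK => H.
  apply/eqP; rewrite -subr_eq0; apply/eqP; move/eqP: H; rewrite -subr_eq0 => /eqP H.
  by rewrite -[RHS]H; ring.
(* As [P^H Q = Q^H P], its rows lie in the row space of [P], and a pseudo-inverse of [P] factors it
   on both sides. *)
have [V h1] : exists V : 'M[C]_2, P ^t* *m Q *m V *m P = P ^t* *m Q.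
  by exists (pinvmx P); apply: mulmxKpV; rewrite PQ; exact: submxMl.
pose Z := V ^t* *m (P ^t* *m Q) *m V.
have HZ : P ^t* *m Q = P ^t* *m Z *m P.
  have h2 : P ^t* *m V ^t* *m (P ^t* *m Q) = P ^t* *m Q.
    have := congr1 (fun M : 'M[C]_2 => M ^t*) h1.
    by rewrite !trC_mul trmxCK -PQ mulmxA.
  by rewrite /Z !mulmxA -(mulmxA _ (P ^t*) Q) h2 h1.
pose K : R := \sum_i \sum_j (`|Re (Z i j)| + `|Im (Z i j)|).
have K0 : 0 <= K by rewrite sumr_ge0// => i _; rewrite sumr_ge0// => j _; rewrite addr_ge0.
exists (2 * K); first by rewrite mulr_ge0.
move=> u v uv0.
have [c [uE vE]] := bc_kernel symplE_sqr rAB sAB uv0.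
pose w := P *m c.
have u0 : u 0 0 = - w 0 0.
  by rewrite uE /w -mulmxA !mxE !big_ord2 !mxE !big_ord2 !mxE/=; ring.
have v0 : v 0 0 = w 1 0.
  by rewrite vE /w -mulmxA !mxE !big_ord2 !mxE !big_ord2 !mxE/=; ring.
have u1 : u 1 0 = (Q *m c) 0 0.
  by rewrite uE -mulmxA !mxE !big_ord2 !mxE !big_ord2 !mxE/=; ring.
have v1 : v 1 0 = (Q *m c) 1 0.
  by rewrite vE -mulmxA !mxE !big_ord2 !mxE !big_ord2 !mxE/=; ring.
have F : Num.conj (v 0 0) * v 1 0 - Num.conj (u 0 0) * u 1 0 = (w ^t* *m Z *m w) 0 0.
  have -> : w ^t* *m Z *m w = w ^t* *m (Q *m c).
    have -> : w ^t* *m Z *m w = c ^t* *m (P ^t* *m Z *m P) *m c.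
      by rewrite /w trC_mul !mulmxA.
    by rewrite -HZ /w trC_mul !mulmxA.
  rewrite [RHS]mxE big_ord2 ![(w ^t*) _ _]mxE ![w^T _ _]mxE u0 v0 u1 v1 rmorphN; ring.
rewrite -[- Re _]ReN -ReD F u0 v0.
have -> : normsq (- w 0 0) = normsq (w 0 0) by rewrite /normsq ReN ImN !sqrrN.
set s := normsq (w 0 0) + normsq (w 1 0).
have ns i : normsq (w i 0) <= s.
  by elim/ord2P: i; rewrite /s ?lerDl ?lerDr normsq_ge0.
have -> : Re ((w ^t* *m Z *m w) 0 0) =
    \sum_j \sum_i Re (Num.conj (w i 0) * Z i j * w j 0).
  exact: Re_form_sum.
rewrite /K mulr_sumr mulr_suml exchange_big /=; apply: ler_sum => i _.
rewrite mulr_sumr mulr_suml; apply: ler_sum => j _.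
apply: le_trans (Re_form_le _ _ _) _.
have := lerD (ns i) (ns j); set k := _ + `|Im _| => h.
have k0 : 0 <= k by rewrite addr_ge0.
have := ler_wpM2l k0 h; lra.
Qed.

Variables (a b : R).
Hypothesis ab : a < b.
Local Notation dist := (coef_dist a b).
Local Notation S := (coef_space a b).

(** For an eigenfunction, [l] times the integral of r |y|^2 is the energy plus the [q] term minus
    the boundary form. The last two together are at least [- M * s2], where [s2], supplied by
    [sl_sup_estimate], is a multiple of the energy small enough to be absorbed plus a multiple of
    the integral of r |y|^2. *)
Lemma eigenvalue_lower_bound om0 : S om0 -> exists2 e : R, 0 < e & exists L : R,
  forall om l, S om -> dist om om0 < e -> is_eigenvalue a b A B om l%:C -> L <= l.
Proof.
move=> S0; have [K K0 HK] := boundary_form_bound.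
pose Q1 := oc_int a b (fun t => `|coef_q om0 t|) + 1.
have Q10 : 0 <= Q1 by rewrite addr_ge0//; apply: oc_int_ge0.
pose M := Q1 + 2 * K; have M0 : 0 <= M by rewrite addr_ge0// mulr_ge0.
(* Chosen so that [M * (8 * ep) <= 1], which absorbs the energy. *)
pose ep := (8 * (M + 1))^-1.
have ep0 : 0 < ep by rewrite invr_gt0 mulr_gt0// ltr_wpDl.
have ep2 : 0 < ep / 2 by rewrite divr_gt0.
have q4 : 0 < 4^-1 :> R by rewrite invr_gt0.
have [d1 d10 H1] := oc_int_small_itv (cf_P_integrable S0) ep2.
have [d2 d20 H2] := oc_int_small_itv (coef_s_integrable S0) q4.
(* On windows of length [e0] the integrals of |1/p| and |s| for [om0] are below [ep / 2] and [1/4],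
   half of what [sl_sup_estimate] allows; the other half is left for the perturbation. *)
pose e0 : R := Num.min (Num.min d1 d2) (b - a) / 2.
have m0 : 0 < Num.min (Num.min d1 d2) (b - a) by rewrite !lt_min d10 d20 subr_gt0.
have e00 : 0 < e0 by rewrite divr_gt0.
have [m1 m2 m3] : [/\ e0 < d1, e0 < d2 & e0 <= b - a].
  have h1 : Num.min (Num.min d1 d2) (b - a) <= d1 by rewrite !ge_min lexx.
  have h2 : Num.min (Num.min d1 d2) (b - a) <= d2 by rewrite !ge_min lexx !orbT.
  have h3 : Num.min (Num.min d1 d2) (b - a) <= b - a by rewrite !ge_min lexx !orbT.
  by rewrite /e0; split; lra.
have [rho0 rho00 Hrho] := uniform_cover ab (coef_r_integrable S0) (coef_r_gt0 S0) e00 m3.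
pose rho : R := rho0 / 2; have rhop : 0 < rho by rewrite divr_gt0.
(* In order: the perturbation allowed to 1/p, [s], [r] and [q]. *)
exists (Num.min (Num.min (ep / 2) 4^-1) (Num.min rho 1)).
  by rewrite !lt_min ep2 q4 rhop ltr01.
exists (- (8 * M / rho)) => om l So.
rewrite !lt_min => /andP[/andP[dP ds] /andP[dr dq]] [y [y1 sol bc] [x0 x0ab yx0]].
have [sr si] := is_solution_sl_sol ab So sol.
have T (p q : R) : `|p| <= `|q| + `|p - q|.
  by rewrite -{1}(subrK q p) addrC ler_normD.
have close (f : coefficients R -> R -> R) u v : a <= u -> u <= v -> v <= b ->
    oc_integrable a b (f om) -> oc_integrable a b (f om0) ->
    (forall t, `|f om t - f om0 t| <= coef_diff om om0 t) ->
    oc_int u v (fun t => `|f om t|) <= oc_int u v (fun t => `|f om0 t|) + dist om om0 /\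
    oc_int u v (fun t => `|f om0 t|) <= oc_int u v (fun t => `|f om t|) + dist om om0.
  move=> au uv vb fi fi0 fd.
  have di := oc_integrableB fi fi0.
  have fiu := oc_integrable_norm (oc_integrableS au vb fi).
  have fi0u := oc_integrable_norm (oc_integrableS au vb fi0).
  have diu := oc_integrable_norm (oc_integrableS au vb di).
  have h := coef_dist_le So S0 au uv vb di fd.
  split.
    apply: (@le_trans _ _ (oc_int u v (fun t => `|f om0 t| + `|f om t - f om0 t|))).
      by apply: le_oc_int => //; exact: oc_integrableD.
    by rewrite oc_intD// lerD2l.
  apply: (@le_trans _ _ (oc_int u v (fun t => `|f om t| + `|f om t - f om0 t|))).
    by apply: le_oc_int => //; [exact: oc_integrableD|move=> t _; rewrite distrC].
  by rewrite oc_intD// lerD2l.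
have Pi := cf_P_integrable So; have si' := coef_s_integrable So.
have qi := coef_q_integrable So; have ri := coef_r_integrable So.
have sup (f f1 : R -> R) : sl_sol a b om l f f1 -> forall x, a <= x <= b ->
   f x ^+ 2 <= 8 * ep * oc_int a b (fun t => `|cf_P om t| * f1 t ^+ 2) +
    8 / rho * oc_int a b (fun t => `|coef_r om t| * f t ^+ 2).
  move=> fsol x /andP[ax xb].
  have [c [ac cb cx xc]] := subitv_containing e00 m3 ax xb.
  have cc : c <= c + e0 by rewrite lerDl ltW.
  have cE : c + e0 - c = e0 by rewrite addrAC subrr add0r.
  have cd1 : c + e0 - c < d1 by rewrite cE.
  have cd2 : c + e0 - c < d2 by rewrite cE.
  apply: (sl_sup_estimate ac cc cb ep0 rhop Pi si' ri fsol); last by rewrite cx.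
  - have [h _] := close cf_P _ _ ac cc cb Pi (cf_P_integrable S0) (cf_P_diff om om0).
    have h' := H1 _ _ ac cc cb cd1.
    by apply: le_trans h _; rewrite [leRHS]splitr ltW// ltrD.
  - have [h _] := close (@coef_s R) _ _ ac cc cb si' (coef_s_integrable S0) (coef_s_diff om om0).
    have h' := H2 _ _ ac cc cb cd2.
    apply: le_trans h _; apply: ltW; apply: lt_le_trans (ltrD h' ds) _.
    lra.
  - have [_ h] := close (@coef_r R) _ _ ac cc cb ri (coef_r_integrable S0) (coef_r_diff om om0).
    have h' := Hrho c ac cb.
    have h'' : oc_int c (c + e0) (coef_r om0) <= oc_int c (c + e0) (fun t => `|coef_r om0 t|).
      have r0i := oc_integrableS ac cb (coef_r_integrable S0).
      apply: le_oc_int => //; first exact: oc_integrable_norm.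
      by move=> t _; exact: ler_norm.
    rewrite /rho in dr *; lra.
have Q1b : oc_int a b (fun t => `|coef_q om t|) <= Q1.
  have [h _] := close (@coef_q R) _ _ (lexx a) (ltW ab) (lexx b) qi (coef_q_integrable S0)
    (coef_q_diff om om0).
  by rewrite /Q1; lra.
have energy (f f1 : R -> R) : sl_sol a b om l f f1 ->
  l * oc_int a b (fun t => `|coef_r om t| * f t ^+ 2) >=
  oc_int a b (fun t => `|cf_P om t| * f1 t ^+ 2) -
  Q1 * (8 * ep * oc_int a b (fun t => `|cf_P om t| * f1 t ^+ 2) +
    8 / rho * oc_int a b (fun t => `|coef_r om t| * f t ^+ 2)) - (f b * f1 b - f a * f1 a).
  move=> fsol; have [pf pf1] := fsol.
  have mf := primitive_bounded_measurable pf; have mf1 := primitive_bounded_measurable pf1.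
  have mf2 : bounded_measurable a b (fun t => f t ^+ 2) := bounded_measurableM mf mf.
  have mf12 : bounded_measurable a b (fun t => f1 t ^+ 2) := bounded_measurableM mf1 mf1.
  set s2 := 8 * ep * _ + _.
  rewrite -(oc_int_weight_norm ri mf2 (coef_r_gt0 So)).
  rewrite -(oc_int_weight_norm Pi mf12 (cf_P_gt0 So)).
  rewrite (sl_energy (ltW ab) fsol) /cf_Q.
  have i1 := bounded_measurable_integrableM mf12 Pi.
  have i2 := bounded_measurable_integrableM mf2 qi.
  have i3 := bounded_measurable_integrableM mf2 ri.
  rewrite (@eq_oc_int _ _ _ (fun t => cf_P om t * f1 t ^+ 2 +
    (coef_q om t - l * coef_r om t) * f t ^+ 2) (fun t => cf_P om t * f1 t ^+ 2 +
    coef_q om t * f t ^+ 2 - l * (coef_r om t * f t ^+ 2))); last by move=> t _; ring.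
  rewrite oc_intB; [|exact: oc_integrableD|exact: oc_integrableZ].
  rewrite oc_intD// oc_intZ//.
  have s20 : 0 <= s2.
    have aa : a <= a <= b by rewrite lexx ltW.
    by apply: le_trans (sup f f1 fsol a aa); exact: sqr_ge0.
  have : - oc_int a b (fun t => coef_q om t * f t ^+ 2) <= Q1 * s2.
    rewrite -oc_intN//; apply: (@le_trans _ _ (oc_int a b (fun t => s2 * `|coef_q om t|))).
      apply: le_oc_int; [exact: oc_integrableN|exact/oc_integrableZ/oc_integrable_norm|].
      move=> t /andP[/ltW ta tb]; apply: le_trans (ler_norm _) _.
      rewrite normrN normrM mulrC ler_wpM2r// ger0_norm ?sqr_ge0//.
      by apply: sup; rewrite ?ta.
    rewrite oc_intZ; last exact: oc_integrable_norm.
    by rewrite mulrC ler_wpM2r.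
  lra.
have er := energy _ _ sr; have ei := energy _ _ si.
set Er := oc_int a b (fun t => `|cf_P om t| * Re (y1 t) ^+ 2) in er.
set Ei := oc_int a b (fun t => `|cf_P om t| * Im (y1 t) ^+ 2) in ei.
set Rr := oc_int a b (fun t => `|coef_r om t| * Re (y t) ^+ 2) in er.
set Ri := oc_int a b (fun t => `|coef_r om t| * Im (y t) ^+ 2) in ei.
have Er0 : 0 <= Er by apply: oc_int_ge0 => t _; rewrite mulr_ge0// sqr_ge0.
have Ei0 : 0 <= Ei by apply: oc_int_ge0 => t _; rewrite mulr_ge0// sqr_ge0.
have Rr0 : 0 <= Rr by apply: oc_int_ge0 => t _; rewrite mulr_ge0// sqr_ge0.
have Ri0 : 0 <= Ri by apply: oc_int_ge0 => t _; rewrite mulr_ge0// sqr_ge0.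
set s2 := 8 * ep * (Er + Ei) + 8 / rho * (Rr + Ri).
have bform : (Re (y b) * Re (y1 b) - Re (y a) * Re (y1 a)) +
   (Im (y b) * Im (y1 b) - Im (y a) * Im (y1 a)) <= 2 * K * s2.
  have := HK _ _ bc; rewrite !mxE/= !(ReM, ReC, ImC) /normsq => h.
  have aa : a <= a <= b by rewrite lexx ltW.
  have bb : a <= b <= b by rewrite lexx ltW.
  have h1 := sup _ _ sr a aa; have h2 := sup _ _ si a aa.
  have h3 := sup _ _ sr b bb; have h4 := sup _ _ si b bb.
  rewrite -/Er -/Rr in h1 h3; rewrite -/Ei -/Ri in h2 h4.
  have h5 : Re (y a) ^+ 2 + Im (y a) ^+ 2 + (Re (y b) ^+ 2 + Im (y b) ^+ 2) <= 2 * s2.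
    by rewrite /s2; lra.
  have := ler_wpM2l K0 h5; lra.
have Rpos : 0 < Rr + Ri.
  have pos (f f1 : R -> R) : sl_sol a b om l f f1 -> f x0 != 0 ->
      0 < oc_int a b (fun t => `|coef_r om t| * f t ^+ 2).
    move=> [pf _] fx0; have mf := primitive_bounded_measurable pf.
    have mf2 : bounded_measurable a b (fun t => f t ^+ 2) := bounded_measurableM mf mf.
    rewrite -(oc_int_weight_norm ri mf2 (coef_r_gt0 So)).
    apply: (oc_int_weight_gt0 ab ri (coef_r_gt0 So) pf _ fx0).
    by move: x0ab; rewrite /= in_itv.
  move: yx0; rewrite eq_complex negb_and => /orP[h|h].
    by rewrite ltr_wpDr//; exact: pos sr h.
  by rewrite ltr_wpDl//; exact: pos si h.
have main : - (8 * M / rho) * (Rr + Ri) <= l * (Rr + Ri).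
  have epM : M * (8 * ep) <= 1.
    have -> : M * (8 * ep) = M / (M + 1) by rewrite /ep; field; rewrite gt_eqF// ltr_wpDl.
    by rewrite ler_pdivrMr ?ltr_wpDl// mul1r lerDl.
  have h : M * (8 * ep) * (Er + Ei) <= Er + Ei by rewrite ler_piMl// addr_ge0.
  have h' : M * s2 = M * (8 * ep) * (Er + Ei) + 8 * M / rho * (Rr + Ri).
    by rewrite /s2; ring.
  have h'' : M * s2 = Q1 * s2 + 2 * K * s2 by rewrite /M; ring.
  have h3 : Q1 * s2 = Q1 * (8 * ep * Er + 8 / rho * Rr) + Q1 * (8 * ep * Ei + 8 / rho * Ri).
    by rewrite /s2; ring.
  lra.
by rewrite -(ler_pM2r Rpos).
Qed.

End Boundary.

End LowerBound.

(** * Counting eigenvalues *)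

Section Counting.
Context {R : realType}.
Implicit Types (lam : nat -> R) (x y z : R) (N : nat).

(** [N] is the number of terms below [x]: for a non-decreasing sequence they form an initial segment
    of the indices. *)
Definition count_lt lam x N := forall k, (k < N)%N = (lam k < x).

Lemma count_lt_exists lam x : {homo lam : n m / (n <= m)%N >-> n <= m} ->
  lam n @[n --> \oo] --> +oo -> exists N, count_lt lam x N.
Proof.
move=> mono /cvgryPge /(_ x)[M _ HM].
have ex : exists n, x <= lam n by exists M; apply: HM => /=.
exists (ex_minn ex); case: ex_minnP => N xN minN k.
apply/idP/idP => [kN|]; first by rewrite ltNge; apply/negP => /minN; rewrite leqNgt kN.
by rewrite ltNge; apply: contraNT; rewrite -leqNgt => /mono; exact: le_trans.
Qed.

(** The indices at which [z] is taken are those from [Nx] up to, but excluding, [Ny]. *)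
Lemma count_lt_jump lam x y z m Nx Ny : {homo lam : n m / (n <= m)%N >-> n <= m} ->
  x < z -> z < y -> (forall k, x <= lam k -> lam k < y -> lam k = z) ->
  ([set k | lam k = z] #= `I_m)%card -> count_lt lam x Nx -> count_lt lam y Ny ->
  Ny = (Nx + m)%N.
Proof.
move=> mono xz zy only cm cx cy.
have NxNy : (Nx <= Ny)%N.
  rewrite leqNgt; apply/negP => h; have : (Ny < Nx)%N := h.
  rewrite cx => /lt_trans/(_ (lt_trans xz zy)); by rewrite -cy ltnn.
have E : [set k | lam k = z] = [set k | (Nx <= k < Ny)%N].
  apply/seteqP; split => k /=.
    by move=> kz; rewrite leqNgt cx cy kz zy andbT -leNgt ltW.
  by rewrite leqNgt cx cy -leNgt => /andP[xk ky]; exact: only.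
have cE : ([set k | (Nx <= k < Ny)%N] #= `I_(Ny - Nx))%card.
  have -> : [set k | (Nx <= k < Ny)%N] = (addn Nx) @` `I_(Ny - Nx).
    apply/seteqP; split => k /=.
      move=> /andP[h1 h2]; exists (k - Nx)%N => /=; last by rewrite subnKC.
      by rewrite ltn_sub2r// (leq_ltn_trans h1).
    by move=> [j /= hj <-]; rewrite leq_addr/= -ltn_subRL.
  by apply: inj_card_eq => i j _ _; exact: addnI.
rewrite E in cm.
have : (`I_m #= `I_(Ny - Nx))%card by apply: card_eq_trans cE; rewrite card_eq_sym.
by move=> /card_eq_II ->; rewrite subnKC.
Qed.

(** Each branch is continuous and strictly increasing, so between [x] and [y] it vanishes exactly
    when it changes sign, and then once. The interval is cut so that each piece contains at most one
    point of the spectrum, whose multiplicity counts the branches vanishing there. *)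
Lemma count_lt_crossing lam (h : bool -> R -> R) x y Nx Ny :
  {homo lam : n m / (n <= m)%N >-> n <= m} -> lam n @[n --> \oo] --> +oo ->
  x < y -> (forall s, {within `[x, y], continuous (h s)}) ->
  (forall s u v, x <= u -> u < v -> v <= y -> h s u < h s v) ->
  (forall l, x <= l <= y ->
    ([set k | lam k = l] #= `I_((h false l == 0%R) + (h true l == 0%R)))%card) ->
  (forall s, h s x != 0) -> (forall s, h s y != 0) ->
  count_lt lam x Nx -> count_lt lam y Ny ->
  Ny = (Nx + ((h false x < 0 < h false y)%R + (h true x < 0 < h true y)%R))%N.
Proof.
move=> mono lamy xy hc hmono hm hx hy cx cy.
have zero s : (h s x < 0 < h s y)%R -> exists2 z, x < z < y & h s z = 0.
  move=> /andP[hx0 hy0]; have [|z] := @IVT R (h s) x y 0 (ltW xy) (hc s).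
    by rewrite ge_min le_max (ltW hx0) (ltW hy0) orbT.
  rewrite in_itv/= => /andP[xz zy] hz; exists z => //; rewrite !lt_neqAle xz zy !andbT.
  apply/andP; split; apply/eqP => e; [move: (hx s)|move: (hy s)].
    by rewrite e hz eqxx.
  by rewrite -e hz eqxx.
have inj s u v : x <= u <= y -> x <= v <= y -> h s u = 0 -> h s v = 0 -> u = v.
  move=> /andP[xu uy] /andP[xv vy] hu hv; case: (ltgtP u v) => // uv.
    by have := hmono s u v xu uv vy; rewrite hu hv ltxx.
  by have := hmono s v u xv uv uy; rewrite hu hv ltxx.
have nozero s : (h s x < 0 < h s y)%R = false -> forall u, x <= u <= y -> h s u != 0.
  move=> F u /andP[xu uy]; apply/eqP => hu; move/negP: F; apply; apply/andP; split.
    move: xu; rewrite le_eqVlt => /orP[/eqP xu|xu]; last by rewrite -hu hmono.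
    by move: (hx s); rewrite xu hu eqxx.
  move: uy; rewrite le_eqVlt => /orP[/eqP uy|uy]; last by rewrite -hu hmono.
  by move: (hy s); rewrite -uy hu eqxx.
have ev k : x <= lam k <= y -> exists s, h s (lam k) = 0.
  move=> kxy; have := hm _ kxy; case: eqP => [e _|_]; first by exists false.
  case: eqP => [e _|_]; first by exists true.
  rewrite II0 card_eq0 => /eqP e; have : [set k0 | lam k0 = lam k] k by [].
  by rewrite e.
(* A piece whose only possible spectral point is [z], which may have multiplicity 0. *)
have block u v z Nu Nv : x <= u -> v <= y -> u < z -> z < v ->
    (forall s w, u <= w <= v -> h s w = 0 -> w = z) ->
    count_lt lam u Nu -> count_lt lam v Nv ->
    Nv = (Nu + ((h false z == 0%R) + (h true z == 0%R)))%N.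
  move=> xu vy uz zv only cu cv.
  apply: (count_lt_jump mono uz zv) => // [k uk kv|].
    have [|s hs] := ev k; first by rewrite (le_trans xu)//= (le_trans (ltW kv)).
    by apply: (only s); rewrite ?uk ?ltW.
  by apply: hm; rewrite (le_trans xu (ltW uz)) (le_trans (ltW zv)).
(* Two simple eigenvalues, one on each branch: cut halfway between them. *)
have two (s : bool) z0 z1 : x < z0 -> z0 < z1 -> z1 < y -> h s z0 = 0 ->
    h (~~ s) z1 = 0 -> Ny = (Nx + 2)%N.
  move=> xz0 z01 z1y h0 h1; pose w := (z0 + z1) / 2.
  have z0w : z0 < w by rewrite /w; lra.
  have wz1 : w < z1 by rewrite /w; lra.
  have [Nw cw] := count_lt_exists w mono lamy.
  have z0xy : x <= z0 <= y by rewrite (ltW xz0) ltW// (lt_trans z01).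
  have z1xy : x <= z1 <= y by rewrite (ltW z1y) ltW// (lt_trans xz0).
  have o0 s' u : x <= u <= w -> h s' u = 0 -> u = z0.
    move=> /andP[xu uw] hu; have uxy : x <= u <= y by rewrite xu; lra.
    have [e|e] : s' = s \/ s' = ~~ s by case: s' s {h0 h1 hu} => [][]; auto.
      by apply: (inj s) => //; rewrite -e.
    have : u = z1 by apply: (inj (~~ s)) => //; rewrite -e.
    lra.
  have o1 s' u : w <= u <= y -> h s' u = 0 -> u = z1.
    move=> /andP[wu uy] hu; have uxy : x <= u <= y by rewrite uy andbT; lra.
    have [e|e] : s' = s \/ s' = ~~ s by case: s' s {h0 h1 hu o0} => [][]; auto.
      have : u = z0 by apply: (inj s) => //; rewrite -e.
      lra.
    by apply: (inj (~~ s)) => //; rewrite -e.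
  have B0 := block x w z0 Nx Nw (lexx x) ltac:(lra) xz0 z0w o0 cx cw.
  have B1 := block w y z1 Nw Ny ltac:(lra) (lexx y) wz1 z1y o1 cw cy.
  have n0 : h (~~ s) z0 != 0.
    by apply/eqP => e; have := inj (~~ s) z0 z1 z0xy z1xy e h1; lra.
  have n1 : h s z1 != 0.
    by apply/eqP => e; have := inj s z0 z1 z0xy z1xy h0 e; lra.
  rewrite B1 B0; case: s h0 h1 n0 n1 {o0 o1} => /= -> -> /negbTE -> /negbTE ->;
    by rewrite eqxx !addn0 ?add0n -addnA.
case e0 : (h false x < 0 < h false y)%R; case e1 : (h true x < 0 < h true y)%R.
- have [z0 /andP[xz0 z0y] h0] := zero _ e0; have [z1 /andP[xz1 z1y] h1] := zero _ e1.
  case: (ltgtP z0 z1) => z01; first exact: (two false z0 z1).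
    exact: (two true z1 z0).
  have := block x y z0 Nx Ny (lexx x) (lexx y) xz0 z0y _ cx cy.
  rewrite h0 {2}z01 h1 eqxx; apply => -[] u uxy hu.
    by rewrite z01; apply: (inj true) => //; rewrite (ltW xz1) ltW.
  by apply: (inj false) => //; rewrite (ltW xz0) ltW.
- have [z0 /andP[xz0 z0y] h0] := zero _ e0.
  have := block x y z0 Nx Ny (lexx x) (lexx y) xz0 z0y _ cx cy.
  have z0xy : x <= z0 <= y by rewrite (ltW xz0) ltW.
  rewrite h0 eqxx (negbTE (nozero _ e1 z0 z0xy)); apply => -[] u uxy hu.
    by move: (nozero _ e1 u uxy); rewrite hu eqxx.
  exact: (inj false).
- have [z1 /andP[xz1 z1y] h1] := zero _ e1.
  have := block x y z1 Nx Ny (lexx x) (lexx y) xz1 z1y _ cx cy.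
  have z1xy : x <= z1 <= y by rewrite (ltW xz1) ltW.
  rewrite h1 eqxx (negbTE (nozero _ e0 z1 z1xy)); apply => -[] u uxy hu.
    exact: (inj true).
  by move: (nozero _ e0 u uxy); rewrite hu eqxx.
(* No branch vanishes: any interior point serves, with jump 0. *)
- pose z := (x + y) / 2.
  have xz : x < z by rewrite /z; lra.
  have zy : z < y by rewrite /z; lra.
  have zxy : x <= z <= y by rewrite (ltW xz) ltW.
  have := block x y z Nx Ny (lexx x) (lexx y) xz zy _ cx cy.
  rewrite (negbTE (nozero _ e0 z zxy)) (negbTE (nozero _ e1 z zxy)); apply => -[] u uxy hu.
    by move: (nozero _ e1 u uxy); rewrite hu eqxx.
  by move: (nozero _ e0 u uxy); rewrite hu eqxx.
Qed.

End Counting.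

(** * Local constancy of the counting function *)

Section Stability.
Context {R : realType}.
Variables (a b : R) (A B : 'M[R[i]]_2) (lam : coefficients R -> nat -> R).
Hypotheses (ab : a < b) (hAB : selfadjoint_bc A B).
Hypothesis hlam : forall om, coef_space a b om ->
  is_eigenvalue_sequence a b A B om (lam om).
Variable om0 : coefficients R.
Hypothesis S0 : coef_space a b om0.
Local Notation dist := (coef_dist a b).
Local Notation S := (coef_space a b).

Let mono om (So : S om) : {homo lam om : n m / (n <= m)%N >-> n <= m}.
Proof. by have [h _ _ _] := hlam So. Qed.

Let lamy om (So : S om) : lam om n @[n --> \oo] --> +oo.
Proof. by have [_ h _ _] := hlam So. Qed.

(** The premise sits inside, so the property holds trivially at spectral points of [om0] and the
    supremum argument can range over all reals. *)
Definition stable_count x := (forall k, lam om0 k != x) -> exists2 d : R, 0 < d &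
  forall om, S om -> dist om om0 < d ->
  forall N, count_lt (lam om0) x N -> count_lt (lam om) x N.

Let dist0 : dist om0 om0 = 0.
Proof.
rewrite coef_distE// (@eq_oc_int _ _ _ _ (fun=> 0)) ?oc_int_cst ?mul0r ?ltW// => t _.
by rewrite /coef_diff !subrr normr0 !addr0.
Qed.

(** Below the uniform lower bound the count is 0 for every nearby [om]. *)
Let stable_count_low : exists L : R, forall x, x < L -> stable_count x.
Proof.
have [e e0 [L HL]] := eigenvalue_lower_bound hAB ab S0.
exists L => x xL _; exists e => // om So dom N cN k.
have low om' k' : S om' -> dist om' om0 < e -> (lam om' k' < x) = false.
  move=> So' dom'; apply/negbTE; rewrite -leNgt (le_trans (ltW xL))//.
  apply: (HL om' _ So' dom'); have [_ _ ev _] := hlam So'.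
  by apply/ev; exists k'.
by rewrite cN !low// dist0.
Qed.

(** Inside the window of one chart, the count at [y] is the count at [x] plus the number of branches
    changing sign in between, and the signs at two non-spectral points persist for [om] near [om0].
    The first clause supplies such points. *)
Let local_count mu : exists2 e : R, 0 < e &
  (forall u v, mu - e < u -> u < v -> v < mu + e ->
    exists2 w, u < w < v & forall k, lam om0 k != w) /\
  (forall x y, mu - e < x -> x < y -> y < mu + e -> (forall k, lam om0 k != x) ->
    stable_count x -> stable_count y).
Proof.
have [e e0 [h [hrank hmono hcont hparam]]] := local_structure ab hAB mu S0.
have near_mu x : mu - e < x -> x < mu + e -> `|x - mu| < e.
  by move=> h1 h2; rewrite ltr_norml; apply/andP; split; lra.
have d00 : dist om0 om0 < e by rewrite dist0.
have cardE om l : S om -> dist om om0 < e -> `|l - mu| < e ->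
    ([set k | lam om k = l] #= `I_((h false om l == 0%R) + (h true om l == 0%R)))%card.
  by move=> So dom ll; rewrite -hrank//; exact: (eigenvalue_count ab l So (hlam So)).
have h0E l : `|l - mu| < e -> (forall k, lam om0 k != l) -> forall s, h s om0 l != 0.
  move=> ll nl s; have := cardE om0 l S0 d00 ll.
  have -> : [set k | lam om0 k = l] = set0.
    by apply/seteqP; split => // k /= kl; move: (nl k); rewrite kl eqxx.
  rewrite card_eq_sym card_eq0 => /eqP/seteqP[+ _] => /(_ 0%N)/= H.
  by apply/negP => hs; apply: H; case: s hs => ->; rewrite ?addn1.
exists e => //; split.
  move=> u v mu_u uv v_mu.
  have inj s x y : `|x - mu| < e -> `|y - mu| < e -> h s om0 x = 0 -> h s om0 y = 0 -> x = y.
    move=> hx hy zx zy; case: (ltgtP x y) => // xy.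
      by have := hmono s om0 x y S0 d00 hx hy xy; rewrite zx zy ltxx.
    by have := hmono s om0 y x S0 d00 hy hx xy; rewrite zx zy ltxx.
  have ev w : u < w < v -> (exists k, lam om0 k = w) -> exists s, h s om0 w = 0.
    move=> /andP[uw wv] [k kw]; apply: contrapT => H.
    have hw : `|w - mu| < e by apply: near_mu; lra.
    have := cardE om0 w S0 d00 hw.
    have -> : (h false om0 w == 0) = false by apply/eqP => e1; apply: H; exists false.
    have -> : (h true om0 w == 0) = false by apply/eqP => e1; apply: H; exists true.
    by rewrite II0 card_eq0 => /eqP/seteqP[+ _] => /(_ k kw).
  apply: contrapT => H.
  have all_ev w : u < w < v -> exists s, h s om0 w = 0.
    move=> uwv; apply: ev => //; apply: contrapT => K; apply: H; exists w => // k.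
    by apply/eqP => kw; apply: K; exists k.
  (* Three points against two branches: if all were spectral, one strictly increasing branch would
     vanish twice. *)
  pose p (i : nat) := u + (v - u) * i.+1%:R / 4.
  have pE : [/\ p 0%N = u + (v - u) / 4, p 1%N = u + (v - u) * 2 / 4 &
     p 2%N = u + (v - u) * 3 / 4] by rewrite /p mulr1.
  have [p0 p1 p2] := pE.
  have [s0 z0] : exists s, h s om0 (p 0%N) = 0 by apply: all_ev; rewrite p0; lra.
  have [s1 z1] : exists s, h s om0 (p 1%N) = 0 by apply: all_ev; rewrite p1; lra.
  have [s2 z2] : exists s, h s om0 (p 2%N) = 0 by apply: all_ev; rewrite p2; lra.
  have n0 : `|p 0%N - mu| < e by apply: near_mu; rewrite p0; lra.
  have n1 : `|p 1%N - mu| < e by apply: near_mu; rewrite p1; lra.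
  have n2 : `|p 2%N - mu| < e by apply: near_mu; rewrite p2; lra.
  have [E|[E|E]] : s0 = s1 \/ s1 = s2 \/ s0 = s2.
    by case: s0 s1 s2 {z0 z1 z2} => [][][]; auto.
  - by rewrite E in z0; have := inj s1 _ _ n0 n1 z0 z1; rewrite p0 p1; lra.
  - by rewrite E in z1; have := inj s2 _ _ n1 n2 z1 z2; rewrite p1 p2; lra.
  - by rewrite E in z0; have := inj s2 _ _ n0 n2 z0 z2; rewrite p0 p2; lra.
move=> x y mu_x xy y_mu nx sx ny.
have hx : `|x - mu| < e by apply: near_mu; lra.
have hy : `|y - mu| < e by apply: near_mu; lra.
have [d1 d10 H1] := sx nx.
have sign l : `|l - mu| < e -> (forall k, lam om0 k != l) -> forall s,
    exists2 d, 0 < d & forall om, S om -> dist om om0 < d ->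
      [/\ h s om l != 0, (h s om l < 0) = (h s om0 l < 0) & (0 < h s om l) = (0 < h s om0 l)].
  move=> hl nl s; have z := h0E l hl nl s.
  have [|d d0 Hd] := hparam s l hl `|h s om0 l|; first by rewrite normr_gt0.
  exists d => // om So dom; have := Hd om So dom.
  move: z; rewrite neq_lt => /orP[z|z].
    rewrite (ltr0_norm z) ltr_norml => /andP[_ k]; have k' : h s om l < 0 by lra.
    by rewrite k' z lt_eqF// !ltNge !ltW.
  rewrite (gtr0_norm z) ltr_norml => /andP[k _]; have k' : 0 < h s om l by lra.
  by rewrite k' z gt_eqF// !ltNge !ltW.
have [dx0 dx00 Hx0] := sign x hx nx false; have [dx1 dx10 Hx1] := sign x hx nx true.
have [dy0 dy00 Hy0] := sign y hy ny false; have [dy1 dy10 Hy1] := sign y hy ny true.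
exists (Num.min (Num.min e d1) (Num.min (Num.min dx0 dx1) (Num.min dy0 dy1))).
  by rewrite !lt_min e0 d10 dx00 dx10 dy00.
move=> om So; rewrite !lt_min => /andP[/andP[de dd1]] /andP[/andP[k1 k2] /andP[k3 k4]] N cN.
have [a1 a2 a3] := Hx0 om So k1; have [a1' a2' a3'] := Hx1 om So k2.
have [b1 b2 b3] := Hy0 om So k3; have [b1' b2' b3'] := Hy1 om So k4.
have [Nx cx] := count_lt_exists x (mono S0) (lamy S0).
have [Ny' cy'] := count_lt_exists y (mono So) (lamy So).
have sub u : x <= u <= y -> `|u - mu| < e.
  by move=> /andP[xu uy]; apply: near_mu; lra.
have cross om' Na Nb : S om' -> dist om' om0 < e -> (forall s, h s om' x != 0) ->
   (forall s, h s om' y != 0) -> count_lt (lam om') x Na -> count_lt (lam om') y Nb ->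
   Nb = (Na + ((h false om' x < 0 < h false om' y)%R + (h true om' x < 0 < h true om' y)%R))%N.
  move=> So' d' zx zy ca cb.
  apply: (@count_lt_crossing _ (lam om') (fun s => h s om') x y) => //; [exact: mono|exact: lamy| | |].
  - move=> s; apply: continuous_in_subspaceT => u; rewrite inE/= in_itv/= => uxy.
    by apply: hcont => //; exact: sub.
  - move=> s u v xu uv vy; apply: hmono => //; apply: sub.
      by rewrite xu (le_trans (ltW uv)).
    by rewrite vy (le_trans xu (ltW uv)).
  - by move=> l lxy; apply: cardE => //; exact: sub.
have := cross om0 Nx N S0 d00 (h0E x hx nx) (h0E y hy ny) cx cN.
have := cross om Nx Ny' So de _ _ (H1 om So dd1 Nx cx) cy'.
rewrite a2 b3 a2' b3' => E1 E2.
have <- : Ny' = N by rewrite E1 ?E2//; case.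
by [].
Qed.

(** Real induction from the lower bound. If some [x] failed, the stable half-lines would be bounded
    above; at the supremum of their ends, [local_count] started from a non-spectral stable [w] just
    below it reaches beyond it. *)
Lemma stable_count_all x : stable_count x.
Proof.
have [L HL] := stable_count_low.
apply: contrapT => nsx.
pose G := [set y | forall z, z <= y -> stable_count z].
have GL : G (L - 1) by move=> z zL; apply: HL; lra.
have Gx : has_sup G.
  split; first by exists (L - 1).
  exists x => y Gy; rewrite leNgt; apply/negP => xy; apply: nsx; apply: Gy; exact: ltW.
have [e e0 [dense step]] := local_count (sup G).
have [g Gg gs] := sup_adherent e0 Gx.
have gsup : g <= sup G by apply: sup_upper_bound.
have [|||w /andP[w1 w2] nw] := dense ((sup G - e + g) / 2) g; [lra|lra|lra|].
have Gs : G (sup G + e / 2).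
  move=> z zs; have [zg|gz] := leP z g; first exact: Gg.
  by apply: (step w z) => //; [lra|lra|lra|apply: Gg; exact: ltW].
have : sup G + e / 2 <= sup G by apply: sup_upper_bound.
lra.
Qed.

Lemma nonspectral_point u v : u < v -> exists2 w, u < w < v & forall k, lam om0 k != w.
Proof.
move=> uv; have [e e0 [dense _]] := local_count u.
have m : u < Num.min v (u + e) by rewrite lt_min uv ltrDl.
have mv : Num.min v (u + e) <= v by rewrite ge_min lexx.
have me : Num.min v (u + e) <= u + e by rewrite ge_min lexx orbT.
pose u' := (u + Num.min v (u + e)) / 2; pose v' := (u' + Num.min v (u + e)) / 2.
have [|||w /andP[w1 w2] nw] := dense u' v'; [by rewrite /u'; lra|by rewrite /v' /u'; lra|
  by rewrite /v' /u'; lra|].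
by exists w => //; apply/andP; move: w1 w2; rewrite /v' /u'; split; lra.
Qed.

End Stability.

Theorem theorem7p1 (R : realType) (a b : R) (hab : a < b)
    (A B : 'M[R[i]]_2) (hAB : selfadjoint_bc A B)
    (lam : coefficients R -> nat -> R)
    (hlam : forall om, coef_space a b om ->
       is_eigenvalue_sequence a b A B om (lam om))
    (n : nat) :
  continuous_for (coef_space a b) (coef_dist a b) (fun om => lam om n).
Proof.
move=> om0 S0 eps eps0; set mu := lam om0 n.
have [mono0 lamy0 _ _] := hlam om0 S0.
(* Non-spectral points on either side of [mu], within [eps]: keeping the counts at both keeps the
   eigenvalue of index [n] between them. *)
have [|x /andP[x1 x2] nx] := nonspectral_point hab hAB hlam S0 (u := mu - eps) (v := mu).
  by lra.
have [|y /andP[y1 y2] ny] := nonspectral_point hab hAB hlam S0 (u := mu) (v := mu + eps).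
  by lra.
have [dx dx0 Hx] := stable_count_all hab hAB hlam S0 nx.
have [dy dy0 Hy] := stable_count_all hab hAB hlam S0 ny.
have [Nx cx] := count_lt_exists x mono0 lamy0.
have [Ny cy] := count_lt_exists y mono0 lamy0.
exists (Num.min dx dy); first by rewrite lt_min dx0.
move=> om So; rewrite lt_min => /andP[ddx ddy].
have h1 : x <= lam om n.
  by rewrite leNgt -(Hx om So ddx Nx cx) cx -leNgt; exact: ltW.
have h2 : lam om n < y by rewrite -(Hy om So ddy Ny cy) cy.
by rewrite ltr_norml -/mu; apply/andP; split; lra.
Qed.
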